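(* Let $t_1,t_2\ge0$ and $1\le k\le n$. Let $\mathbf{H}'^{(t_1,t_2)}_{(1^{k-1},n-k+1)}$ be the homogeneous component of $\mathbf{H}'_{(1^{k-1},n-k+1)}$ of total degree $t_1$ in $y_1,\dots,y_n$ and total degree $t_2$ in $x_1,\dots,x_n$. It decomposes into a direct sum of Solomon descent representations as follows: $$\mathbf{H}'^{(t_1,t_2)}_{(1^{k-1},n-k+1)}\cong\bigoplus_{\lambda}R_\lambda^{(k)}$$ as $S_n$-modules, where the sum is over all $(n,k)$-bipartitions $\lambda=(\mu,\nu)$ such that $$\sum_{k\le i<n,\ \nu_{n-i}>\nu_{n-i+1}}(n-i)=t_1,\qquad \sum_{1\le i<k,\ \mu_i>\mu_{i+1}}i=t_2 .$$
   Context: Let $\mathbf{Q}[\bar x,\bar y]=\mathbf{Q}[x_1,\dots,x_n,y_1,\dots,y_n]$ with $S_n$ acting by $\sigma(x_i)=x_{\sigma(i)}$, $\sigma(y_i)=y_{\sigma(i)}$. For the hook shape $\mu=(1^{k-1},n-k+1)$ let $\Delta_\mu$ be the determinant of the $n\times n$ matrix whose $i$-th row is $(1,y_i,\dots,y_i^{n-k},x_i,\dots,x_i^{k-1})$. Let $\mathbf{H}_\mu$ be the $\mathbf{Q}$-span of all partial derivatives (of all orders, including order $0$) of $\Delta_\mu$. Let $\langle f,g\rangle$ be the constant term of $f(\partial_{x_1},\dots,\partial_{x_n};\partial_{y_1},\dots,\partial_{y_n})\,g(\bar x;\bar y)$, let $J_\mu=\mathbf{H}_\mu^\perp$ with respect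 to $\langle\ ,\ \rangle$ (an $S_n$-invariant bihomogeneous ideal), and $\mathbf{H}'_\mu=\mathbf{Q}[\bar x,\bar y]/J_\mu$. For $\pi\in S_n$ let $\mathrm{Des}(\pi)=\{1\le i\le n-1:\pi(i)>\pi(i+1)\}$; let $d_i=|\mathrm{Des}(\pi)\cap\{i,\dots,k-1\}|$ for $1\le i<k$, $d_k=0$, $d_i=|\mathrm{Des}(\pi)\cap\{k,\dots,i-1\}|$ for $k<i\le n$, and $a_\pi^{(k)}=\prod_{i=1}^{k-1}x_{\pi(i)}^{d_i}\prod_{i=k+1}^{n}y_{\pi(i)}^{d_i}$. Its exponent bipartition is $\lambda(a_\pi^{(k)})=((d_1,\dots,d_{k-1},0),(d_n,d_{n-1},\dots,d_{k+1},0))$. An $(n,k)$-bipartition is a pair $\lambda=(\mu,\nu)$ of partitions $\mu=(\mu_1\ge\cdots\ge\mu_{k-1}\ge\mu_k=0)$, $\nu=(\nu_1\ge\cdots\ge\nu_{n-k}\ge\nu_{n-k+1}=0)$ with $\mu_i-\mu_{i+1}\in\{0,1\}$ for $1\le i\le k-1$ and $\nu_i-\nu_{i+1}\in\{0,1\}$ for $1\le i\le n-k$. For bipartitions, $(\mu^1,\nu^1)\trianglelefteq(\mu^2,\nu^2)$ means $\mu^1\trianglelefteq\mu^2$ and $\nu^1\trianglelefteq\nu^2$ in dominance order of partitions (of equal size); $\triangleleft$ means $\trianglelefteq$ and not equal. Put $I_\lambda^{(k)\trianglelefteq}=\mathrm{span}_{\mathbf{Q}}\{a_\pi^{(k)}+J_{(1^{k-1},n-k+1)}:\lambda(a_\pi^{(k)})\trianglelefteq\lambda\}$,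 $I_\lambda^{(k)\triangleleft}=\mathrm{span}_{\mathbf{Q}}\{a_\pi^{(k)}+J_{(1^{k-1},n-k+1)}:\lambda(a_\pi^{(k)})\triangleleft\lambda\}$ (both are $S_n$-invariant subspaces of $\mathbf{H}'_{(1^{k-1},n-k+1)}$) and $R_\lambda^{(k)}=I_\lambda^{(k)\trianglelefteq}/I_\lambda^{(k)\triangleleft}$. ''Solomon descent representation'': $R_\lambda^{(k)}$ is isomorphic to $\rho^{A_\lambda}$, where $A_\lambda=\{1\le i<k:\mu_i-\mu_{i+1}=1\}\cup\{k\le i<n:\nu_{n-i}-\nu_{n-i+1}=1\}$ and, for $A\subseteq\{1,\dots,n-1\}$, $\rho^A$ is the representation with character $\sum_{B\subseteq A}(-1)^{|A\setminus B|}\mathrm{Ind}_{S_{c(B)}}^{S_n}1$, with $S_{c(B)}=S_{b_1}\times S_{b_2-b_1}\times\cdots\times S_{n-b_r}$ for $B=\{b_1<\dots<b_r\}$. *)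

(* Defs.v *)
From HB Require Import structures.
From mathcomp Require Import all_boot all_order all_algebra all_fingroup.
From mathcomp Require Import all_field all_character.
From mathcomp Require Import ssrcomplements mpoly.
From mathcomp Require Import boolp generic_quotient ring_quotient.

Set Implicit Arguments.
Unset Strict Implicit.
Unset Printing Implicit Defensive.

Import GRing.Theory.

Local Open Scope ring_scope.
Local Open Scope quotient_scope.

(* In MathComp [s * t : 'S_n] is "[s], then [t]"; hence the order of the
   composition in [sn_actM], which is the usual left action. *)
Record snModule (n : nat) := SnModule {
  sn_space :> lmodType rat;
  sn_act : 'S_n -> sn_space -> sn_space;
  sn_act_linear : forall s, linear (sn_act s);
  sn_act1 : forall v, sn_act 1%g v = v;
  sn_actM : forall s t v, sn_act (s * t)%g v = sn_act t (sn_act s v)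
}.

HB.instance Definition _ n (M : snModule n) s :=
  GRing.isLinear.Build rat M M *:%R (@sn_act n M s) (sn_act_linear s).

Definition sn_isomorphic n (M N : snModule n) : Prop :=
  exists f : {linear M -> N},
    bijective f /\ forall s v, f (sn_act s v) = sn_act s (f v).

Definition sn_stable n (M : snModule n) (U : {pred M}) : Prop :=
  forall s u, u \in U -> sn_act s u \in U.

Record snSubmodule n (M : snModule n) := SnSubmodule {
  sub_pred : {pred M};
  sub_submod_closed : submod_closed sub_pred;
  sub_stable : sn_stable sub_pred
}.

HB.instance Definition _ n (M : snModule n) (U : snSubmodule M) :=
  GRing.isSubmodClosed.Build rat M (sub_pred U) (sub_submod_closed U).

Section Submodule.
Variables (n : nat) (M : snModule n) (U : snSubmodule M).

Record sub_space := SubSpace { sub_val : M; _ : sub_val \in sub_pred U }.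
HB.instance Definition _ := [isSub for sub_val].
HB.instance Definition _ := [Choice of sub_space by <:].
HB.instance Definition _ := [SubChoice_isSubLmodule of sub_space by <:].

Definition sub_act (s : 'S_n) (u : sub_space) : sub_space :=
  SubSpace (sub_stable s (valP u)).

Lemma sub_act_linear s : linear (sub_act s).
Proof. by move=> a u v; apply: val_inj; rewrite /= !linearP. Qed.
Lemma sub_act1 u : sub_act 1%g u = u.
Proof. by apply: val_inj; rewrite /= sn_act1. Qed.
Lemma sub_actM s t u : sub_act (s * t)%g u = sub_act t (sub_act s u).
Proof. by apply: val_inj; rewrite /= sn_actM. Qed.

Definition sub_module : snModule n :=
  SnModule sub_act_linear sub_act1 sub_actM.
End Submodule.

Section Quotient.
Variables (n : nat) (M : snModule n) (U : snSubmodule M).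

Definition quot_space := Quotient.quot (sub_pred U).
HB.instance Definition _ := GRing.Zmodule.on quot_space.

Definition quot_pi : M -> quot_space := \pi_(Quotient.quot (sub_pred U)).

Lemma quot_pi_eq u v : (quot_pi u == quot_pi v) = (u - v \in sub_pred U).
Proof. by rewrite (Quotient.idealrBE (sub_pred U)). Qed.

Lemma quot_piD u v : quot_pi (u + v) = quot_pi u + quot_pi v.
Proof. exact: (@pi_addr _ _ _ _ _ (Quotient.quot (sub_pred U)) u v). Qed.

Lemma quot_pi_repr (x : quot_space) : quot_pi (repr x) = x.
Proof. exact: reprK. Qed.

Definition quot_scale (a : rat) (x : quot_space) := quot_pi (a *: repr x).

Lemma quot_piZ a u : quot_pi (a *: u) = quot_scale a (quot_pi u).
Proof.
apply/eqP; rewrite quot_pi_eq -scalerBr rpredZ // -quot_pi_eq.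
by rewrite quot_pi_repr.
Qed.

Lemma quot_scaleA a b x :
  quot_scale a (quot_scale b x) = quot_scale (a * b) x.
Proof. by rewrite -[x]quot_pi_repr -!quot_piZ scalerA. Qed.
Lemma quot_scale1 : left_id 1 quot_scale.
Proof. by move=> x; rewrite -[x]quot_pi_repr -!quot_piZ scale1r. Qed.
Lemma quot_scaleDr : right_distributive quot_scale +%R.
Proof.
move=> a x y; rewrite -[x]quot_pi_repr -[y]quot_pi_repr.
by rewrite -!(quot_piD, quot_piZ) scalerDr.
Qed.
Lemma quot_scaleDl x : {morph quot_scale^~ x : a b / a + b}.
Proof.
by move=> a b; rewrite -[x]quot_pi_repr -!(quot_piD, quot_piZ) scalerDl.
Qed.

HB.instance Definition _ := GRing.Zmodule_isLmodule.Build rat quot_space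
  quot_scaleA quot_scale1 quot_scaleDr quot_scaleDl.

Lemma quot_pi_linear : linear quot_pi.
Proof. by move=> a u v; rewrite quot_piD quot_piZ. Qed.
HB.instance Definition _ :=
  GRing.isLinear.Build rat M quot_space *:%R quot_pi quot_pi_linear.

Definition quot_act (s : 'S_n) (x : quot_space) : quot_space :=
  quot_pi (sn_act s (repr x)).

Lemma quot_actE s u : quot_act s (quot_pi u) = quot_pi (sn_act s u).
Proof.
apply/eqP; rewrite quot_pi_eq -linearB; apply: sub_stable.
by rewrite -quot_pi_eq quot_pi_repr.
Qed.

Lemma quot_act_linear s : linear (quot_act s).
Proof.
move=> a x y; rewrite -[x]quot_pi_repr -[y]quot_pi_repr.
by rewrite -linearP !quot_actE !linearP.
Qed.
Lemma quot_act1 x : quot_act 1%g x = x.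
Proof. by rewrite -[x]quot_pi_repr quot_actE sn_act1. Qed.
Lemma quot_actM s t x : quot_act (s * t)%g x = quot_act t (quot_act s x).
Proof. by rewrite -[x]quot_pi_repr !quot_actE sn_actM. Qed.

Definition quot_module : snModule n :=
  SnModule quot_act_linear quot_act1 quot_actM.
End Quotient.

Section SubQuotient.
Variables (n : nat) (M : snModule n) (U W : snSubmodule M).

Definition preim_pred : {pred sub_module U} :=
  [pred u | sub_val u \in sub_pred W].

Lemma preim_submod_closed : submod_closed preim_pred.
Proof.
split=> [|a u v uW vW]; first exact: (rpred0 (sub_pred W)).
by apply: (@rpredD _ (sub_pred W)) => //; apply: rpredZ.
Qed.
Lemma preim_stable : sn_stable preim_pred.
Proof. by move=> s u; rewrite !inE; apply: sub_stable. Qed.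

(* [U / W] when [W] is contained in [U]. *)
Definition subquot_module : snModule n :=
  quot_module (SnSubmodule preim_submod_closed preim_stable).
End SubQuotient.

Section DirectSum.
Variables (n : nat) (I : finType) (M : I -> snModule n).

Definition dsum_space := {dffun forall i : I, M i}.
HB.instance Definition _ := Choice.on dsum_space.

Implicit Types u v w : dsum_space.

Definition dsum_zero : dsum_space := [ffun i => 0 : M i].
Definition dsum_opp u : dsum_space := [ffun i => - u i : M i].
Definition dsum_add u v : dsum_space := [ffun i => u i + v i : M i].
Definition dsum_scale (a : rat) u : dsum_space := [ffun i => a *: u i : M i].
Definition dsum_act (s : 'S_n) u : dsum_space := [ffun i => sn_act s (u i)].

Lemma dsum_addA : associative dsum_add.
Proof. by move=> u v w; apply/ffunP => i; rewrite !ffunE addrA. Qed.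
Lemma dsum_addC : commutative dsum_add.
Proof. by move=> u v; apply/ffunP => i; rewrite !ffunE addrC. Qed.
Lemma dsum_add0 : left_id dsum_zero dsum_add.
Proof. by move=> u; apply/ffunP => i; rewrite !ffunE add0r. Qed.
Lemma dsum_addN : left_inverse dsum_zero dsum_opp dsum_add.
Proof. by move=> u; apply/ffunP => i; rewrite !ffunE addNr. Qed.
HB.instance Definition _ := GRing.isZmodule.Build dsum_space
  dsum_addA dsum_addC dsum_add0 dsum_addN.

Lemma dsum_scaleA a b u :
  dsum_scale a (dsum_scale b u) = dsum_scale (a * b) u.
Proof. by apply/ffunP => i; rewrite !ffunE scalerA. Qed.
Lemma dsum_scale1 : left_id 1 dsum_scale.
Proof. by move=> u; apply/ffunP => i; rewrite !ffunE scale1r. Qed.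
Lemma dsum_scaleDr : right_distributive dsum_scale +%R.
Proof. by move=> a u v; apply/ffunP => i; rewrite !ffunE scalerDr. Qed.
Lemma dsum_scaleDl u : {morph dsum_scale^~ u : a b / a + b}.
Proof. by move=> a b; apply/ffunP => i; rewrite !ffunE scalerDl. Qed.
HB.instance Definition _ := GRing.Zmodule_isLmodule.Build rat dsum_space
  dsum_scaleA dsum_scale1 dsum_scaleDr dsum_scaleDl.

Lemma dsum_act_linear s : linear (dsum_act s).
Proof. by move=> a u v; apply/ffunP => i; rewrite !ffunE linearP. Qed.
Lemma dsum_act1 u : dsum_act 1%g u = u.
Proof. by apply/ffunP => i; rewrite ffunE sn_act1. Qed.
Lemma dsum_actM s t u : dsum_act (s * t)%g u = dsum_act t (dsum_act s u).
Proof. by apply/ffunP => i; rewrite !ffunE sn_actM. Qed.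

Definition dsum_module : snModule n :=
  SnModule dsum_act_linear dsum_act1 dsum_actM.
End DirectSum.

Section MatrixModule.
Variables (n d : nat) (rG : mx_representation rat [set: 'S_n]%G d).

Definition mx_act (s : 'S_n) (v : 'rV[rat]_d) : 'rV[rat]_d := v *m rG s.

Lemma mx_act_linear s : linear (mx_act s).
Proof. by move=> a u v; rewrite /mx_act mulmxDl scalemxAl. Qed.
Lemma mx_act1 v : mx_act 1%g v = v.
Proof. by rewrite /mx_act repr_mx1 mulmx1. Qed.
Lemma mx_actM s t v : mx_act (s * t)%g v = mx_act t (mx_act s v).
Proof. by rewrite /mx_act repr_mxM ?inE // mulmxA. Qed.

Definition mx_module : snModule n := SnModule mx_act_linear mx_act1 mx_actM.
End MatrixModule.

Definition spanQ (V : lmodType rat) (S : V -> Prop) : {pred V} :=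
  [pred v | `[< exists c : seq (rat * V),
    (forall p, p \in c -> S p.2) /\ v = \sum_(p <- c) p.1 *: p.2 >]].

Lemma spanQ_ind (V : lmodType rat) (S : V -> Prop) (U : V -> Prop) :
  U 0 -> (forall a u v, S u -> U v -> U (a *: u + v)) ->
  forall v, v \in spanQ S -> U v.
Proof.
move=> U0 US v /asboolP [c [cS ->]]; elim: c cS => [|p c IHc] cS.
  by rewrite big_nil.
rewrite big_cons; apply: US; first by apply: cS; rewrite mem_head.
by apply: IHc => q qc; apply: cS; rewrite inE qc orbT.
Qed.

Lemma mem_spanQ (V : lmodType rat) (S : V -> Prop) u : S u -> u \in spanQ S.
Proof.
move=> Su; apply/asboolP; exists [:: (1, u)]; rewrite big_seq1 scale1r.
by split=> // p; rewrite inE => /eqP ->.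
Qed.

Lemma spanQ_submod_closed (V : lmodType rat) (S : V -> Prop) :
  submod_closed (spanQ S).
Proof.
split=> [|a u v /asboolP [c [cS ->]] /asboolP [c' [c'S ->]]].
  by apply/asboolP; exists [::]; rewrite big_nil.
apply/asboolP; exists ([seq (a * p.1, p.2) | p <- c] ++ c'); split.
  by move=> p; rewrite mem_cat => /orP [/mapP [q /cS Sq ->] //|/c'S].
rewrite big_cat big_map scaler_sumr /=; congr (_ + _).
by apply: eq_bigr => p _; rewrite scalerA.
Qed.

Section HookModule.
Variable n : nat.

Notation pol := {mpoly rat[n + n]}.
(* The first [n] variables are the [x_i], the last [n] the [y_i]. *)
Definition varx (i : 'I_n) : pol := 'X_(lshift n i).
Definition vary (i : 'I_n) : pol := 'X_(rshift n i).

Definition diag_fun (s : 'S_n) (i : 'I_(n + n)) : 'I_(n + n) :=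
  match split i with
  | inl j => lshift n (s j)
  | inr j => rshift n (s j)
  end.

Lemma diag_fun_inj s : injective (diag_fun s).
Proof.
apply: (can_inj (g := diag_fun s^-1)) => i; rewrite /diag_fun.
case: (split_ordP i) => j ->;
  by rewrite ?(unsplitK (inl _)) ?(unsplitK (inr _)) permK.
Qed.

Definition diag_perm (s : 'S_n) : 'S_(n + n) := perm (@diag_fun_inj s).

Lemma diag_perml s i : diag_perm s (lshift n i) = lshift n (s i).
Proof. by rewrite permE /diag_fun (unsplitK (inl _)). Qed.
Lemma diag_permr s i : diag_perm s (rshift n i) = rshift n (s i).
Proof. by rewrite permE /diag_fun (unsplitK (inr _)). Qed.

Definition pol_act (s : 'S_n) (p : pol) : pol := msym (diag_perm s) p.
Arguments pol_act : simpl never.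

Lemma pol_act_linear s : linear (pol_act s).
Proof. exact: linearP. Qed.
HB.instance Definition _ s :=
  GRing.isLinear.Build rat pol pol *:%R (pol_act s) (pol_act_linear s).

Lemma pol_act1 p : pol_act 1%g p = p.
Proof.
rewrite /pol_act (_ : diag_perm 1 = 1%g) ?msym1m //; apply/permP => i.
rewrite perm1.
by case: (split_ordP i) => j ->; rewrite ?diag_perml ?diag_permr perm1.
Qed.
Lemma pol_actM s t p : pol_act (s * t)%g p = pol_act t (pol_act s p).
Proof.
rewrite /pol_act -msymMm; congr msym; apply/permP => i; rewrite permM.
by case: (split_ordP i) => j ->; rewrite ?diag_perml ?diag_permr permM.
Qed.

Definition pol_module : snModule n :=
  SnModule pol_act_linear pol_act1 pol_actM.

Lemma pol_act_varx s i : pol_act s (varx i) = varx (s i).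
Proof. by rewrite /pol_act /msym mmapX mmap1U diag_perml. Qed.
Lemma pol_act_vary s i : pol_act s (vary i) = vary (s i).
Proof. by rewrite /pol_act /msym mmapX mmap1U diag_permr. Qed.

Variable k : nat.

(* Row [i] is [1, y_i, ..., y_i^(n-k), x_i, ..., x_i^(k-1)], columns counted
   from 0. *)
Definition hook_mx : 'M[pol]_n :=
  \matrix_(i, j) if (j <= n - k)%N then vary i ^+ j
                 else varx i ^+ (j - (n - k)).

Definition Delta : pol := \det hook_mx.

Definition H_space : {pred pol} :=
  spanQ (fun p => exists m : 'X_{1..(n + n)}, p = Delta^`M[m]).

(* Constant term of [f(d/dx; d/dy) g]. *)
Definition pairing (f g : pol) : rat :=
  (\sum_(m <- msupp f) f@_m *: g^`M[m])@_0%MM.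

Lemma pairingE f g K : (msize f <= K)%N ->
  pairing f g = \sum_(m : 'X_{1..(n + n) < K}) f@_m * (g^`M[m])@_0%MM.
Proof.
move=> fK; rewrite /pairing raddf_sum /=.
pose P (m : 'X_{1..(n + n) < K}) := val m \in msupp f.
rewrite [RHS](bigID P) {}/P /= addrC [X in _ = X + _]big1 ?add0r; last first.
  by move=> m /memN_msupp_eq0 ->; rewrite mul0r.
pose I : subFinType _ := 'X_{1..(n + n) < K}.
rewrite (big_mksub I) //=; first by apply: eq_bigr => m _; rewrite mcoeffZ.
  exact: msupp_uniq.
by move=> m /msize_mdeg_lt /leq_trans; apply.
Qed.

Definition pairingr (g f : pol) : rat^o := pairing f g.

Lemma pairingr_linear g : linear (pairingr g).
Proof.
move=> a f1 f2; rewrite /pairingr.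
pose K := maxn (msize (a *: f1 + f2)) (maxn (msize f1) (msize f2)).
rewrite !(@pairingE _ _ K) ?leq_max ?leqnn ?orbT //.
rewrite scaler_sumr -big_split /=; apply: eq_bigr => m _.
by rewrite mcoeffD mcoeffZ mulrDl scalerAl.
Qed.
HB.instance Definition _ g :=
  GRing.isLinear.Build rat pol rat^o *:%R (pairingr g) (pairingr_linear g).

Lemma pairingX m g : pairing 'X_[m] g = (g^`M[m])@_0%MM.
Proof. by rewrite /pairing msuppX big_seq1 mcoeffX eqxx scale1r. Qed.


Lemma mcoeff_act s p m :
  (pol_act s p)@_m = p@_[multinom m (diag_perm s i) | i < n + n].
Proof. exact: mcoeff_sym. Qed.

Lemma pol_actX s m :
  pol_act s 'X_[m] = 'X_[[multinom m ((diag_perm s)^-1%g i) | i < n + n]].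
Proof. exact: msymX. Qed.

Lemma diag_permV s : diag_perm s^-1 = (diag_perm s)^-1%g.
Proof.
apply/permP => i; apply: (@perm_inj _ (diag_perm s)); rewrite permKV.
by case: (split_ordP i) => j ->;
  rewrite ?diag_perml ?diag_permr ?diag_perml ?diag_permr permKV.
Qed.

Lemma pol_act_deriv s p m :
  pol_act s p^`M[m] =
  (pol_act s p)^`M[[multinom m ((diag_perm s)^-1%g i) | i < n + n]].
Proof.
apply/mpolyP => m'; rewrite mcoeff_act !mcoeff_mderivm mcoeff_act.
congr (p@_(_) *+ _).
  by apply/mnmP => i; rewrite !(mnmE, mnmDE) permK.
rewrite [RHS](reindex_inj (@perm_inj _ (diag_perm s))) /=.
by apply: eq_bigr => i _; rewrite !(mnmE, mnmDE) permK.
Qed.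

Lemma pairing_act s f g :
  pairing (pol_act s f) g = pairing f (pol_act s^-1 g).
Proof.
rewrite -![pairing _ _]/(pairingr _ _) [f]mpolyE.
rewrite (linear_sum (pol_act s)) !(linear_sum (pairingr _)).
apply: eq_bigr => m _.
rewrite (linearZ_LR (pol_act s)) !(linearZ_LR (pairingr _)) /=.
apply: (congr1 (fun x : rat^o => f@_m *: x)).
rewrite /pairingr pol_actX !pairingX -{1}[g]pol_act1 -(mulVg s) pol_actM.
rewrite -pol_act_deriv mcoeff_act; congr (_ @_ _).
by apply/mnmP => i; rewrite !mnmE.
Qed.

Lemma Delta_act s : pol_act s Delta = (-1) ^+ s *: Delta.
Proof.
rewrite /pol_act /Delta -det_map_mx.
rewrite (_ : map_mx _ _ = row_perm s hook_mx).
  by rewrite row_permE det_mulmx det_perm scaler_sign mulr_sign.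
apply/matrixP => i j; rewrite !mxE; case: ifP => _; rewrite rmorphXn /=.
  by rewrite [msym _ _]pol_act_vary.
by rewrite [msym _ _]pol_act_varx.
Qed.

Lemma H_space_stable s g : g \in H_space -> pol_act s g \in H_space.
Proof.
have [H0 HP] := spanQ_submod_closed (fun p => exists m, p = Delta^`M[m]).
move: g; apply: spanQ_ind => [|a u v [m ->] vH]; first by rewrite linear0.
rewrite linearP /=; apply: (HP) => //.
rewrite pol_act_deriv Delta_act mderivmZ -[_ *: _]addr0.
by apply: HP => //; apply: mem_spanQ; eexists.
Qed.

Definition J_pred : {pred pol_module} :=
  [pred f : pol | `[< forall g : pol, g \in H_space -> pairing f g = 0 >]].

Lemma J_submod_closed : submod_closed J_pred.
Proof.
split=> [|a u v /asboolP uJ /asboolP vJ]; apply/asboolP => g gH.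
  by rewrite -[LHS]/(pairingr g 0) linear0.
rewrite -[LHS]/(pairingr g (a *: u + v)) linearP /= /pairingr uJ // vJ //.
by rewrite scaler0 addr0.
Qed.

Lemma J_stable : sn_stable J_pred.
Proof.
move=> s f /asboolP fJ; apply/asboolP => g gH.
by rewrite pairing_act fJ //; apply: H_space_stable.
Qed.

(* [J_mu], [Q[x,y] / J_mu]; the quotient map is [quot_pi J]. *)
Definition J : snSubmodule pol_module := SnSubmodule J_submod_closed J_stable.

Definition H' : snModule n := quot_module J.

(* Image in [H'] of the polynomials of degree [t1] in [y] and [t2] in [x]. *)
Definition bihomog (t1 t2 : nat) (p : pol) : Prop :=
  forall m, m \in msupp p ->
    (\sum_(i < n) m (rshift n i) = t1)%N /\ (\sum_(i < n) m (lshift n i) = t2)%N.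

Definition Hcomp_pred (t1 t2 : nat) : {pred H'} :=
  [pred h | `[< exists2 p : pol, bihomog t1 t2 p & h = quot_pi J p >]].

Lemma Hcomp_submod_closed t1 t2 : submod_closed (Hcomp_pred t1 t2).
Proof.
split=> [|a _ _ /asboolP [p pt ->] /asboolP [q qt ->]]; apply/asboolP.
  by exists 0; [move=> m; rewrite msupp0 | rewrite linear0].
exists (a *: p + q); last by rewrite linearP.
move=> m /msuppD_le; rewrite mem_cat => /orP [/msuppZ_le/pt | /qt] //.
Qed.

Lemma Hcomp_stable t1 t2 : sn_stable (Hcomp_pred t1 t2).
Proof.
move=> s _ /asboolP [p pt ->]; apply/asboolP.
exists (pol_act s p); last exact: quot_actE.
move=> m; rewrite mcoeff_msupp mcoeff_act -mcoeff_msupp => /pt [<- <-].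
split; rewrite [LHS](reindex_inj (@perm_inj _ s)); apply: eq_bigr => i _;
  by rewrite mnmE ?diag_perml ?diag_permr.
Qed.

Definition Hcomp (t1 t2 : nat) : snModule n :=
  sub_module (SnSubmodule (@Hcomp_submod_closed t1 t2) (@Hcomp_stable t1 t2)).

(* [d_i] and [Des pi] refer to positions [1, ..., n]; position [i.+1] is
   [i : 'I_n]. A subset of [{1, ..., n-1}] is encoded as a set of nonzero
   elements of ['I_n]. *)
Definition Des (pi : 'S_n) : {set 'I_n} :=
  [set i : 'I_n | [exists j : 'I_n, (j.+1 == i) && (pi i < pi j)%N]].

Definition dexp (pi : 'S_n) (i : nat) : nat :=
  if (i < k)%N then #|[set j in Des pi | (i <= j < k)%N]|
  else #|[set j in Des pi | (k <= j < i)%N]|.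

Definition a_mon (pi : 'S_n) : pol :=
  (\prod_(i < n | (i.+1 < k)%N) varx (pi i) ^+ dexp pi i.+1) *
  (\prod_(i < n | (k < i.+1)%N) vary (pi i) ^+ dexp pi i.+1).

Definition lambda_a (pi : 'S_n) : seq nat * seq nat :=
  (rcons [seq dexp pi i | i <- iota 1 k.-1] 0%N,
   rcons [seq dexp pi i | i <- rev (iota k.+1 (n - k))] 0%N).

(* Weakly decreasing, last entry [0], consecutive differences in [{0, 1}]. *)
Definition stair (s : seq nat) : bool :=
  (last 0%N s == 0%N) && sorted [rel a b | (b <= a <= b.+1)%N] s.

Definition is_bipartition (p : seq nat * seq nat) : bool :=
  [&& size p.1 == k, stair p.1, size p.2 == (n - k).+1 & stair p.2].

Record bipartition :=
  Bipartition { bip_val :> seq nat * seq nat; _ : is_bipartition bip_val }.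
HB.instance Definition _ := [isSub for bip_val].
HB.instance Definition _ := [Countable of bipartition by <:].

Lemma stair_bound s : stair s -> all (fun x => x <= size s)%N s.
Proof.
elim: s => [//|x [|y s] IHs] /andP [l0 /=].
  by move: l0 => /= /eqP ->.
move=> /andP [/andP [_ xy] ss].
have sh : all (fun z => z <= (size s).+1)%N (y :: s).
  by apply: IHs; apply/andP.
apply/andP; split; last by apply: sub_all sh => z /leqW.
by case/andP: sh => ys _; apply: leq_trans xy _.
Qed.

Definition seq_of_tuple b c (t : c.-tuple 'I_b) : seq nat := map val t.
Definition tuple_of_seq b c (s : seq nat) : c.-tuple 'I_b.+1 :=
  [tuple inord (nth 0%N s i) | i < c].

Lemma tuple_of_seqK b c s : size s = c -> all (fun x => x <= b)%N s ->
  seq_of_tuple (tuple_of_seq b c s) = s.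
Proof.
move=> sc sb; apply: (@eq_from_nth _ 0%N) => [|i].
  by rewrite /seq_of_tuple size_map size_tuple sc.
rewrite /seq_of_tuple size_map size_tuple => ic.
rewrite (nth_map ord0) ?size_tuple // -[i]/(val (Ordinal ic)).
rewrite -tnth_nth tnth_mktuple /= inordK // ltnS.
by apply: (allP sb); rewrite mem_nth // sc.
Qed.

Definition bip_code (l : bipartition) :
    k.-tuple 'I_k.+1 * (n - k).+1.-tuple 'I_(n - k).+2 :=
  (tuple_of_seq k k l.1, tuple_of_seq (n - k).+1 (n - k).+1 l.2).
Definition bip_decode
    (t : k.-tuple 'I_k.+1 * (n - k).+1.-tuple 'I_(n - k).+2) :
    option bipartition :=
  insub (seq_of_tuple t.1, seq_of_tuple t.2).

Lemma bip_codeK : pcancel bip_code bip_decode.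
Proof.
move=> [[s1 s2] h]; rewrite /bip_decode /=.
have /and4P [/eqP /= c1 /stair_bound b1 /eqP /= c2 /stair_bound b2] := h.
rewrite /= c1 in b1; rewrite /= c2 in b2.
by rewrite !tuple_of_seqK //= ?insubT // -?c1 -?c2.
Qed.
HB.instance Definition _ : isFinite bipartition := PCanIsFinite bip_codeK.

(* [part s i] is the [i]-th part of [s], [i >= 1]. *)
Definition part (s : seq nat) (i : nat) : nat := nth 0%N s i.-1.

Definition A_set (l : bipartition) : {set 'I_n} :=
  [set i : 'I_n |
     [&& (0 < i)%N, (i < k)%N & part l.1 i == (part l.1 i.+1).+1]
  || (k <= i)%N && (part l.2 (n - i) == (part l.2 (n - i).+1).+1)].

Definition has_bidegree (t1 t2 : nat) (l : bipartition) : bool :=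
  ((\sum_(k <= i < n | (part l.2 (n - i) > part l.2 (n - i).+1)%N) (n - i) == t1)
  && (\sum_(1 <= i < k | (part l.1 i > part l.1 i.+1)%N) i == t2))%N.

(* Dominance order on partitions of the same size. *)
Definition dominated (a b : seq nat) : Prop :=
  sumn a = sumn b /\ forall j, (sumn (take j a) <= sumn (take j b))%N.

Definition bidominated (p q : seq nat * seq nat) : Prop :=
  dominated p.1 q.1 /\ dominated p.2 q.2.

Definition I_le (l : bipartition) : {pred H'} :=
  spanQ (fun h : H' => exists2 pi : 'S_n,
    bidominated (lambda_a pi) l & h = quot_pi J (a_mon pi)).

Definition I_lt (l : bipartition) : {pred H'} :=
  spanQ (fun h : H' => exists2 pi : 'S_n,
    bidominated (lambda_a pi) l /\ lambda_a pi <> l & h = quot_pi J (a_mon pi)).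

Definition R_module (l : bipartition)
    (le_stable : sn_stable (I_le l)) (lt_stable : sn_stable (I_lt l)) :
    snModule n :=
  subquot_module
    (SnSubmodule (spanQ_submod_closed _) le_stable)
    (SnSubmodule (spanQ_submod_closed _) lt_stable).

End HookModule.

Section Solomon.
Variable n : nat.
Implicit Types A B : {set 'I_n}.

Definition block B (i : 'I_n) : nat := #|[set b in B | (b <= i)%N]|.

(* [S_{c(B)}]: the permutations preserving each block of consecutive
   positions cut out by [B]. *)
Definition young B : {set 'S_n} :=
  [set s : 'S_n | [forall i, block B (s i) == block B i]].

Lemma young_group_set B : group_set (young B).
Proof.
apply/group_setP; split=> [|s t].
  by rewrite inE; apply/forallP => i; rewrite perm1.
rewrite !inE => /forallP sB /forallP tB; apply/forallP => i.
by rewrite permM (eqP (tB _)).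
Qed.
Canonical young_group B := Group (young_group_set B).

Definition solomon_char A : 'CF([set: 'S_n]) :=
  \sum_(B : {set 'I_n} | B \subset A)
    (-1) ^+ #|A :\: B| *: 'Ind[[set: 'S_n], young B] 1.

(* [M] is isomorphic to a representation of character [solomon_char A]. *)
Definition is_solomon_rep A (M : snModule n) : Prop :=
  exists d (rG : mx_representation rat [set: 'S_n]%G d),
    (forall s, ratr (\tr (rG s)) = solomon_char A s)
    /\ sn_isomorphic M (mx_module rG).
End Solomon.

(* Main.v *)
From HB Require Import structures.
From mathcomp Require Import all_boot all_order all_algebra all_fingroup.
From mathcomp Require Import all_field all_character.
From mathcomp Require Import ssrcomplements mpoly zify.
From mathcomp Require Import boolp generic_quotient.
Require Import Defs.

Set Implicit Arguments.
Unset Strict Implicit.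
Unset Printing Implicit Defensive.

Import GRing.Theory.

Local Open Scope ring_scope.

(** The argument reads monomials as weights.  A monomial divisible by no x_i
    y_i is a function w from the n indices to the integers, positive values
    being exponents of x and negative ones exponents of y.  The ideal J
    contains x_i y_i, every product of k distinct x's or of n-k+1 distinct y's,
    and the elementary symmetric polynomials of positive degree in the x's and
    in the y's ([mon_J_both], [mon_J_many], [elem_sym_J]). So only weights
    whose k-th largest value is 0 survive; they are the integer weights modulo
    constants, or multichains of proper nonempty subsets of the n indices, and
    H' is a filtered version of the Stanley-Reisner ring of the Boolean lattice
    modulo its rank parameters.  The rank-selected pieces of that ring carry
    Solomon's descent representations, which is why the theorem holds.

    Straightening ([straighten]): multiplying by an elementary symmetric
    polynomial rewrites a monomial through monomials that are either strictly
    smaller for dominance, or of the same shape but arranged in a less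
    increasing way; iterating, every monomial is a combination of the a_pi
    whose exponent bipartitions it dominates.  This gives the invariance of the
    subspaces defining R_lambda.

    Independence ([a_class_free]): Delta contains exactly the weights with
    pairwise distinct values k-1, ..., k-n, up to order.  Multiplying a_pi by a
    monomial whose drops are complementary to the descents of some pi' and
    pairing with Delta gives a triangular matrix for dominance refined by the
    statistic sum_i i pi(i) ([pair_Delta_triangular]).

    Graded pieces: in R_lambda, with A the drop set of lambda, the monomials of
    shape lambda span a quotient of the permutation module on the cosets of the
    Young subgroup of A by the images of the modules attached to A minus a
    point ([sum_coset_lower]). In the group algebra the sums of the cosets of
    young (Des p) through p form a basis, adapted to all these permutation
    modules at once ([coset_vec_span]). Hence the action on the basis a_pi of
    R_lambda is a diagonal block of the regular representation ([des_expand],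
    [toR_a_class_act]), and counting fixed cosets followed by Moebius inversion
    gives the trace ([trace_coset], [solomon_charE]).

    Direct sum ([Hcomp_iso]): projecting on the span of the a_pi of shape
    lambda and averaging over S_n gives an equivariant map to R_lambda; these
    maps together are unitriangular for dominance, hence bijective on each
    bigraded component. *)

(** * Exchange arguments for sums over finite sets *)

Section Exchange.
Variable T : finType.
Implicit Types (X Y : {set T}) (f g : T -> nat).
Local Open Scope nat_scope.

Lemma leq_sum_sep f g X Y : #|X| <= #|Y| ->
  (forall x y, x \in X -> y \in Y -> f x <= g y) ->
  \sum_(i in X) f i <= \sum_(i in Y) g i.
Proof.
move=> cXY fg; pose c := \max_(x in X) f x.
apply: (@leq_trans (#|X| * c)).
  by rewrite -sum_nat_const; apply: leq_sum => x xX; apply: leq_bigmax_cond.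
apply: (@leq_trans (#|Y| * c)); first by rewrite leq_mul2r cXY orbT.
rewrite -sum_nat_const; apply: leq_sum => y yY.
by apply/bigmax_leqP => x xX; apply: fg.
Qed.

Lemma leq_sum_exchange g X Y : #|X| <= #|Y| ->
  (forall x y, x \in X :\: Y -> y \in Y :\: X -> g x <= g y) ->
  \sum_(i in X) g i <= \sum_(i in Y) g i.
Proof.
move=> cXY gXY.
rewrite (big_setID Y) /= [leqRHS](big_setID X) /= setIC leq_add2l.
apply: leq_sum_sep => //.
by rewrite -(leq_add2l #|X :&: Y|) cardsID setIC cardsID.
Qed.

Lemma ltn_sum_exchange g X Y : #|X| = #|Y| -> X != Y ->
  (forall x y, x \in X :\: Y -> y \in Y :\: X -> g x < g y) ->
  \sum_(i in X) g i < \sum_(i in Y) g i.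
Proof.
move=> cXY nXY gXY.
rewrite (big_setID Y) /= [ltnRHS](big_setID X) /= setIC ltn_add2l.
have cD : #|X :\: Y| = #|Y :\: X|.
  by apply/eqP; rewrite -(eqn_add2l #|X :&: Y|) cardsID setIC cardsID cXY.
have := @leq_sum_sep (fun x => (g x).+1) g (X :\: Y) (Y :\: X).
rewrite cD leqnn => /(_ isT gXY).
under eq_bigr do rewrite -addn1.
rewrite big_split /= sum1_card; apply: leq_trans.
rewrite -addn1 leq_add2l card_gt0 setD_eq0.
apply: contraNN nXY => sXY; rewrite eqEcard sXY cXY leqnn //.
Qed.

(** If one of the exchanges were a strict gain, setting it aside would leave
    a weak inequality for the rest and make the total strict. *)
Lemma eq_sum_exchange g X Y : #|X| = #|Y| ->
  (forall x y, x \in X :\: Y -> y \in Y :\: X -> g x <= g y) ->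
  \sum_(i in Y) g i <= \sum_(i in X) g i ->
  forall x y, x \in X :\: Y -> y \in Y :\: X -> g x = g y.
Proof.
move=> cXY gXY; rewrite (big_setID X) /= [leqRHS](big_setID Y) /= setIC.
rewrite leq_add2l => sYX x y xX yY.
apply/eqP; rewrite eqn_leq gXY //= leqNgt; apply: contraTN sYX => lt.
rewrite -ltnNge (big_setD1 x xX) (big_setD1 y yY) /= -addSn leq_add //.
apply: leq_sum_sep => [|u v /setD1P [_ uX] /setD1P [_ vY]]; last exact: gXY.
have cD : #|X :\: Y| = #|Y :\: X|.
  by apply/eqP; rewrite -(eqn_add2l #|X :&: Y|) cardsID setIC cardsID cXY.
by move: (cardsD1 x (X :\: Y)) (cardsD1 y (Y :\: X));
  rewrite xX yY cD => -> /addnI ->.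
Qed.

End Exchange.

(** * Largest partial sums *)

Section TopSums.
Variable n : nat.
Implicit Types (f g h : 'I_n -> nat) (X : {set 'I_n}) (s : 'S_n).
Local Open Scope nat_scope.

(** The sum of the first j parts of the partition obtained by sorting f.  A
    maximum avoids sorting, and admitting sets with fewer than j elements makes
    it equal to the total of f as soon as j is at least n. *)
Definition top_sum f j := \max_(X : {set 'I_n} | #|X| <= j) \sum_(i in X) f i.

Lemma top_ub f j X : #|X| <= j -> \sum_(i in X) f i <= top_sum f j.
Proof.
exact: (@leq_bigmax_cond _ (fun Y : {set 'I_n} => #|Y| <= j)
          (fun Y => \sum_(i in Y) f i) X).
Qed.

Lemma top_leP f j c :
  reflect (forall X, #|X| <= j -> \sum_(i in X) f i <= c) (top_sum f j <= c).
Proof. exact: bigmax_leqP. Qed.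

Lemma eq_top_sum f g j : f =1 g -> top_sum f j = top_sum g j.
Proof. by move=> fg; apply: eq_bigr => X _; apply: eq_bigr => i _. Qed.

Lemma top_add f g h j : (forall a, f a = g a + h a) ->
  top_sum f j <= top_sum g j + top_sum h j.
Proof.
move=> fgh; apply/top_leP => X Xj; under eq_bigr do rewrite fgh.
by rewrite big_split leq_add ?top_ub.
Qed.

Definition initial s j : {set 'I_n} := s @: [set i : 'I_n | i < j].

Lemma mem_initial s j i : (s i \in initial s j) = (i < j).
Proof. by rewrite (mem_imset _ _ (@perm_inj _ s)) inE. Qed.

Lemma card_initial s j : j <= n -> #|initial s j| = j.
Proof.
move=> jn; rewrite card_imset; last exact: perm_inj.
by rewrite -sum1dep_card -(big_ord_widen n (fun=> 1) jn) sum1_card card_ord.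
Qed.

Lemma card_initial_le s j : #|initial s j| <= j.
Proof.
case: (leqP j n) => [jn|/ltnW nj]; first by rewrite card_initial.
by apply: leq_trans nj; rewrite -[leqRHS]card_ord max_card.
Qed.

Lemma sum_initial f s j :
  \sum_(a in initial s j) f a = \sum_(i < n | i < j) f (s i).
Proof.
rewrite big_imset /=; last by move=> i i' _ _ /perm_inj.
by apply: eq_bigl => i; rewrite inE.
Qed.

Definition decreasing f := forall i i' : 'I_n, i <= i' -> f i' <= f i.

(** No exchange improves on the first j positions of a decreasing
    arrangement. *)
Lemma top_sorted f s j : decreasing (f \o s) ->
  top_sum f j = \sum_(i < n | i < j) f (s i).
Proof.
move=> fs; apply/eqP; rewrite eqn_leq; apply/andP; split; last first.
  by rewrite -sum_initial; apply/top_ub/card_initial_le.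
apply/top_leP => X Xj; rewrite -sum_initial.
have sep a b : a \in X :\: initial s j -> b \in initial s j :\: X -> f a <= f b.
  rewrite -[a](permKV s) -[b](permKV s) !inE !mem_initial -leqNgt.
  by move=> /andP [ja _] /andP [_ bj]; apply/fs/ltnW/(leq_trans bj).
case: (leqP j n) => [jn|/ltnW nj].
  by apply: leq_sum_exchange => //; rewrite card_initial.
apply: leq_sum_exchange => //; apply: subset_leq_card; apply/subsetP => a _.
by rewrite -[a](permKV s) mem_initial; apply: leq_trans nj.
Qed.

Lemma partial_sums_inj f g :
  (forall j, \sum_(i < n | i < j) f i = \sum_(i < n | i < j) g i) -> f =1 g.
Proof.
move=> fg i; have := fg i.+1.
rewrite (bigD1 i) //= [RHS](bigD1 i) //=.
have E h : \sum_(i0 < n | (i0 < i.+1) && (i0 != i)) h i0 =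
  \sum_(i0 < n | i0 < i) h i0.
  by apply: eq_bigl => a; rewrite ltnS [RHS]ltn_neqAle andbC.
by rewrite !E fg => /addIn.
Qed.

Lemma top_perm f s j : top_sum (fun a => f (s a)) j = top_sum f j.
Proof.
apply/eqP; rewrite eqn_leq; apply/andP; split; apply/top_leP => X Xj.
  rewrite -(big_imset f) /=; last by move=> i i' _ _ /perm_inj.
  by apply: top_ub; rewrite card_imset //; apply: perm_inj.
rewrite (_ : X = s @: (s^-1%g @: X)); last first.
  by rewrite -imset_comp -[LHS]imset_id; apply: eq_imset => a /=;
    rewrite permKV.
rewrite (big_imset f) /=; last by move=> i i' _ _ /perm_inj.
by apply: top_ub; rewrite card_imset //; apply: perm_inj.
Qed.

(** The position of an index is the number of indices with a larger key. *)
Lemma sort_perm (key : 'I_n -> nat) : injective key ->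
  exists s : 'S_n, forall i i' : 'I_n, i < i' -> key (s i') < key (s i).
Proof.
move=> key_inj; pose up a := [set b | key a < key b].
have upP a b : key a < key b -> #|up b| < #|up a|.
  move=> ab; apply: proper_card; apply/properP; split.
    by apply/subsetP => c; rewrite !inE; apply: ltn_trans.
  by exists b; rewrite inE ?ab ?ltnn.
have up_lt a : #|up a| < n.
  have [le|//] := leqP n #|up a|.
  have /eqP/setP/(_ a) : up a == setT.
    by rewrite eqEcard subsetT cardsT card_ord.
  by rewrite !inE ltnn.
have r_inj : injective (fun a => Ordinal (up_lt a)).
  move=> a b [E]; apply: key_inj; case: (ltngtP (key a) (key b)) => // /upP.
    by rewrite E ltnn.
  by rewrite E ltnn.
exists (perm r_inj)^-1%g => i i'.
rewrite -{1}[i](permKV (perm r_inj)) -{1}[i'](permKV (perm r_inj)).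
set a := _ i; set b := _ i'; rewrite !permE /= => ab.
case: (ltngtP (key a) (key b)) => // [/upP|/key_inj E]; last first.
  by move: ab; rewrite E ltnn.
by move=> /(ltn_trans ab); rewrite ltnn.
Qed.

End TopSums.

(** * Arrangements increasing along blocks *)

Section Blocks.
Variable n : nat.
Implicit Types (A B : {set 'I_n}) (s t h : 'S_n) (f : 'I_n -> nat).
Local Open Scope nat_scope.

Lemma block_mono B (i i' : 'I_n) : i <= i' -> block B i <= block B i'.
Proof.
move=> ii'; apply: subset_leq_card; apply/subsetP => b; rewrite !inE.
by move=> /andP [-> /leq_trans ->].
Qed.

Lemma block_eqP B (i i' : 'I_n) : i <= i' ->
  reflect (forall b, b \in B -> ~~ (i < b <= i')) (block B i == block B i').
Proof.
move=> ii'.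
have sub : [set b in B | b <= i] \subset [set b in B | b <= i'].
  by apply/subsetP => b; rewrite !inE => /andP [-> /leq_trans ->].
have -> : (block B i == block B i') =
  ([set b in B | b <= i] == [set b in B | b <= i']).
  by rewrite eqEcard sub eqn_leq block_mono.
apply: (iffP eqP) => [/setP E b bB|E].
  by move: (E b); rewrite !inE bB /= ltnNge => ->; case: leqP.
apply/setP => b; rewrite !inE; case bB: (b \in B) => //=.
have := E b bB; rewrite ltnNge; case: leqP => //= bi.
  by rewrite (leq_trans bi ii').
by move=> /negbTE ->.
Qed.

Lemma youngP B h : reflect (forall i, block B (h i) = block B i)
    (h \in young B).
Proof. by rewrite inE; apply: (iffP forallP) => H i; apply/eqP. Qed.

Lemma young_anti A B : B \subset A -> young A \subset young B.
Proof.
move=> BA; apply/subsetP => h /youngP hA; apply/youngP => i.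
have blk (a b : 'I_n) : block A a = block A b -> block B a = block B b.
  wlog ab : a b / a <= b.
    by case: (leqP a b) => [/[swap] H /H//|/ltnW ba /(_ b a ba) H] /esym/H.
  move=> /eqP/(block_eqP _ ab) H; apply/eqP/(block_eqP _ ab) => c cB.
  by apply: H; apply: (subsetP BA).
exact/blk/hA.
Qed.

Lemma increasing_perm1 h : (forall i i' : 'I_n, i < i' -> h i < h i') ->
    h = 1%g.
Proof.
move=> hinc.
have ge (g : 'S_n) : (forall i i' : 'I_n, i < i' -> g i < g i') ->
  forall i : 'I_n, i <= g i.
  move=> ginc [i ilt] /=; elim: i ilt => // i IH ilt.
  by apply: leq_trans (ginc (Ordinal (ltnW ilt)) _ _) => //; rewrite ltnS;
    apply: IH.
have hVinc (i i' : 'I_n) : i < i' -> (h^-1%g : 'S_n) i < (h^-1%g : 'S_n) i'.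
  move=> ii'; rewrite ltnNge; apply/negP;
    rewrite leq_eqVlt => /orP [/eqP/ord_inj/perm_inj E|].
    by rewrite E ltnn in ii'.
  by move=> /hinc; rewrite !permKV => /(ltn_trans ii'); rewrite ltnn.
apply/permP => i; rewrite perm1; apply/val_inj/eqP;
  rewrite eqn_leq (ge h hinc) andbT.
by have := ge _ hVinc (h i); rewrite permK.
Qed.

Definition block_increasing B f s :=
  forall i i' : 'I_n, i < i' -> block B i = block B i' -> f (s i) < f (s i').

Lemma block_increasing_adj B f s :
  (forall i i' : 'I_n, i' = i.+1 :> nat -> i' \notin B -> f (s i) < f (s i')) ->
  block_increasing B f s.
Proof.
move=> adj i i'; case: i' => m; elim: m => // m IH mn im /eqP E.
have /(block_eqP _ (ltnW im)) nB := E.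
pose i' := Ordinal mn; pose j := Ordinal (ltnW mn).
have fj : f (s j) < f (s i') by apply: adj => //; apply/negP => /nB;
  rewrite im leqnn.
move: im; rewrite ltnS leq_eqVlt => /orP [/eqP ij|ij].
  by rewrite (_ : i = j) //; apply: val_inj.
apply: leq_trans fj; rewrite ltnS; apply/ltnW/(IH (ltnW mn)) => //.
apply/eqP; apply/(@block_eqP B i j (ltnW ij)) => b /nB;
  apply: contraNN => /andP [-> /=].
exact: leqW.
Qed.

(** By the rearrangement inequality this statistic is largest, inside a coset
    of a Young subgroup, at the arrangement increasing along the blocks.  It
    plays the part of the number of inversions. *)
Definition Psi f s := \sum_(i < n) i * f (s i).

Lemma Psi_tperm f s (i i' : 'I_n) : i < i' -> f (s i') < f (s i) ->
  Psi f s < Psi f (tperm i i' * s)%g.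
Proof.
move=> ii' lt; have ne : i' != i by rewrite neq_ltn ii' orbT.
rewrite /Psi (bigD1 i) //= (bigD1 i') //= [ltnRHS](bigD1 i) //=
  [X in _ < _ + X](bigD1 i') //=.
rewrite !permM tpermL tpermR [X in _ + (_ + X) < _](_ : _ =
  \sum_(i0 < n | (i0 != i) && (i0 != i')) i0 * f ((tperm i i' * s)%g i0)).
  rewrite !addnA ltn_add2r; nia.
apply: eq_bigr => c /andP [ci ci']; rewrite permM tpermD // eq_sym //.
Qed.

Lemma tperm_young B (i i' : 'I_n) : block B i = block B i' ->
    tperm i i' \in young B.
Proof. by move=> E; apply/youngP => c; case: tpermP => [->|->|]. Qed.

(** The permutation relating the two arrangements preserves the blocks and is
    increasing inside each of them, so it is increasing, hence trivial. *)
Lemma block_increasing_uniq B f s t :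
  block_increasing B f s -> block_increasing B f t ->
  t \in (young B :* s)%g -> t = s.
Proof.
move=> sinc tinc; rewrite mem_rcoset => /youngP.
rewrite -{2}(mulgKV s t); move: tinc; rewrite -(mulgKV s t).
move: (t * s^-1)%g => h hinc; rewrite !mulgK => hB.
rewrite (_ : h = 1%g) ?mul1g //; apply: increasing_perm1 => i i' ii'.
have bi : block B i <= block B i' by apply/block_mono/ltnW.
move: bi; rewrite leq_eqVlt => /orP [/eqP E|lt]; last first.
  by rewrite ltnNge; apply/negP => /(block_mono B); rewrite !hB leqNgt lt.
have := hinc _ _ ii' E; rewrite !permM => lt.
rewrite ltnNge leq_eqVlt; apply/negP => /orP [/eqP/ord_inj/perm_inj E'|lt'].
  by rewrite E' ltnn in ii'.
by have := sinc _ _ lt'; rewrite !hB E => /(_ erefl) /(ltn_trans lt);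
  rewrite ltnn.
Qed.

(** Otherwise swapping two positions of a block would increase Psi. *)
Lemma Psi_max_increasing B f t : injective f ->
  (forall u, u \in (young B :* t)%g -> Psi f u <= Psi f t) ->
  block_increasing B f t.
Proof.
move=> f_inj tmax i i' ii' E.
case: (ltngtP (f (t i)) (f (t i'))) => // [lt|/f_inj/perm_inj E']; last first.
  by rewrite E' ltnn in ii'.
have /tmax : (tperm i i' * t \in young B :* t)%g.
  by rewrite mem_rcoset mulgK tperm_young.
by rewrite leqNgt Psi_tperm.
Qed.

Lemma block_sort B f s : injective f ->
  exists2 t, t \in (young B :* s)%g & block_increasing B f t /\
    forall u, u \in (young B :* s)%g -> Psi f u <= Psi f t.
Proof.
move=> f_inj; case: (@arg_maxnP _ s (mem (young B :* s)%g) (Psi f)) => /=.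
  exact: rcoset_refl.
move=> t ts tmax; exists t => //; split=> //.
by apply: Psi_max_increasing => // u; rewrite (rcoset_eqP ts); apply: tmax.
Qed.

(** Maximisers of Psi in the coset are increasing along the blocks, and there
    is only one such arrangement. *)
Lemma Psi_max B f s t : injective f -> block_increasing B f s ->
  t \in (young B :* s)%g -> t = s \/ Psi f t < Psi f s.
Proof.
move=> f_inj sinc ts; have [m ms [minc mmax]] := block_sort B s f_inj.
have E := block_increasing_uniq sinc minc ms; rewrite E in mmax.
have := mmax _ ts; rewrite leq_eqVlt => /orP [/eqP Ets|]; last by right.
left; apply: (block_increasing_uniq sinc _ ts);
  apply: Psi_max_increasing => // u.
by rewrite (rcoset_eqP ts) Ets; apply: mmax.
Qed.

End Blocks.

(** * The descent basis of the regular representation *)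

HB.instance Definition _ (V : lmodType rat) (S : V -> Prop) :=
  GRing.isSubmodClosed.Build rat V (spanQ S) (spanQ_submod_closed S).

Lemma spanQ_sub (V : lmodType rat) (S : V -> Prop) (U : submodClosed V) :
  (forall v, S v -> v \in U) -> {subset spanQ S <= U}.
Proof.
move=> SU v; move: v; apply: spanQ_ind => [|a u v /SU uU vU];
  first exact: rpred0.
by rewrite rpredD ?rpredZ.
Qed.

Lemma spanQ_coef (V : lmodType rat) (I : finType) (P : pred I) (b : I -> V) v :
  v \in spanQ (fun u => exists2 i, P i & u = b i) ->
  exists2 c : I -> rat, (forall i, ~~ P i -> c i = 0) & v = \sum_i c i *: b i.
Proof.
move: v; apply: spanQ_ind => [|a u v [i Pi ->] [c c0 ->]].
  by exists (fun=> 0) => //; rewrite big1 // => i _; rewrite scale0r.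
exists (fun j => c j + (if j == i then a else 0)) => [j nPj|].
  by rewrite c0 //; case: eqP => [E|]; rewrite ?addr0 //; rewrite E Pi in nPj.
under [RHS]eq_bigr do rewrite scalerDl.
rewrite big_split /= addrC; congr (_ + _).
by rewrite (bigD1 i) //= eqxx big1 ?addr0 // => j /negbTE ->; rewrite scale0r.
Qed.

(** A one-sided inverse of a square matrix is two-sided. *)
Lemma fin_left_inverse (I : finType) (V W : I -> I -> rat) :
  (forall s t, \sum_p W s p * V p t = (s == t)%:R) ->
  forall p q, \sum_t V p t * W t q = (p == q)%:R.
Proof.
move=> WV p q.
pose mx (M : I -> I -> rat) :=
  \matrix_(i < #|I|, j < #|I|) M (enum_val i) (enum_val j).
have mxM M M' : mx M *m mx M' = mx (fun s t => \sum_p M s p * M' p t).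
  apply/matrixP => i j; rewrite !mxE (reindex (@enum_val I I)) /=; last first.
    exact/onW_bij/enum_val_bij.
  by apply: eq_bigr => l _; rewrite !mxE.
have : mx W *m mx V = 1%:M.
  by rewrite mxM; apply/matrixP => i j; rewrite !mxE WV (inj_eq enum_val_inj).
move=> /mulmx1C /matrixP /(_ (enum_rank p) (enum_rank q)).
by rewrite mxM !mxE !enum_rankK (inj_eq enum_rank_inj).
Qed.

Section DescentBasis.
Variable n : nat.
Implicit Types (A B : {set 'I_n}) (s t p q h : 'S_n).

Local Notation val := (@nat_of_ord n).

(** A block is an interval of positions none of which, except the first, lies
    in A; so a descent outside A is a descent inside a block. *)
Lemma Des_subP A s : reflect (block_increasing A val s) (Des s \subset A).
Proof.
apply: (iffP subsetP) => [sA|sinc i].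
  apply: block_increasing_adj => i i' ii' /negP i'A; rewrite ltnNge leq_eqVlt.
  apply/negP => /orP [/eqP/ord_inj/perm_inj E|lt].
    by move: ii'; rewrite E => /n_Sn.
  by apply: i'A; apply: sA; rewrite inE; apply/existsP; exists i;
    rewrite ii' eqxx.
rewrite inE => /existsP [j /andP [/eqP ji lt]]; apply: contraLR lt => iA.
rewrite -leqNgt ltnW //; apply: sinc; first by rewrite -ji.
apply/eqP/block_eqP => [|b bA]; first by rewrite -ji.
apply: contraNN iA; rewrite -ji => /andP [jb bj].
by rewrite (_ : i = b) //; apply/val_inj/eqP; rewrite /= -ji eqn_leq jb bj.
Qed.

Definition coset_vec A s : {ffun 'S_n -> rat^o} :=
    [ffun t => (t \in young A :* s)%g%:R].

Definition des_vec p := coset_vec (Des p) p.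

Definition span_des A : {pred {ffun 'S_n -> rat^o}} :=
  spanQ (fun v => exists2 p, Des p \subset A & v = des_vec p).
HB.instance Definition _ A := GRing.SubmodClosed.on (span_des A).

Lemma mem_coset_sym A s t : (t \in young A :* s)%g = (s \in young A :* t)%g.
Proof. exact: rcoset_sym. Qed.

Lemma card_young_neq0 A : #|young A|%:R != 0 :> rat.
Proof. by rewrite Num.Theory.pnatr_eq0 -lt0n (cardG_gt0 (young_group A)). Qed.

Lemma sum_coset_const (M : lmodType rat) A (x : 'S_n -> M) s :
  (forall h t, h \in young A -> x (h * t)%g = x t) ->
  \sum_(t in (young A :* s)%g) x t = #|young A|%:R *: x s.
Proof.
move=> xinv; rewrite (eq_bigr (fun=> x s)).
  by rewrite sumr_const card_rcoset scaler_nat.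
by move=> t /rcosetP [h hA ->]; rewrite xinv.
Qed.

Lemma coset_vec_eq A s t : t \in (young A :* s)%g ->
    coset_vec A t = coset_vec A s.
Proof. by move=> ts; apply/ffunP => u; rewrite !ffunE (rcoset_eqP ts). Qed.

Lemma coset_vec_inv A s t h : h \in young A ->
    coset_vec A s (h * t)%g = coset_vec A s t.
Proof.
by move=> hA; rewrite !ffunE !mem_rcoset -mulgA (@groupMl _ (young_group A)).
Qed.

Lemma sum_coset (M : nmodType) A (f : 'S_n -> M) t :
  \sum_(u in (young A :* t)%g) f u = \sum_(h in young A) f (h * t)%g.
Proof.
rewrite (reindex_inj (mulIg t)) /=; apply: eq_bigl => h.
by rewrite mem_rcoset mulgK.
Qed.

Lemma sum_coset_refine (M : lmodType rat) A B (f : 'S_n -> M) s :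
    young A \subset young B ->
  \sum_(t in (young B :* s)%g) \sum_(u in (young A :* t)%g) f u =
  #|young A|%:R *: \sum_(t in (young B :* s)%g) f t.
Proof.
move=> /subsetP AB; under eq_bigr do rewrite sum_coset.
rewrite exchange_big /= (eq_bigr (fun=> \sum_(t in (young B :* s)%g) f t)).
  by rewrite sumr_const scaler_nat.
move=> h /AB hB; rewrite [RHS](reindex_inj (mulgI h)); apply: eq_bigl => t.
by rewrite !mem_rcoset -mulgA (@groupMl _ (young_group B) _ _ hB).
Qed.

Definition delta t : {ffun 'S_n -> rat^o} := [ffun u => (u == t)%:R].

Lemma coset_vecE A s : coset_vec A s = \sum_(t in (young A :* s)%g) delta t.
Proof.
apply/ffunP => u; rewrite sum_ffunE ffunE; under eq_bigr do rewrite ffunE.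
have [us|us] := boolP (u \in _); last first.
  by rewrite big1 // => t ts; case: eqP us => // ->; rewrite ts.
rewrite (bigD1 u) //= eqxx big1 ?addr0 // => t /andP [_].
by rewrite eq_sym => /negbTE ->.
Qed.

Lemma sum_coset_vec_refine A B s : B \subset A ->
  \sum_(u in (young B :* s)%g) coset_vec A u = #|young A|%:R *: coset_vec B s.
Proof.
move=> BA; under eq_bigr do rewrite coset_vecE.
by rewrite sum_coset_refine ?coset_vecE //; apply: young_anti.
Qed.

(** Let s be increasing along the A-blocks and j a point of A that is not a
    descent of s.  The coset of young (A :\ j) through s is the union of the
    coset of young A through s and of cosets of young A on which Psi stays below
    Psi s.  The first kind of coset is treated by induction on #|A|, the others
    by induction on Psi. *)
Lemma coset_vec_span A s : coset_vec A s \in span_des A.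
Proof.
have [m] := ubnP #|A|; elim: m A s => // m IHm A s Am.
have [t ts [tinc _]] := block_sort A s (@ord_inj n).
rewrite -(coset_vec_eq ts) => {s ts}.
have [l] := ubnP (Psi val t); elim: l t tinc => // l IHl t tinc tl.
have [->|] := eqVneq A (Des t).
  by apply: mem_spanQ; exists t.
move/Des_subP: (tinc) => dA;
  rewrite eq_sym eqEsubset dA /= => /subsetPn [j jA jd].
pose B := A :\ j; have BA : B \subset A by apply: subsetDl.
have sBA : {subset span_des B <= span_des A}.
  apply: spanQ_sub => _ [p pB ->]; apply: mem_spanQ; exists p => //.
  exact: subset_trans BA.
have BcA : (#|B| < m)%N by move: Am; rewrite (cardsD1 j) jA.
have tB : block_increasing B val t by apply/Des_subP; rewrite subsetD1 dA.
have AB : young A \subset young B by apply: young_anti.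
have sub : (young A :* t \subset young B :* t)%g by rewrite mulSg.
have := sum_coset_vec_refine t BA.
rewrite (big_setID (young A :* t)%g) /= (setIidPr sub).
rewrite (eq_bigr (fun=> coset_vec A t)); last by move=> u /coset_vec_eq.
rewrite sumr_const card_rcoset -scaler_nat => /(canRL (addrK _)) E.
rewrite -[coset_vec A t](scalerK (card_young_neq0 A)) E rpredZ ?rpredB
  ?rpredZ //.
  exact/sBA/IHm.
apply: rpred_sum => u /setDP [uB uA].
have [v vu [vinc _]] := block_sort A u (@ord_inj n); rewrite -(coset_vec_eq vu).
have vB : v \in (young B :* t)%g.
  rewrite -(rcoset_eqP uB); move: vu; rewrite !mem_rcoset; exact/subsetP.
have [vt|lt] := Psi_max (@ord_inj n) tB vB.
  by rewrite vt mem_coset_sym in vu; rewrite vu in uA.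
by apply: IHl => //; apply: leq_trans lt _.
Qed.

Lemma young_setT : young [set: 'I_n] = [set 1%g].
Proof.
apply/setP => h; rewrite in_set1; apply/idP/eqP => [/youngP hT|->];
  last by apply/youngP => i; rewrite perm1.
have blk (i : 'I_n) : block setT i = i.+1.
  rewrite /block -[RHS](card_initial 1 (ltn_ord i)); apply: eq_card => b.
  by rewrite -{2}[b](perm1 b) mem_initial !inE ltnS.
by apply/permP => i; rewrite perm1; apply: ord_inj; have := hT i;
  rewrite !blk => -[].
Qed.

(** The n! vectors [des_vec p] generate a space of dimension n!, since the
    cosets of young setT are single permutations. *)
Lemma des_dual_exists : exists W : 'S_n -> 'S_n -> rat,
  forall p q, \sum_t des_vec p t * W t q = (p == q)%:R.
Proof.
have spans s : exists c : 'S_n -> rat, coset_vec setT s =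
  \sum_p c p *: des_vec p.
  by have [c _ E] := spanQ_coef (coset_vec_span setT s); exists c.
have {spans} /boolp.choice [W WE] := spans.
have WV s t : \sum_p W s p * des_vec p t = (s == t)%:R.
  have /ffunP /(_ t) := WE s; rewrite sum_ffunE ffunE young_setT mem_rcoset.
  rewrite in_set1 -eq_mulgV1 eq_sym => ->.
  by apply: eq_bigr => p _; rewrite [RHS]ffunE.
by exists W; apply: fin_left_inverse.
Qed.

Definition des_dual := projT1 (cid des_dual_exists).

Lemma des_vecK p q : \sum_t des_vec p t * des_dual t q = (p == q)%:R.
Proof. by rewrite /des_dual; case: cid. Qed.

(** The coordinate along [des_vec p] of the coset vector of young A at s. *)
Definition des_coef A s p := \sum_(t in (young A :* s)%g) des_dual t p.

Lemma des_coefE A s p : des_coef A s p = \sum_t coset_vec A s t * des_dual t p.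
Proof.
rewrite /des_coef big_mkcond; apply: eq_bigr => t _.
by rewrite ffunE; case: ifP; rewrite ?mul1r ?mul0r.
Qed.

Lemma des_coefP A s :
  (forall p, ~~ (Des p \subset A) -> des_coef A s p = 0) /\
  (forall t, coset_vec A s t = \sum_p des_coef A s p * des_vec p t).
Proof.
have [c c0 E] := spanQ_coef (coset_vec_span A s).
have Et t : coset_vec A s t = \sum_p c p * des_vec p t.
  by rewrite E sum_ffunE; apply: eq_bigr => p _; rewrite [LHS]ffunE.
have cE p : des_coef A s p = c p.
  rewrite des_coefE; under eq_bigr do rewrite Et mulr_suml.
  rewrite exchange_big (bigD1 p) //= [X in _ + X]big1 ?addr0.
    by under eq_bigr do rewrite -mulrA; rewrite -mulr_sumr des_vecK eqxx mulr1.
  move=> q /negbTE qp; under eq_bigr do rewrite -mulrA.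
  by rewrite -mulr_sumr des_vecK qp mulr0.
split=> [p /c0 <-|t]; first by rewrite cE.
by rewrite Et; apply: eq_bigr => p _; rewrite cE.
Qed.

(** A function on cosets of young A that is killed by the coset sums for the
    larger groups young (A :\ j) extends linearly to a map that vanishes on
    every [des_vec p] with Des p strictly inside A. Expanding the coset of s
    in the descent basis leaves the terms with Des p = A. *)
Lemma des_expand (M : lmodType rat) A (x : 'S_n -> M) s :
    (forall h t, h \in young A -> x (h * t)%g = x t) ->
    (forall j t, j \in A -> \sum_(u in (young (A :\ j) :* t)%g) x u = 0) ->
  x s = \sum_(p | Des p == A) des_coef A s p *: x p.
Proof.
move=> xinv xrel; apply: (scalerI (card_young_neq0 A)).
have [c0 cE] := des_coefP A s.
have vx p : Des p \subset A ->
    \sum_t des_vec p t *: x t = if Des p == A then #|young A|%:R *: x p else 0.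
  move=> pA; have -> : \sum_t des_vec p t *: x t =
    \sum_(t in (young (Des p) :* p)%g) x t.
    rewrite [RHS]big_mkcond; apply: eq_bigr => t _; rewrite ffunE.
    by case: ifP; rewrite ?scale1r ?scale0r.
  case: eqP => [E|/eqP ne]; first by rewrite E sum_coset_const.
  have /subsetPn [j jA jp] : ~~ (A \subset Des p).
    by apply: contraNN ne => Ap; rewrite eqEsubset pA.
  apply: (scalerI (card_young_neq0 (A :\ j))); rewrite scaler0.
  have sub : young (A :\ j) \subset young (Des p).
    by apply: young_anti; rewrite subsetD1 pA.
  by rewrite -sum_coset_refine // big1 // => t _; apply: xrel.
rewrite -sum_coset_const // (_ : \sum_(t in _) x t =
  \sum_t coset_vec A s t *: x t); last first.
  rewrite [LHS]big_mkcond; apply: eq_bigr => t _; rewrite ffunE.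
  by case: ifP; rewrite ?scale1r ?scale0r.
under eq_bigr do rewrite cE scaler_suml.
rewrite exchange_big scaler_sumr [RHS]big_mkcond /=; apply: eq_bigr => p _.
under eq_bigr do rewrite -scalerA.
rewrite -scaler_sumr; case: (boolP (Des p \subset A)) => pA.
  by rewrite vx //; case: eqP; rewrite ?scaler0 // !scalerA mulrC.
rewrite c0 // !scale0r scaler0.
by case: eqP => // E; rewrite E subxx in pA.
Qed.

(** The vectors [des_vec p] with Des p inside A form a basis of the
    permutation module on the cosets of young A, and the left side is a multiple
    of the trace of s on it; the right side counts the t whose coset is fixed.
    The kernel P below is the projection onto that module along the other basis
    vectors. *)
Lemma trace_coset A s :
  #|young A|%:R * \sum_(p | Des p \subset A) des_coef (Des p) (p * s)%g p =
  #|[set t | (t * s * t^-1)%g \in young A]|%:R.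
Proof.
pose P r t := \sum_(p | Des p \subset A) des_dual r p * des_vec p t.
have Pinv r h t : h \in young A -> P r (h * t)%g = P r t.
  move=> hA; apply: eq_bigr => p pA; congr (_ * _); apply: coset_vec_inv.
  by move: hA; apply/subsetP/young_anti.
have -> : \sum_(p | Des p \subset A) des_coef (Des p) (p * s)%g p =
  \sum_t P (t * s)%g t.
  rewrite exchange_big; apply: eq_bigr => p _ /=.
  rewrite /des_coef [LHS]big_mkcond (reindex_inj (mulIg s)) /=.
  apply: eq_bigr => t _; rewrite ffunE !mem_rcoset invMg mulgA mulgK.
  by case: ifP; rewrite ?mulr1 ?mulr0.
have -> : #|young A|%:R * \sum_t P (t * s)%g t =
          \sum_t \sum_(u in (young A :* (t * s))%g) P u t.
  under [RHS]eq_bigr do rewrite sum_coset.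
  rewrite [RHS]exchange_big mulr_natl -sumr_const /=; apply: eq_bigr => h hA.
  rewrite (reindex_inj (mulgI h)) /=; apply: eq_bigr => t _.
  by rewrite Pinv // mulgA.
rewrite -sum1_card natr_sum [RHS]big_mkcond; apply: eq_bigr => t _ /=.
have [c0 cE] := des_coefP A (t * s)%g; have := cE t.
rewrite ffunE mem_rcoset invMg [t \in _]in_set => E.
have -> : (t * s * t^-1 \in young A)%g = (t * (s^-1 * t^-1) \in young A)%g.
  by rewrite -(@groupV _ (young_group A)) !invMg invgK mulgA.
rewrite exchange_big /= -[RHS]/(if _ then 1%:R else 0%:R).
transitivity (\sum_p des_coef A (t * s)%g p * des_vec p t); last first.
  by rewrite -E; case: ifP.
rewrite [LHS]big_mkcond; apply: eq_bigr => p _.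
by case: ifPn => [_|/c0 ->]; rewrite ?mul0r // /des_coef mulr_suml.
Qed.

Lemma Ind_youngE A s : 'Ind[[set: 'S_n], young A] 1 s =
  #|young A|%:R^-1 * #|[set t | (t * s * t^-1)%g \in young A]|%:R.
Proof.
rewrite (@cfIndE _ [set: 'S_n]%G (young_group A)) ?subsetT //; congr (_ * _).
rewrite -sum1_card natr_sum [RHS]big_mkcond (reindex_inj invg_inj).
apply: eq_big => t; first by rewrite in_setT.
by rewrite [t \in _]in_set cfun1E conjgE invgK mulgA => _; case: ifP.
Qed.

Lemma trace_subsets A s :
  ratr (\sum_(p | Des p \subset A) des_coef (Des p) (p * s)%g p) =
  'Ind[[set: 'S_n], young A] 1 s :> algC.
Proof.
rewrite Ind_youngE -[X in ratr X](mulKf (card_young_neq0 A)) trace_coset.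
by rewrite rmorphM fmorphV !rmorph_nat.
Qed.

(** Adding or removing a point of A outside B reverses the sign. *)
Lemma sum_sign_interval (R : pzRingType) A B : B \subset A -> B != A ->
  \sum_(C : {set 'I_n} | (B \subset C) && (C \subset A)) (-1) ^+ #|A :\: C| =
    0 :> R.
Proof.
move=> BA neq; have /subsetPn [j jA jB] : ~~ (A \subset B).
  by apply: contraNN neq => AB; rewrite eqEsubset BA.
rewrite (bigID (fun C : {set 'I_n} => j \in C)) /=.
rewrite (reindex_onto (fun C : {set 'I_n} => j |: C)
  (fun C : {set 'I_n} => C :\ j)) /=; last first.
  by move=> C /andP [_ jC]; rewrite setD1K.
apply/eqP; rewrite addr_eq0 -sumrN; apply/eqP; apply: eq_big => C.
  rewrite setU11 andbT subUset sub1set jA /=.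
  case: (boolP (j \in C)) => jC; last first.
    rewrite setU1K // eqxx !andbT; congr (_ && _);
      apply/idP/idP => [BC|/subset_trans -> //].
      apply/subsetP => b bB; move/subsetP/(_ b bB): BC;
        rewrite !inE => /orP [/eqP E|//].
      by rewrite -E bB in jB.
    exact: subsetUr.
  rewrite andbF; apply/negbTE; rewrite negb_and orbC; apply/orP; left.
  by apply: contraTneq jC => <-; rewrite setD11.
move=> /andP [_ /eqP E]; have jC : j \notin C by rewrite -E setD11.
rewrite (_ : A :\: C = j |: (A :\: (j |: C))).
  by rewrite cardsU1 !inE eqxx /= exprD expr1 mulN1r opprK.
apply/setP => i; rewrite !inE; case: eqP => //= ->; by rewrite jA jC.
Qed.

(** Moebius inversion of [trace_subsets] over the subsets of A. *)
Lemma solomon_charE A s :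
  ratr (\sum_(p | Des p == A) des_coef A (p * s)%g p) = solomon_char A s.
Proof.
rewrite /solomon_char sum_cfunE.
rewrite (eq_bigr (fun B : {set 'I_n} => \sum_(p | Des p \subset B)
  (-1) ^+ #|A :\: B| * ratr (des_coef (Des p) (p * s)%g p))); last first.
  by move=> B _; rewrite cfunE -trace_subsets rmorph_sum mulr_sumr.
rewrite [RHS](exchange_big_dep xpredT) //=
  rmorph_sum /= [RHS](bigID (fun p => Des p \subset A)) /=.
rewrite [X in _ = _ + X]big1 ?addr0; last first.
  move=> p pA; rewrite big_pred0 // => C; apply: contraNF pA => /andP [CA pC].
  exact: subset_trans CA.
rewrite [RHS](bigID (fun p => Des p == A)) /= [X in _ = _ + X]big1 ?addr0;
  last first.
  move=> p /andP [pA ne]; rewrite -mulr_suml.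
  rewrite (eq_bigl (fun C : {set 'I_n} => (Des p \subset C) && (C \subset A)));
    last first.
    by move=> C; rewrite andbC.
  by rewrite sum_sign_interval ?mul0r.
apply: eq_big => [p|p /eqP E]; first by case: eqP => [->|];
  rewrite ?subxx ?andbF.
rewrite (big_pred1 A) => [|C]; first by rewrite setDv cards0 mul1r E.
by rewrite E [RHS]eqEsubset.
Qed.

End DescentBasis.

(** * Elements of the ideal J *)

Section Hook.
Variables n k : nat.
Hypothesis hk : (1 <= k <= n)%N.
Implicit Types (A : {set 'I_n}) (s t : 'S_n) (m : 'X_{1..n + n}) (b : bool).
Implicit Types (a c i : 'I_n) (S T : {set 'I_n}).

Local Notation pol := {mpoly rat[n + n]}.
Local Notation Delta := (Delta n k).
Local Notation J := (J n k).

(** Treating x and y as the two values of a boolean lets one proof serve both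
    families of variables. *)
Definition side b a : 'I_(n + n) := if b then rshift n a else lshift n a.

Lemma side_eq b b' a c : (side b a == side b' c) = (b == b') && (a == c).
Proof.
case: b b' => [] [] //=;
  rewrite ?(inj_eq (@rshift_inj _ _)) ?(inj_eq (@lshift_inj _ _)) //.
  by rewrite eq_rlshift.
by rewrite eq_lrshift.
Qed.

Lemma mnm_sideP m m' : (forall b a, m (side b a) = m' (side b a)) -> m = m'.
Proof.
move=> mm; apply/mnmP => i; case: (split_ordP i) => a ->.
  exact: (mm false).
exact: (mm true).
Qed.

Lemma diag_perm_side s b a : diag_perm s (side b a) = side b (s a).
Proof. by case: b; rewrite /= ?diag_perml ?diag_permr. Qed.

(** Consider the weakly decreasing weight that drops by one at each element of
    A (the drop j lies between the positions j-1 and j, counted from 0) and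
    vanishes at position k-1.  This is the exponent it carries at position i, on
    the x side for [b = false] and on the y side for [b = true]. *)
Definition hgt b A (i : nat) : nat :=
  if b then #|[set j in A | (k <= j <= i)%N]| else
    #|[set j in A | (i < j < k)%N]|.

Arguments hgt : simpl never.

(** The weight with drop set A placed along the arrangement s.  The monomial
    a_pi is the case [A = Des pi], and the monomials of Delta are the case
    [A = setT]. *)
Definition expo A s : 'X_{1..n + n} :=
  [multinom (match split i with
             | inl a => hgt false A (s^-1%g a)
             | inr a => hgt true A (s^-1%g a) end) | i < n + n].

Lemma expoE A s b a : expo A s (side b a) = hgt b A (s^-1%g a).
Proof. by rewrite mnmE; case: b => /=;
  rewrite ?(unsplitK (inl _)) ?(unsplitK (inr _)). Qed.

Lemma mon_sideE m : 'X_[m] = (\prod_a varx a ^+ m (side false a)) *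
  \prod_a vary a ^+ m (side true a) :> pol.
Proof. by rewrite mpolyXE_id big_split_ord. Qed.

Lemma a_monE s : a_mon k s = 'X_[expo (Des s) s].
Proof.
rewrite mon_sideE /a_mon; congr (_ * _).
  rewrite [RHS](reindex_inj (@perm_inj _ s)) [LHS]big_mkcond /=.
  apply: eq_bigr => i _; rewrite (expoE _ _ false) permK /dexp /hgt /=.
  case ik: (i.+1 < k)%N; first by [].
  rewrite eq_card0 ?expr0 // => j; rewrite !inE;
    apply/negP => /andP [_ /andP [ij jk]].
  by move: ik; rewrite (leq_ltn_trans ij jk).
rewrite [RHS](reindex_inj (@perm_inj _ s)) [LHS]big_mkcond /=.
apply: eq_bigr => i _; rewrite (expoE _ _ true) permK /dexp /hgt ltnS.
case ki: (k <= i)%N; first by rewrite ltnNge (leq_trans ki).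
rewrite eq_card0 ?expr0 // => j; rewrite !inE;
  apply/negP => /andP [_ /andP [kj ji]].
by move: ki; rewrite (leq_trans kj ji).
Qed.

Lemma pol_act_mon s A t : pol_act s 'X_[expo A t] = 'X_[expo A (t * s)%g].
Proof.
rewrite pol_actX; congr 'X_[_]; apply: mnm_sideP => b a.
rewrite mnmE expoE -diag_permV diag_perm_side expoE.
by rewrite invMg permM.
Qed.

Lemma pol_actM_mul s (p q : pol) : pol_act s (p * q) =
    pol_act s p * pol_act s q.
Proof. exact: msymM. Qed.

Lemma card_ord_itv (l u : nat) : (u <= n)%N ->
    #|[set j : 'I_n | (l <= j < u)%N]| = (u - l)%N.
Proof.
move=> un; have [lu|ul] := leqP l u; last first.
  rewrite (eqP (ltnW ul : _ - _ == 0)%N) eq_card0 // => j; rewrite !inE.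
  by apply/negP => /andP [/leq_ltn_trans H /H]; rewrite ltnNge (ltnW ul).
have E : #|[set j : 'I_n | (j < u)%N]| = u.
  by rewrite -sum1dep_card -(big_ord_widen n (fun=> 1%N) un) sum1_card card_ord.
have F : #|[set j : 'I_n | (j < l)%N]| = l.
  by rewrite -sum1dep_card -(big_ord_widen n (fun=> 1%N) (leq_trans lu un))
    sum1_card card_ord.
have := cardsID [set j : 'I_n | (j < l)%N] [set j : 'I_n | (j < u)%N].
rewrite E (_ : _ :&: _ = [set j : 'I_n | (j < l)%N]) ?F; last first.
  apply/setP => j; rewrite !inE andbC; case: ltnP => //= jl;
    exact: leq_trans jl lu.
move=> Eu; rewrite -[in RHS]Eu addKn; apply: eq_card => j.
by rewrite !inE leqNgt.
Qed.

Lemma hgt_setT b i : hgt b setT i = if b then (i.+1 - k)%N else (k - i.+1)%N.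
Proof.
case: b; rewrite /hgt.
  rewrite -(card_ord_itv k (ltn_ord i)); apply: eq_card => j.
  by rewrite !inE ltnS.
rewrite -(card_ord_itv i.+1 (proj2 (andP hk))); apply: eq_card => j.
by rewrite !inE.
Qed.

Lemma hgt_setC b A i : (hgt b A i + hgt b (~: A) i)%N = hgt b setT i.
Proof.
by case: b; rewrite /hgt -[RHS](cardsID A); congr (_ + _)%N;
  apply: eq_card => j;
  rewrite !inE /= andbC.
Qed.

Lemma pairing_linear (f : pol) : linear (pairing f : pol -> rat^o).
Proof.
move=> a u v; rewrite /pairing !raddf_sum /= -big_split /=.
apply: eq_bigr => m _; rewrite !mcoeffZ mderivmD mderivmZ mcoeffD mcoeffZ.
by rewrite mulrDr; congr (_ + _); apply: mulrCA.
Qed.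

Lemma pairing0 (f : pol) : pairing f 0 = 0.
Proof. by have := pairing_linear f (-1) 0 0;
  rewrite scaler0 addr0 scaleN1r addNr. Qed.

Lemma pairing_mulX (f g : pol) m : pairing (f * 'X_[m]) g = pairing f g^`M[m].
Proof.
rewrite -![pairing _ _]/(pairingr _ _) [f]mpolyE mulr_suml.
rewrite !(linear_sum (pairingr _)); apply: eq_bigr => m' _.
rewrite -scalerAl !(linearZ_LR (pairingr _)) /=; congr (_ *: _ : rat^o).
by rewrite /pairingr -mpolyXD !pairingX addmC mderivmDm.
Qed.

(** J consists of the f such that this functional vanishes on all multiples
    of f. *)
Definition pair_Delta (f : pol) : rat^o := pairing f Delta.
HB.instance Definition _ :=
    GRing.isLinear.Build rat pol rat^o *:%R pair_Delta (pairingr_linear Delta).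

Lemma mem_J (f : pol) : (forall m, pair_Delta (f * 'X_[m]) = 0) <->
    f \in sub_pred J.
Proof.
split=> [fL|/asboolP fJ m].
  apply/asboolP => g; move: g; apply: spanQ_ind => [|a _ v [m ->] fv].
    exact: pairing0.
  by have /= -> := pairing_linear f a Delta^`M[m] v;
    rewrite -pairing_mulX [pairing _ _]fL scaler0 add0r.
by rewrite /pair_Delta pairing_mulX fJ //; apply: mem_spanQ; exists m.
Qed.

Lemma pos_subproof (c : 'I_n) :
    ((if (c <= n - k)%N then c + k.-1 else n.-1 - c) < n)%N.
Proof. case: c => c; move: hk => /=; case: ifP; lia. Qed.

Lemma pos_inj : injective (fun c => Ordinal (pos_subproof c)).
Proof.
case=> c cn [] d dn [E]; apply: val_inj => /=; move: E hk cn dn.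
by case: ifP; case: ifP; lia.
Qed.

(** The position whose weight is the exponent standing in column c of the
    matrix defining Delta; it turns the Leibniz formula into a sum over
    arrangements. *)
Definition col_pos : 'S_n := perm pos_inj.

Lemma hook_mxE a c : hook_mx n k a c =
  varx a ^+ hgt false setT (col_pos c) * vary a ^+ hgt true setT (col_pos c).
Proof.
rewrite mxE !hgt_setT permE /=; case: c => c cn /=.
move: (vary a) (varx a) => y x; case: ifP => cnk.
  have -> : (k - (c + k.-1).+1)%N = 0%N by clear -hk cn cnk; lia.
  have -> : ((c + k.-1).+1 - k)%N = c by clear -hk cn cnk; lia.
  by rewrite expr0 mul1r.
have -> : ((n.-1 - c).+1 - k)%N = 0%N by clear -hk cn cnk; lia.
have -> : (k - (n.-1 - c).+1)%N = (c - (n - k))%N by clear -hk cn cnk; lia.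
by rewrite expr0 mulr1.
Qed.

Lemma DeltaE : Delta =
    \sum_(s : 'S_n) (-1) ^+ s *: 'X_[expo setT (s * col_pos)^-1%g].
Proof.
apply: eq_bigr => s _; rewrite scaler_sign mulr_sign;
  congr (if _ then - _ else _);
  rewrite mon_sideE -big_split /=; apply: eq_bigr => a _;
  by rewrite hook_mxE (expoE _ _ false) (expoE _ _ true) invgK permM.
Qed.

Lemma expo_setT_inj : injective (expo setT).
Proof.
move=> s t E; apply: (can_inj invgK); apply/permP => a; apply: ord_inj.
have := expoE setT s false a; have := expoE setT s true a.
rewrite E !expoE !hgt_setT /=.
move: (s^-1%g a) (t^-1%g a) => i j.
lia.
Qed.

Lemma pair_Delta_mon m : pair_Delta 'X_[m] =
    Delta@_m *+ \prod_(i < n + n) (m i) ^_ (m i).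
Proof. by rewrite /pair_Delta pairingX mcoeff_mderivm addm0. Qed.

Lemma pair_Delta_neq0 m : pair_Delta 'X_[m] != 0 -> exists s, m = expo setT s.
Proof.
rewrite pair_Delta_mon => H.
have /eqP Dm : Delta@_m != 0 by apply: contraNneq H => ->; rewrite mul0rn.
have [s /eqP sm|nos] := pickP (fun s => expo setT (s * col_pos)^-1%g == m).
  by exists (s * col_pos)^-1%g.
case: Dm; rewrite DeltaE raddf_sum big1 // => s _ /=.
by rewrite mcoeffZ mcoeffX nos mulr0.
Qed.

Lemma pair_Delta_full s : pair_Delta 'X_[expo setT s] != 0.
Proof.
rewrite pair_Delta_mon Num.Theory.mulrn_eq0 negb_or; apply/andP; split.
  by rewrite -lt0n prodn_gt0 // => i; rewrite ffact_gt0.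
rewrite DeltaE raddf_sum (bigD1 (s^-1 * col_pos^-1)%g) //= big1 ?addr0.
  by rewrite mcoeffZ mcoeffX mulgKV invgK eqxx mulr1 signr_eq0.
move=> t ne; rewrite mcoeffZ mcoeffX (inj_eq expo_setT_inj).
case: eqP => [E|]; last by rewrite mulr0.
by rewrite -E invgK mulgK eqxx in ne.
Qed.

Lemma pair_Delta_act s f : pair_Delta (pol_act s f) = (-1) ^+ s * pair_Delta f.
Proof.
rewrite /pair_Delta pairing_act Delta_act odd_permV.
by have /= := pairing_linear f ((-1) ^+ s) Delta 0;
  rewrite !addr0 pairing0 addr0 => ->.
Qed.

Lemma J_mul f g : f \in sub_pred J -> f * g \in sub_pred J.
Proof.
move=> /mem_J fJ; apply/mem_J => m.
rewrite [g]mpolyE mulr_sumr mulr_suml linear_sum big1 //= => m' _.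
by rewrite -scalerAr -scalerAl linearZ /= -mulrA -mpolyXD fJ scaler0.
Qed.

(** The functional only sees the monomials of Delta. *)
Lemma mon_J m : (forall m' s, (m + m')%MM <> expo setT s) ->
    'X_[m] \in sub_pred J.
Proof.
move=> mN; apply/mem_J => m'; rewrite -mpolyXD; apply/eqP; apply: contraT.
by move=> /pair_Delta_neq0 [s /mN].
Qed.

Lemma mon_J_both m a : (0 < m (side false a))%N -> (0 < m (side true a))%N ->
  'X_[m] \in sub_pred J.
Proof.
move=> m0 m1; apply: mon_J => m' s /mnmP E.
have := E (side false a); have := E (side true a).
rewrite !mnmDE !expoE (hgt_setT true) (hgt_setT false).
move: (m (side false a)) (m (side true a)) m0 m1 (s^-1%g a) => x y x0 y0 i; lia.
Qed.

(** The number of positions of the weight with all drops that carry a positive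
    exponent on side b. *)
Definition capacity b := if b then (n - k)%N else k.-1.

Lemma card_hgt_pos b s : #|[set a | (0 < expo setT s (side b a))%N]| =
    capacity b.
Proof.
rewrite -(card_imset _ (@perm_inj _ s^-1%g)).
transitivity #|[set i : 'I_n | (0 < hgt b setT i)%N]|.
  apply: eq_card => i; rewrite -[i in LHS](permK s) mem_imset;
    last exact: perm_inj.
  by rewrite !inE expoE permK.
rewrite /capacity; case: b.
  rewrite -(card_ord_itv k (leqnn n)); apply: eq_card => i.
  by rewrite !inE hgt_setT ltn_ord andbT subn_gt0.
rewrite -[RHS]subn0 -card_ord_itv; last by move: hk; lia.
by apply: eq_card => i; rewrite !inE hgt_setT; move: hk; lia.
Qed.

Lemma mon_J_many b m : (capacity b < #|[set a | 0 < m (side b a)]|)%N ->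
  'X_[m] \in sub_pred J.
Proof.
move=> cap; apply: mon_J => m' s E; move: cap;
  rewrite -(card_hgt_pos b s) -E ltnNge.
move=> /negP; apply; apply: subset_leq_card; apply/subsetP => a;
  rewrite !inE mnmDE.
by move=> ma; rewrite addn_gt0 ma.
Qed.

Definition chi b S : 'X_{1..n + n} := (\sum_(a in S) U_(side b a))%MM.

Lemma chiE b S b' a : chi b S (side b' a) = (b == b') && (a \in S) :> nat.
Proof.
rewrite mnm_sumE; under eq_bigr do rewrite mnm1E side_eq.
case: (b == b') => /=; last by rewrite big1.
have [aS|aS] := boolP (a \in S).
  rewrite (bigD1 a) //= eqxx big1 ?addn0 // => c /andP [_].
  by move=> /negbTE ->.
by rewrite big1 // => c cS; case: eqP => // ca; rewrite -ca cS in aS.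
Qed.

Lemma pol_act_chi s b S : pol_act s 'X_[chi b S] = 'X_[chi b (s @: S)].
Proof.
rewrite pol_actX; congr 'X_[_]; apply: mnm_sideP => b' a.
rewrite mnmE -diag_permV diag_perm_side !chiE; congr (nat_of_bool (_ && _)).
by rewrite -{2}[a](permKV s) mem_imset //; apply: perm_inj.
Qed.

Definition elem_sym b j : pol := \sum_(S : {set 'I_n} | #|S| == j) 'X_[chi b S].

Lemma pol_act_elem_sym s b j : pol_act s (elem_sym b j) = elem_sym b j.
Proof.
rewrite /elem_sym linear_sum /= (reindex_inj
  (imset_inj (@perm_inj _ s^-1%g))) /=.
apply: eq_big => S; first by rewrite card_imset //; apply: perm_inj.
move=> _; rewrite pol_act_chi -imset_comp; congr 'X_[chi b _].
by rewrite -[RHS]imset_id; apply: eq_imset => a /=; rewrite permKV.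
Qed.

Lemma lower_neighbour b (i : 'I_n) : (0 < hgt b setT i)%N -> exists i' : 'I_n,
  [/\ hgt b setT i = (hgt b setT i').+1, hgt (~~ b) setT i' = 0%N
    & hgt (~~ b) setT i = 0%N].
Proof.
have iltn := ltn_ord i; case: b; rewrite hgt_setT => ipos.
  have h : (i.-1 < n)%N by clear -iltn; lia.
  exists (Ordinal h); rewrite !(hgt_setT _ i) !(hgt_setT _ (Ordinal h)) /=.
  by clear -hk iltn ipos; split; lia.
have h : (i.+1 < n)%N by clear -hk iltn ipos; lia.
exists (Ordinal h); rewrite !(hgt_setT _ i) !(hgt_setT _ (Ordinal h)) /=.
by clear -hk iltn ipos; split; lia.
Qed.

(** The transposition of a and c fixes the product and changes the sign of
    Delta. *)
Lemma pair_Delta_twin m a c b j : a != c ->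
    (forall b', m (side b' a) = m (side b' c)) ->
  pair_Delta (elem_sym b j * 'X_[m]) = 0.
Proof.
move=> ac mac; have := pair_Delta_act (tperm a c) (elem_sym b j * 'X_[m]).
rewrite pol_actM_mul pol_act_elem_sym pol_actX odd_tperm ac.
set m' := (X in 'X_[X]).
have -> : m' = m.
  apply: mnm_sideP => b' d; rewrite mnmE -diag_permV diag_perm_side tpermV.
  by case: tpermP => // ->; rewrite mac.
by rewrite expr1 mulN1r => /eqP;
  rewrite -addr_eq0 -mulr2n Num.Theory.mulrn_eq0 => /eqP.
Qed.

(** If the functional does not kill the product with m, some term is a
    monomial of Delta.  Let a be an index of S with least exponent in this term.
    The index c carrying the next smaller exponent is outside S, so a and c have
    the same exponents in m, and [pair_Delta_twin] applies. *)
Lemma elem_sym_J b j : (0 < j)%N -> elem_sym b j \in sub_pred J.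
Proof.
move=> j0; apply/mem_J => m; apply/eqP; apply: contraT => Lne.
have [S /eqP Sj LS] : exists2 S : {set 'I_n}, #|S| == j &
  pair_Delta 'X_[chi b S + m] != 0.
  apply/exists_inP; rewrite -[X in is_true X]negbK negb_exists_in.
  apply: contraNN Lne => /forall_inP L0; rewrite /elem_sym mulr_suml linear_sum.
  rewrite big1 //= => S Sj; rewrite -mpolyXD; apply/eqP.
  by have := L0 S Sj; rewrite negbK.
have [s E] := pair_Delta_neq0 LS.
have SE b' a : (((b == b') && (a \in S)) + m (side b' a))%N =
  hgt b' setT (s^-1%g a).
  by rewrite -chiE -mnmDE E expoE.
have /card_gt0P [a0 a0S] : (0 < #|S|)%N by rewrite Sj.
pose F a := hgt b setT (s^-1%g a).
case: (arg_minnP F a0S) => a aS0 amin; have aS : a \in S by [].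
clear aS0.
have Fa : F a = (m (side b a)).+1 by rewrite /F -SE eqxx aS.
have [|i' [h1 h2 h3]] := @lower_neighbour b (s^-1%g a);
  first by rewrite -/(F a) Fa.
have cS : s i' \notin S.
  by apply/negP => /amin; rewrite {2}/F permK -ltnS -h1 ltnn.
have ac : a != s i' by apply: contraNneq cS => <-.
have F' b' : b' != b -> b' = ~~ b by clear; case: b b' => [] [].
case/eqP: Lne; apply: (pair_Delta_twin b j ac) => b'.
have := SE b' a; have := SE b' (s i'); rewrite permK (negbTE cS) aS andbF andbT.
have [E'|] := eqVneq b b'; first by rewrite -E' h1 add0n add1n => -> [].
by rewrite eq_sym => /F' ->; rewrite h2 h3 !add0n => -> ->.
Qed.

End Hook.

(** * Dominance and exchange *)

Section Straightening.
Variables n k : nat.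
Hypothesis hk : (1 <= k <= n)%N.
Implicit Types (A : {set 'I_n}) (s t : 'S_n) (m : 'X_{1..n + n}) (b : bool).
Implicit Types (a c : 'I_n) (S T : {set 'I_n}).

Local Notation pol := {mpoly rat[n + n]}.
Local Notation J := (J n k).
Local Notation hgt := (hgt k).
Local Notation expo := (@expo n k).
Local Notation elem_sym := (@elem_sym n).

Definition mon_class m : H' n k := quot_pi J 'X_[m].

Lemma quot_pi_eq0 (f : pol) : f \in sub_pred J -> quot_pi J f = 0.
Proof.
move=> fJ; rewrite -[RHS](linear0 (quot_pi J)).
by apply/eqP; rewrite quot_pi_eq subr0.
Qed.

Definition exp_at m b a : nat := m (side b a).

(** Dominance of the sorted exponents, separately in the x's and in the
    y's. *)
Definition dom m m' : Prop := forall b,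
  (\sum_a exp_at m b a = \sum_a exp_at m' b a)%N /\
  forall j, (top_sum (exp_at m b) j <= top_sum (exp_at m' b) j)%N.

Lemma dom_refl m : dom m m. Proof. by []. Qed.

Lemma dom_trans m1 m2 m3 : dom m1 m2 -> dom m2 m3 -> dom m1 m3.
Proof.
move=> d12 d23 b; have [e1 t1] := d12 b; have [e2 t2] := d23 b.
by split=> [|j]; [rewrite e1 | apply: leq_trans (t1 j) (t2 j)].
Qed.

(** This is the relation given by the elementary symmetric polynomial of
    degree #|S0| times m. *)
Lemma mon_class_exchange m b S0 : S0 != set0 ->
  mon_class (chi b S0 + m) =
    - \sum_(S : {set 'I_n} | (#|S| == #|S0|) && (S != S0)) mon_class
    (chi b S + m).
Proof.
rewrite -card_gt0 => S0n; apply/eqP; rewrite -addr_eq0; apply/eqP.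
have : elem_sym b #|S0| * 'X_[m] \in sub_pred J by apply/J_mul/elem_sym_J.
move=> /quot_pi_eq0; rewrite mulr_suml linear_sum /= (bigD1 S0) //= => E;
  rewrite -[RHS]E.
by rewrite /mon_class mpolyXD; congr (_ + _); apply: eq_bigr => S _;
  rewrite mpolyXD.
Qed.

Lemma exp_at_chi b b' S m a : exp_at (chi b S + m) b' a =
    ((b == b') && (a \in S) + exp_at m b' a)%N.
Proof. by rewrite /exp_at mnmDE chiE. Qed.

Lemma sum_exp_at_chi b S m T :
  (\sum_(a in T) exp_at (chi b S + m) b a =
    #|T :&: S| + \sum_(a in T) exp_at m b a)%N.
Proof.
under eq_bigr do rewrite exp_at_chi eqxx.
rewrite big_split /= -sum1_card; congr (_ + _)%N.
rewrite big_mkcond [RHS]big_mkcond; apply: eq_bigr => a _.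
by rewrite inE; case: (a \in T); case: (a \in S).
Qed.

Lemma top_chi_initial b m s j i : (j <= n)%N -> decreasing (exp_at m b \o s) ->
  top_sum (exp_at (chi b (initial s j) + m) b) i =
    (minn i j + top_sum (exp_at m b) i)%N.
Proof.
move=> jn dec; rewrite (top_sorted _ dec) (@top_sorted _ _ s); last first.
  move=> u v uv /=; rewrite !exp_at_chi eqxx !mem_initial leq_add ?dec //.
  by case: ltnP => // vj; rewrite (leq_ltn_trans uv vj).
under eq_bigr do rewrite exp_at_chi eqxx mem_initial.
rewrite big_split /=; congr (_ + _)%N.
have ijn : (minn i j <= n)%N by apply: leq_trans (geq_minr _ _) jn.
rewrite -[RHS]subn0 -(card_ord_itv 0 ijn) -sum1_card big_mkcond [RHS]big_mkcond.
apply: eq_bigr => u _; rewrite inE /= leq_min.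
by case: (u < i)%N; case: (u < j)%N.
Qed.

(** Raising the exponents that are already the largest gives the most dominant
    result. *)
Lemma dom_exchange b m s j S : (j <= n)%N -> decreasing (exp_at m b \o s) ->
    #|S| = j ->
  dom (chi b S + m) (chi b (initial s j) + m).
Proof.
move=> jn dec Sj b'; have [<-{b'}|bb'] := eqVneq b b'; last first.
  have E T : exp_at (chi b T + m) b' =1 exp_at m b'.
    by move=> a; rewrite exp_at_chi (negbTE bb').
  split=> [|i]; first by apply: eq_bigr => a _; rewrite !E.
  by rewrite !(eq_top_sum _ (E _)).
split=> [|i].
  have H T : (\sum_a exp_at (chi b T + m) b a = #|T| + \sum_a exp_at m b a)%N.
    by have := sum_exp_at_chi b T m setT;
      rewrite setTI !(eq_bigl _ _ (@in_setT _)).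
  by rewrite !H Sj card_initial.
rewrite (top_chi_initial i jn dec); apply/top_leP => T Ti;
  rewrite sum_exp_at_chi.
apply: leq_add; last exact: top_ub.
rewrite leq_min (leq_trans _ Ti) /=; last by apply/subset_leq_card/subsetIl.
by rewrite -Sj; apply/subset_leq_card/subsetIr.
Qed.

(** The j-th partial sum of the dominant choice is only reached by a set S on
    which m has the largest possible total. *)
Lemma dom_exchange_rev b m s j S : (j <= n)%N -> decreasing (exp_at m b \o s) ->
    #|S| = j ->
  dom (chi b (initial s j) + m) (chi b S + m) ->
  (\sum_(a in initial s j) exp_at m b a <= \sum_(a in S) exp_at m b a)%N.
Proof.
move=> jn dec Sj /(_ b) [_ /(_ j)]; rewrite (top_chi_initial j jn dec) minnn.
rewrite (top_sorted _ dec) -sum_initial; set M := (\sum_(a in _) _)%N.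
apply: contraTT; rewrite -!ltnNge => lt.
rewrite -[X in (_ < X)%N]prednK ?ltnS; last first.
  by rewrite (leq_trans _ (leq_addl _ _)) // (leq_ltn_trans _ lt).
apply/top_leP => T Tj; rewrite sum_exp_at_chi -ltnS prednK; last first.
  by rewrite (leq_trans _ (leq_addl _ _)) // (leq_ltn_trans _ lt).
have TS : (#|T :&: S| <= j)%N by rewrite -Sj subset_leq_card // subsetIr.
have TM : (\sum_(a in T) exp_at m b a <= M)%N.
  by rewrite /M sum_initial -(top_sorted _ dec); apply: top_ub.
have [E|ne] := eqVneq #|T :&: S| j; last first.
  by rewrite -addSn leq_add // ltn_neqAle ne.
have <- : S = T.
  apply/eqP; rewrite eqEcard Sj Tj andbT.
  have /eqP <- : T :&: S == S by rewrite eqEcard subsetIr E Sj leqnn.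
  exact: subsetIl.
by rewrite setIid Sj ltn_add2l.
Qed.

(** Order among indices with equal exponents; on the y side the arrangement is
    read backwards, so the order of the indices is reversed too. *)
Definition tie b a : nat := if b then val a else (n.-1 - a)%N.

Lemma tie_lt b a : (tie b a < n)%N.
Proof. by case: a => a an; case: b => //=; clear -an; lia. Qed.

(** The quadratic part decreases when exponents are made more equal.  The
    linear part breaks ties; the factor n keeps it subordinate, as [tie] takes
    values below n. *)
Definition energy m : nat :=
  (\sum_(b : bool) \sum_a
    (n * (exp_at m b a * exp_at m b a) + tie b a * exp_at m b a))%N.

Lemma energy_chi b S m : energy (chi b S + m) =
  (energy m + \sum_(a in S) (n * (2 * exp_at m b a + 1) + tie b a))%N.
Proof.
rewrite /energy (bigD1 b) // [X in _ = (X + _)%N](bigD1 b) //= addnAC.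
congr (_ + _)%N.
  rewrite -[RHS]/(addn _ _) [\sum_(a in S) _]big_mkcond -big_split /=.
  apply: eq_bigr => a _; rewrite exp_at_chi eqxx /=.
  by case: (a \in S); rewrite ?addn0 //; clear; lia.
apply: eq_bigr => b' bb'; apply: eq_bigr => a _.
by rewrite exp_at_chi eq_sym (negbTE bb').
Qed.

(** One straightening step at a gap between the consecutive positions o and c
    of the arrangement t.  The exponents of the positions up to o are lowered by
    one; raising instead the exponents of another set of as many indices costs
    energy, because every index exchanged has a smaller exponent, or the same
    exponent and a smaller tie value. *)
Lemma straighten_step m b t (o c : 'I_n) :
    c = o.+1 :> nat -> decreasing (exp_at m b \o t) ->
    (forall u v : 'I_n, (u < v)%N -> exp_at m b (t u) = exp_at m b (t v) ->
       exp_at m (~~ b) (t u) = exp_at m (~~ b) (t v) ->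
         (tie b (t v) < tie b (t u))%N) ->
    exp_at m (~~ b) (t c) = 0%N ->
    (forall a, (0 < exp_at m b a)%N -> exp_at m (~~ b) a = 0%N) ->
    (exp_at m b (t c) < exp_at m b (t o))%N ->
    (exp_at m b (t o) = (exp_at m b (t c)).+1 ->
      (tie b (t c) < tie b (t o))%N) ->
  exists m', [/\ m = (chi b (initial t o.+1) + m')%MM,
    decreasing (exp_at m' b \o t) &
    forall S, #|S| = o.+1 -> S != initial t o.+1 ->
      (forall a, a \in S -> exp_at m (~~ b) a = 0%N) ->
      (energy (chi b S + m') < energy m)%N /\ dom (chi b S + m') m].
Proof.
move=> co dec tieP gc excl lt tieo.
set S0 := initial t o.+1.
have S0pos a : a \in S0 -> (exp_at m b (t o) <= exp_at m b a)%N.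
  by rewrite -[a](permKV t) mem_initial ltnS => /dec.
have S0neg a : a \notin S0 -> (exp_at m b a <= exp_at m b (t c))%N.
  by rewrite -[a](permKV t) mem_initial -ltnNge -co => /dec.
pose m' := (m - chi b S0)%MM.
have mE : m = (chi b S0 + m')%MM.
  apply/esym; rewrite addmC; apply: submK; apply/mnm_lepP => x.
  have [b' [a ->]] : exists b' a, x = side b' a.
    by case: (split_ordP x) => a ->; [exists false | exists true]; exists a.
  rewrite chiE; have [<-|//] := eqVneq b b';
    case: (boolP (a \in S0)) => // /S0pos h.
  by apply: leq_trans h; apply: leq_ltn_trans lt.
clearbody m'.
have exE b' a : exp_at m b' a = ((b == b') && (a \in S0) + exp_at m' b' a)%N.
  by rewrite mE exp_at_chi.
have dec' : decreasing (exp_at m' b \o t).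
  move=> u v uv /=; have := dec u v uv;
    rewrite /= !exE eqxx /= !mem_initial !ltnS.
  case: (leqP v o) => [vo|ov]; first by rewrite (leq_trans uv vo) leq_add2l.
  case: (leqP u o) => [uo|//] _.
  have tu : t u \in S0 by rewrite mem_initial.
  have tv : t v \notin S0 by rewrite mem_initial -leqNgt.
  have := S0pos _ tu; have := S0neg _ tv;
    rewrite !(exE b (t u), exE b (t v)) eqxx tu (negbTE tv) /=.
  move: lt; lia.
exists m'; split=> // S So SS0 Sg; split; last first.
  by rewrite mE; apply: dom_exchange.
rewrite mE !energy_chi ltn_add2l; apply: ltn_sum_exchange => //.
  by rewrite card_initial.
move=> x y /setDP [xS xS0] /setDP [yS0 yS].
have fx := S0neg x xS0; have fy := S0pos y yS0.
have := exE b x; have := exE b y;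
  rewrite eqxx yS0 (negbTE xS0) /= add0n => Ey Ex.
have tx := tie_lt b x; have ty := tie_lt b y.
have [E|ne] := eqVneq (exp_at m' b x) (exp_at m' b y); last first.
  have : (exp_at m' b x < exp_at m' b y)%N.
    by rewrite ltn_neqAle ne; move: lt fx fy Ex Ey; clear; lia.
  move: tx ty; clear; nia.
rewrite E ltn_add2l.
have [fo fc fyo fxc] :
  [/\ exp_at m b (t o) = (exp_at m b (t c)).+1, tie b (t c) < tie b (t o),
    exp_at m b y = exp_at m b (t o) & exp_at m b x = exp_at m b (t c)]%N.
  have fo : exp_at m b (t o) = (exp_at m b (t c)).+1 by move: lt fx fy Ex Ey E;
    clear; lia.
  split=> //; [exact: tieo|move: lt fx fy Ex Ey E fo; clear;
    lia|move: lt fx fy Ex Ey E fo; clear; lia].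
have yo : (tie b (t o) <= tie b y)%N.
  move: yS0 fyo; rewrite -[y](permKV t) mem_initial ltnS; set u := (t^-1)%g y.
  rewrite leq_eqVlt => /orP [/eqP/ord_inj -> //|uo fyo].
  by apply/ltnW/tieP; rewrite // !excl // ?fyo; apply: leq_ltn_trans lt.
have xc : (tie b x <= tie b (t c))%N.
  have gx := Sg x xS.
  move: xS0 fxc gx; rewrite -[x](permKV t) mem_initial -leqNgt -co;
    set u := (t^-1)%g x.
  rewrite leq_eqVlt => /orP [/eqP/ord_inj -> //|cu fxc gx].
  by apply/ltnW/tieP; rewrite // gx gc.
exact: leq_ltn_trans xc (leq_trans fc yo).
Qed.

End Straightening.

(** * Straightening *)

Section Spanning.
Variables n k : nat.
Hypothesis hk : (1 <= k <= n)%N.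
Implicit Types (A : {set 'I_n}) (s t u : 'S_n) (m : 'X_{1..n + n}) (b : bool).
Implicit Types (a c i j o : 'I_n) (S T : {set 'I_n}).

Local Notation pol := {mpoly rat[n + n]}.
Local Notation J := (J n k).
Local Notation hgt := (hgt k).
Local Notation expo := (@expo n k).
Local Notation mon_class := (@mon_class n k).
Local Notation elem_sym := (@elem_sym n).

Lemma lex_key (x y u v l : nat) : (u < l)%N -> (v < l)%N ->
  (x * l + u < y * l + v)%N -> (x < y)%N \/ x = y /\ (u < v)%N.
Proof.
move=> ul vl; case: (ltngtP x y) => [|yx|->];
  [by left| |by rewrite ltn_add2l; right].
by have := leq_mul yx (leqnn l); rewrite mulSn; clear -ul vl; lia.
Qed.

(** The arrangement s makes the weight (x exponent minus y exponent) weakly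
    decreasing, with equal weights in increasing order of the indices. *)
Definition sorts s m : Prop := forall u v : 'I_n, (u < v)%N ->
  [/\ (exp_at m false (s v) <= exp_at m false (s u))%N,
      (exp_at m true (s u) <= exp_at m true (s v))%N &
      (forall b, exp_at m b (s u) = exp_at m b (s v)) -> (s u < s v)%N].

(** Sort by a key in which the weight comes first and the index second. *)
Lemma sorts_exists m :
  (forall b a, (0 < exp_at m b a)%N -> exp_at m (~~ b) a = 0%N) ->
    exists s, sorts s m.
Proof.
move=> excl; pose Q := (\sum_a exp_at m true a)%N.
have qQ a : (exp_at m true a <= Q)%N by rewrite /Q (bigD1 a) //= leq_addr.
pose w a := (exp_at m false a + (Q - exp_at m true a))%N.
pose key a := (w a * n + (n.-1 - a))%N.
have rn (a : 'I_n) : (n.-1 - a < n)%N by case: a => a an /=; clear -an; lia.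
have key_lt a c : (key a < key c)%N ->
    (w a < w c)%N \/ w a = w c /\ (c < a)%N.
  move=> /(lex_key (rn a) (rn c)) [|[-> lt]]; [by left|right; split=> //].
  by case: a c lt => a an [c cn] /=; clear; lia.
have key_inj : injective key.
  move=> a c E; have wE : w a = w c.
    have ra := rn a; have rc := rn c; move: E; rewrite /key => E.
    case: (ltngtP (w a) (w c)) => // ww; have := leq_mul ww (leqnn n);
      move: E ra rc; rewrite mulSn; clear; lia.
  apply: ord_inj; move: E; rewrite /key wE => /addnI.
  by case: a c {wE} => a an [c cn] /=; clear -an cn; lia.
have [s sP] := sort_perm key_inj; exists s => u v /sP /key_lt.
have h (x y x' y' : nat) : (0 < x -> y = 0)%N -> (0 < y -> x = 0)%N ->
   (0 < x' -> y' = 0)%N -> (0 < y' -> x' = 0)%N -> (y <= Q)%N -> (y' <= Q)%N ->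
   (x + (Q - y) <= x' + (Q - y'))%N -> (x <= x' /\ y' <= y)%N.
  clear; lia.
have e a := excl false a; have e' a := excl true a; rewrite /= in e e'.
move=> lt; have := h _ _ _ _ (e (s v)) (e' (s v)) (e (s u)) (e' (s u)) (qQ _)
  (qQ _).
case.
  by have : (w (s v) <= w (s u))%N by case: lt => [/ltnW|[-> _]].
move=> pp qq; split=> // tie; case: lt => [|[]//].
by rewrite /w !tie ltnn.
Qed.

(** The arrangement along which the exponents of side b decrease. *)
Definition sperm b s : 'S_n := if b then (perm (@rev_ord_inj n) * s)%g else s.

Lemma spermE b s i : sperm b s i = s (if b then rev_ord i else i).
Proof. by case: b; rewrite // permM permE. Qed.

Lemma sperm_rev b s i : sperm b s (if b then rev_ord i else i) = s i.
Proof. by rewrite spermE; case: b; rewrite ?rev_ordK. Qed.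

Lemma rev_ord_lt (u v : 'I_n) : (u < v)%N -> (rev_ord v < rev_ord u)%N.
Proof. by case: u v => u un [v vn] /=; clear -un vn; lia. Qed.

Lemma sorts_dec s m b : sorts s m -> decreasing (exp_at m b \o sperm b s).
Proof.
move=> sm u v uv /=; rewrite !spermE.
move: uv; rewrite leq_eqVlt => /orP [/eqP/ord_inj -> //|uv].
case: b; last by have [] := sm _ _ uv.
by have [] := sm _ _ (rev_ord_lt uv).
Qed.

Lemma dec_support (f : 'I_n -> nat) t (cap : nat) :
  decreasing (f \o t) -> (#|[set a | 0 < f a]| <= cap)%N ->
  forall i, (cap <= i)%N -> f (t i) = 0%N.
Proof.
move=> dec fcap i ci; apply/eqP; rewrite -leqn0 leqNgt; apply/negP => fi.
have sub : initial t i.+1 \subset [set a | (0 < f a)%N].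
  apply/subsetP => a; rewrite -[a](permKV t) mem_initial inE ltnS => ai.
  exact: leq_trans fi (dec _ _ ai).
have := leq_trans (subset_leq_card sub) fcap.
by rewrite card_initial // leqNgt ltnS ci.
Qed.

(** At most k-1 indices have a positive x exponent and at most n-k a positive y
    exponent, so both vanish at position k-1. *)
Lemma sorts_center s m b : sorts s m ->
  (#|[set a | 0 < m (side b a)]| <= capacity n k b)%N ->
  forall i, (if b then (i < k) else (k <= i.+1))%N -> exp_at m b (s i) = 0%N.
Proof.
move=> sm cap i ib; have dec := sorts_dec b sm.
have := dec_support dec cap (i := if b then rev_ord i else i).
rewrite sperm_rev; apply; rewrite /capacity; clear -hk ib.
by case: b ib => /=; case: i => i iltn /=; move: hk; clear -iltn; lia.
Qed.

(** Consecutive positions on side b, with o farther than c from position k-1. *)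
Definition neighbours b o c : bool :=
  if b then (c.+1 == o) && (k <= o)%N else (o.+1 == c) && (c < k)%N.
Definition drop b o c : 'I_n := if b then o else c.

Lemma hgt_neighbours b A o c : neighbours b o c ->
  hgt b A o = (hgt b A c + (drop b o c \in A))%N.
Proof.
rewrite /hgt; case: b => /= /andP [/eqP oc ko].
  rewrite (cardsD1 o) addnC inE ko leqnn !andbT; congr (_ + _)%N.
  apply: eq_card => j; rewrite !inE -(inj_eq (@ord_inj n)).
  by case: (j \in A); rewrite ?andbF //=; move: oc ko; clear; lia.
rewrite (cardsD1 c) addnC inE -oc ltnS leqnn oc ko !andbT; congr (_ + _)%N.
apply: eq_card => j; rewrite !inE -(inj_eq (@ord_inj n)).
by case: (j \in A); rewrite ?andbF //=; move: oc ko; clear; lia.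
Qed.

Lemma hgt_center b A (i : nat) : (if b then (i < k) else (k <= i.+1))%N ->
    hgt b A i = 0%N.
Proof.
rewrite /hgt; case: b => ik; apply: eq_card0 => j; rewrite !inE;
  apply/negP => /andP [_ /andP [h1 h2]].
  by move: ik; rewrite ltnNge (leq_trans h1 h2).
by move: ik; rewrite leqNgt (leq_ltn_trans h1 h2).
Qed.

(** The exponents are recovered from position k-1 outwards, one gap at a
    time. *)
Lemma expo_unique A s m :
    (forall b i, (if b then (i < k) else (k <= i.+1))%N ->
      exp_at m b (s i) = 0%N) ->
    (forall b o c, neighbours b o c ->
       exp_at m b (s o) = (exp_at m b (s c) + (drop b o c \in A))%N) ->
  m = expo A s.
Proof.
move=> m0 mS; apply: mnm_sideP => b a; rewrite expoE -[a in LHS](permKV s).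
move: (s^-1%g a) => i {a}; rewrite -/(exp_at m b (s i)).
case: b; first case: i => i; last case: i => i.
  elim: i => [|i IH] iltn.
    by rewrite hgt_center /= ?m0 //=; case/andP: hk.
  case: (ltnP i.+1 k) => ik; first by rewrite hgt_center /= ?m0.
  have nb : neighbours true (Ordinal iltn) (Ordinal (ltnW iltn))
    by rewrite /= eqxx.
  by rewrite (mS _ _ _ nb) (hgt_neighbours _ nb) IH.
move=> iltn; have [l] := ubnP (k - i); elim: l i iltn => // l IH i iltn il.
case: (leqP k i.+1) => ki; first by rewrite hgt_center /= ?m0.
have i1n : (i.+1 < n)%N by case/andP: hk => _; apply: leq_trans.
have nb : neighbours false (Ordinal iltn) (Ordinal i1n) by rewrite /= eqxx.
by rewrite (mS _ _ _ nb) (hgt_neighbours _ nb) IH //; move: il ki; clear; lia.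
Qed.

Definition dominated_span m : {pred H' n k} :=
  spanQ (fun h : H' n k => exists2 s, dom (expo (Des s) s) m &
    h = quot_pi J (a_mon k s)).
HB.instance Definition _ m := GRing.SubmodClosed.on (dominated_span m).

Lemma dominated_span_trans m m' : dom m m' ->
    {subset dominated_span m <= dominated_span m'}.
Proof.
move=> mm'; apply: spanQ_sub => _ [s sm ->]; apply: mem_spanQ; exists s => //.
exact: dom_trans mm'.
Qed.

Lemma mon_class_both b S m a : a \in S -> (0 < exp_at m (~~ b) a)%N ->
    mon_class (chi b S + m) = 0.
Proof.
move=> aS ga; have h b' : (0 < (chi b S + m)%MM (side b' a))%N.
  rewrite mnmDE chiE aS andbT; have [//|ne] := eqVneq b b'.
  by move: ga; rewrite /exp_at (_ : ~~ b = b') //; case: b b' ne => [] [].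
by apply/quot_pi_eq0/(mon_J_both hk (h false) (h true)).
Qed.

(** Sort the weight along s.  The exponents drop at every descent of s.  If all
    drops are equal to one and occur only at descents, the monomial is a_s.
    Otherwise some gap drops by more than its descent requires, and
    [straighten_step] replaces the monomial by monomials of lower energy that it
    dominates; those containing some x_i y_i vanish. *)
Lemma straighten m : mon_class m \in dominated_span m.
Proof.
have [l] := ubnP (energy m); elim: l m => // l IH m ml.
have [/existsP [a /andP [p0 q0]]|/existsPn excl] :=
    boolP [exists a, (0 < exp_at m false a)%N && (0 < exp_at m true a)%N].
  by rewrite /mon_class (quot_pi_eq0 (mon_J_both hk p0 q0)) rpred0.
have {}excl b a : (0 < exp_at m b a)%N -> exp_at m (~~ b) a = 0%N.
  have := excl a; rewrite negb_and -!leqNgt !leqn0.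
  by case: b => /= /orP [/eqP ->|/eqP ->].
have [/existsP [b bcap]|/existsPn cap] :=
    boolP [exists b, (capacity n k b < #|[set a | 0 < m (side b a)]|)%N].
  by rewrite /mon_class (quot_pi_eq0 (mon_J_many hk bcap)) rpred0.
have {}cap b : (#|[set a | 0 < m (side b a)]| <= capacity n k b)%N
  by rewrite leqNgt.
have [s sm] := sorts_exists excl.
have center b := sorts_center sm (cap b).
(* a tie between neighbours puts their indices in increasing order *)
have descent b o c : neighbours b o c ->
    (exp_at m b (s c) + (drop b o c \in Des s) <= exp_at m b (s o))%N.
  move=> nb; have le : (exp_at m b (s c) <= exp_at m b (s o))%N.
    case: b nb => /= /andP [/eqP oc ko];
      [have [] // := sm c o | have [] // := sm o c]; by rewrite -oc.
  case: (boolP (drop b o c \in Des s)) => [D|]; last by rewrite addn0.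
  rewrite addn1 ltn_neqAle le andbT; apply/eqP => E.
  case: b nb D E {le} => /= /andP [/eqP oc ko];
    rewrite inE => /existsP [i /andP [/eqP io lt]] E.
    have {io} io : i = c by apply: ord_inj; move: io; rewrite -oc => -[].
    have co : (c < o)%N by rewrite -oc.
    have [_ _ H] := sm c o co; have : (s c < s o)%N.
      apply: H => -[] //; rewrite !(center false) //=; move: ko oc; clear; lia.
    by rewrite ltnNge -io ltnW.
  have {io} io : i = o by apply: ord_inj; move: io; rewrite -oc => -[].
  have oc' : (o < c)%N by rewrite -oc.
  have [_ _ H] := sm o c oc'; have : (s o < s c)%N.
    apply: H => -[] //; rewrite !(center true) //=; move: ko oc; clear; lia.
  by rewrite ltnNge -io ltnW.
have [/existsP [b /existsP [o /existsP [c /andP [nb viol]]]]|none] :=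
    boolP [exists b, exists o, exists c, neighbours b o c &&
      (exp_at m b (s c) + (drop b o c \in Des s) < exp_at m b (s o))%N];
        last first.
  have mE : m = expo (Des s) s.
    apply: expo_unique center _ => b o c nb; apply/eqP;
      rewrite eqn_leq descent // andbT leqNgt.
    apply: contraNN none => viol.
    by apply/existsP; exists b; apply/existsP; exists o; apply/existsP;
      exists c; rewrite nb.
  by apply: mem_spanQ; exists s; rewrite ?a_monE -?mE //; apply: dom_refl.
pose r i := if b then rev_ord i else i.
have tr i : sperm b s (r i) = s i by apply: sperm_rev.
have gc : exp_at m (~~ b) (s c) = 0%N.
  apply: center; case: (b) nb => /= /andP [/eqP oc ko]; move: ko oc; clear; lia.
have [|||||||m' [mE dec' red]] :=
  @straighten_step n k hk m b (sperm b s) (r o) (r c).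
- rewrite /r; case: (b) nb => /= /andP [/eqP oc ko] //.
  by case: o c oc {gc viol ko} => o on [c cn] /= oc; move: oc on cn; clear; lia.
- exact: sorts_dec.
- move=> u v uv E E'; rewrite !spermE in E E' *.
  have tie_all x y : exp_at m b x = exp_at m b y ->
    exp_at m (~~ b) x = exp_at m (~~ b) y ->
    forall b', exp_at m b' x = exp_at m b' y.
    by move=> h h' b'; case: (b) (b') h h' => [] [].
  case: b E E' tie_all {nb viol gc r tr} => /= E E' tie_all.
    by have [_ _] := sm _ _ (rev_ord_lt uv); apply; apply: tie_all.
  have [//|_ _ /(_ (tie_all _ _ E E'))] := sm u v.
  by case: (s u) (s v) => x xn [y yn] /=; clear -xn yn; lia.
- by rewrite tr.
- by move=> a; apply: excl.
- by rewrite !tr; apply: leq_ltn_trans viol; apply: leq_addr.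
- rewrite !tr => E; have nD : drop b o c \notin Des s.
    by apply/negP => D; move: viol; rewrite D addn1 E ltnn.
  have ne : (s o == s c) = false.
    by rewrite (inj_eq perm_inj); apply/negP => /eqP oc; move: nb;
      rewrite oc /neighbours; case: (b); move=> /andP [/eqP]; clear; lia.
  case: b nb nD {E viol gc r tr} => /= /andP [/eqP oc ko];
    rewrite inE => /existsPn h.
    by have := h c; rewrite oc eqxx /= -leqNgt leq_eqVlt => /orP
      [/eqP/ord_inj E|//]; rewrite E eqxx in ne.
  have := h o; rewrite oc eqxx /= -leqNgt leq_eqVlt => /orP [/eqP/ord_inj E|];
    first by rewrite E eqxx in ne.
  by case: (s o) (s c) => x xn [y yn] /=; clear -xn yn; lia.
rewrite mE mon_class_exchange //; last by rewrite -card_gt0 card_initial.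
rewrite rpredN rpred_sum // => S /andP [/eqP cS neS].
rewrite card_initial // in cS.
have [/exists_inP [a aS ga]|/exists_inPn gS] :=
  boolP [exists a in S, (0 < exp_at m' (~~ b) a)%N].
  by rewrite (mon_class_both aS ga) rpred0.
have [] := red S cS neS.
  move=> a aS; apply/eqP; rewrite -leqn0 leqNgt; apply: contraNN (gS a aS).
  by rewrite mE exp_at_chi; case: (b).
move=> lt d; rewrite -mE; apply: dominated_span_trans d _ _; apply: IH.
exact: leq_trans lt ml.
Qed.

End Spanning.

(** * Relations between monomials of one shape *)

Section Relations.
Variables n k : nat.
Hypothesis hk : (1 <= k <= n)%N.
Implicit Types (A B : {set 'I_n}) (s t u : 'S_n) (m : 'X_{1..n + n}) (b : bool).
Implicit Types (a c i j o : 'I_n) (S T : {set 'I_n}).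

Local Notation pol := {mpoly rat[n + n]}.
Local Notation J := (J n k).
Local Notation hgt := (hgt k).
Local Notation expo := (@expo n k).
Local Notation mon_class := (@mon_class n k).
Local Notation elem_sym := (@elem_sym n).

(** Positions of one block are separated by no drop; a drop between two
    positions is visible on the side of k where it lies. *)
Lemma hgt_block A i i' :
  (block A i = block A i') <-> (forall b, hgt b A i = hgt b A i').
Proof.
wlog ii' : i i' / (i <= i')%N.
  move=> H; case: (leqP i i') => [|/ltnW]; first exact: H.
  by move/H=> [h1 h2]; split=> [/esym/h1 h b|h]; [|apply/esym/h2 => b].
split=> [/eqP/(block_eqP _ ii') nA b|E].
  rewrite /hgt; case: b; apply: eq_card => j; rewrite !inE;
    case jA: (j \in A) => //=; have := nA j jA; move: ii'; clear; lia.
apply/eqP/(block_eqP _ ii') => c cA; apply/negP => /andP [ic ci'].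
case: (ltnP c k) => ck.
  have := E false; apply/eqP; rewrite gtn_eqF //; apply: proper_card;
    apply/properP; split.
    by apply/subsetP => j; rewrite !inE => /and3P [-> h ->];
      rewrite (leq_ltn_trans ii' h).
  by exists c; rewrite !inE cA ck ?ic //= ltnNge ci'.
have := E true; apply/eqP; rewrite ltn_eqF //; apply: proper_card;
  apply/properP; split.
  by apply/subsetP => j; rewrite !inE => /and3P [-> -> h];
    rewrite (leq_trans h ii').
by exists c; rewrite !inE cA ck ?ci' //= leqNgt ic.
Qed.

Lemma expo_coset A s u : u \in (young A :* s)%g -> expo A u = expo A s.
Proof.
move=> /rcosetP [h /youngP hA ->]; apply: mnm_sideP => b a; rewrite !expoE.
rewrite invMg permM; set i := (s^-1)%g a.
have /hgt_block -> // : block A ((h^-1)%g i) = block A i.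
by rewrite -[in RHS](permKV h i) hA.
Qed.

Lemma exp_at_expo A s b :
    exp_at (expo A s) b =1 (fun a => hgt b A ((s^-1)%g a)).
Proof. by move=> a; rewrite /exp_at expoE. Qed.

Lemma dom_expo A s t : dom (expo A s) (expo A t).
Proof.
move=> b; split=> [|j].
  under eq_bigr do rewrite exp_at_expo;
    under [RHS]eq_bigr do rewrite exp_at_expo.
  by rewrite [LHS](reindex_inj (@perm_inj _ s))
    [RHS](reindex_inj (@perm_inj _ t));
    apply: eq_bigr => i _; rewrite !permK.
rewrite !(eq_top_sum _ (exp_at_expo _ _ _)).
by rewrite !(top_perm (fun i : 'I_n => hgt b A i)).
Qed.

(** The span of the descent monomials strictly below the shape with drop set
    A. *)
Definition lower_span A : {pred H' n k} :=
  spanQ (fun h : H' n k => exists2 s,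
    dom (expo (Des s) s) (expo A 1%g) /\ Des s != A &
      h = quot_pi J (a_mon k s)).
HB.instance Definition _ A := GRing.SubmodClosed.on (lower_span A).

(** The indices whose exponent increases when the drop j is added to the
    weight placed along u. *)
Definition outer j u : {set 'I_n} :=
  [set a | if (k <= j)%N then (j <= (u^-1)%g a)%N else ((u^-1)%g a < j)%N].

Definition outer_size j : nat := if (k <= j)%N then (n - j)%N else j.

Lemma outer_size_le j : (outer_size j <= n)%N.
Proof. by rewrite /outer_size; case: ifP => _;
  [apply: leq_subr | apply: ltnW]. Qed.

Lemma outer_initial j u : outer j u =
    initial (sperm (k <= j)%N u) (outer_size j).
Proof.
apply/setP => a; rewrite inE -[a](permKV (sperm (k <= j)%N u)) mem_initial.
move: (((sperm (k <= j)%N u)^-1)%g a) => i; rewrite spermE permK /outer_size;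
  case: (k <= j)%N => //.
by case: i j => i iltn [j jn] /=; clear -iltn jn; lia.
Qed.

Lemma outerM j s u : outer j (s * u)%g = u @: outer j s.
Proof.
apply/setP => a; rewrite -[a](permKV u) mem_imset; last exact: perm_inj.
by rewrite !inE invMg permM permK.
Qed.

Lemma expo_addD A j u : j \in A ->
  expo A u = (chi (k <= j)%N (outer j u) + expo (A :\ j) u)%MM.
Proof.
move=> jA; apply: mnm_sideP => b a; rewrite mnmDE chiE !expoE inE.
move: ((u^-1)%g a) => i; rewrite /hgt; case: b.
  rewrite (cardsD1 j) inE jA /=; congr (_ + _)%N.
    by rewrite eqb_id; case: (leqP k j).
  apply: eq_card => c; rewrite !inE; by case: (c == j).
rewrite (cardsD1 j) inE jA /=; congr (_ + _)%N.
  by rewrite eqbF_neg -ltnNge andbC; case: (ltnP j k); rewrite ?andbF //.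
apply: eq_card => c; rewrite !inE; by case: (c == j).
Qed.

Lemma outer_zero A j u c : c \in outer j u ->
    hgt (~~ (k <= j)%N) A ((u^-1)%g c) = 0%N.
Proof.
rewrite inE => h; apply: hgt_center; move: h; case: (leqP k j) => /= kj h.
  exact: leq_trans kj (leqW h).
exact: ltn_trans h kj.
Qed.

Lemma dec_expo A u b : decreasing (exp_at (expo A u) b \o sperm b u).
Proof.
move=> i i' ii' /=; rewrite !exp_at_expo !spermE !permK /hgt.
case: b; apply: subset_leq_card; apply/subsetP => c;
  rewrite !inE => /and3P [-> h1 h2] /=.
  by rewrite h1; move: h2 ii' => /=; case: i i' => i iltn [i' i'n] /=; clear;
    lia.
by rewrite h2 andbT; apply: leq_ltn_trans ii' h1.
Qed.

(** Take u in the coset for which [outer j u] meets S in as many points as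
    possible.  If the two sets differ, the maximality of the total over S forces
    an index of S and one of [outer j u], outside their intersection, to have
    equal exponents; they lie in one block, and the transposition improves u. *)
Lemma outer_of_max A j s S : #|S| = outer_size j ->
    (forall a, a \in S -> exp_at (expo A s) (~~ (k <= j)%N) a = 0%N) ->
    (\sum_(a in outer j s) exp_at (expo A s) (k <= j)%N a <=
     \sum_(a in S) exp_at (expo A s) (k <= j)%N a)%N ->
  exists2 u, u \in (young A :* s)%g & outer j u = S.
Proof.
set b := (k <= j)%N => cS gS Smax.
case: (@arg_maxnP _ s (mem (young A :* s)%g) (fun u => #|S :&: outer j u|)).
  exact: rcoset_refl.
move=> u us umax; exists u => //; apply/eqP; apply: contraT => ne.
have cO : #|outer j u| = outer_size j.
  by rewrite outer_initial card_initial ?outer_size_le.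
have [y yO] : exists y, y \in outer j u :\: S.
  apply/set0Pn; rewrite setD_eq0; apply: contra ne => sub.
  by rewrite eqEcard sub cO cS leqnn.
have [x xS] : exists x, x \in S :\: outer j u.
  apply/set0Pn; rewrite -card_gt0; have := cardsID (outer j u) S;
    have := cardsID S (outer j u).
  rewrite cO cS setIC; have : (0 < #|outer j u :\: S|)%N by apply/card_gt0P;
    exists y.
  clear; lia.
have Eu : expo A u = expo A s by apply: expo_coset.
have sep c d : c \in S :\: outer j u -> d \in outer j u :\: S ->
    (exp_at (expo A s) b c <= exp_at (expo A s) b d)%N.
  move=> /setDP [_ cO'] /setDP [dO _]; rewrite -Eu.
  move: cO' dO; rewrite outer_initial -/b -[c](permKV (sperm b u))
    -[d](permKV (sperm b u)).
  rewrite !mem_initial -leqNgt => h1 h2; apply: dec_expo;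
    exact: ltnW (leq_trans h2 h1).
have sums : (\sum_(a in outer j u) exp_at (expo A s) b a <=
  \sum_(a in S) exp_at (expo A s) b a)%N.
  apply: leq_trans Smax;
    rewrite -{1}Eu outer_initial (outer_initial j s) -/b !sum_initial.
  rewrite leq_eqVlt; apply/orP; left; apply/eqP; apply: eq_bigr => i _.
  by rewrite !exp_at_expo !spermE !permK.
have fxy := eq_sum_exchange (etrans cS (esym cO)) sep sums xS yO.
have /setDP [xS' xO] := xS; have /setDP [yO' yS] := yO.
have gx : exp_at (expo A s) (~~ b) x = 0%N by apply: gS.
have gy : exp_at (expo A s) (~~ b) y = 0%N.
  by rewrite -Eu exp_at_expo outer_zero.
pose i := (u^-1)%g x; pose i' := (u^-1)%g y.
have blk : block A i = block A i'.
  apply/hgt_block => b'; rewrite -!(exp_at_expo A u b') Eu.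
  have [->//|nb] := eqVneq b' b.
  by have -> : b' = ~~ b; [case: (b') (b) nb => [] [] | rewrite gx gy].
have /umax : (tperm i i' * u \in young A :* s)%g.
  by rewrite -(rcoset_eqP us) mem_rcoset mulgK tperm_young.
rewrite /= leqNgt => /negP; case; apply: proper_card; apply/properP.
have xy : x != y by apply: contraNneq xO => ->.
have tu a : (((tperm i i' * u)^-1)%g a = (u^-1)%g (tperm x y a)).
  rewrite invMg tpermV permM /i /i'; apply: (@perm_inj _ u).
  by rewrite permKV -[in RHS](permKV u x) -[in RHS](permKV u y) -inj_tperm
    ?permKV //; apply: perm_inj.
have memO a : a \in outer j (tperm i i' * u)%g = (tperm x y a \in outer j u).
  by rewrite !inE tu.
split.
  apply/subsetP => a /setIP [aS aO]; rewrite inE aS memO.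
  by case: tpermP => // E; rewrite -E aS in yS.
by exists x; rewrite inE xS' ?memO ?tpermL //= (negbTE xO).
Qed.

Lemma lower_eq0 A (h : H' n k) : h = 0 -> h \in lower_span A.
Proof. by move=> ->; apply: rpred0. Qed.

(** Multiply the monomial with drop set A minus j by the elementary symmetric
    polynomial of the degree that restores the drop j.  The subsets S of largest
    total are the sets [outer j u] for u in the coset ([outer_of_max]), and each
    is reached equally often; all other terms are strictly dominated. *)
Lemma sum_coset_lower A j s : j \in A -> (0 < j)%N ->
  \sum_(u in (young (A :\ j) :* s)%g) mon_class (expo A u) \in lower_span A.
Proof.
move=> jA j0; set B := A :\ j; set b := (k <= j)%N; set l := outer_size j.
set m := expo B s; have ln : (l <= n)%N by apply: outer_size_le.
have l0 : (0 < l)%N by rewrite /l /outer_size; case: ifP => // _;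
  rewrite subn_gt0.
have cO u : #|outer j u| = l by rewrite outer_initial card_initial.
pose cnt S := #|[set u in (young B :* s)%g | outer j u == S]|.
have -> : \sum_(u in (young B :* s)%g) mon_class (expo A u) =
    \sum_(S : {set 'I_n} | #|S| == l) mon_class (chi b S + m) *+ cnt S.
  rewrite (partition_big (outer j) (fun S => #|S| == l)) /=; last by move=> u _;
    rewrite cO.
  apply: eq_bigr => S _; rewrite -sumr_const; apply: eq_big => u;
    first by rewrite !inE.
  by move=> /andP [uB /eqP <-]; rewrite (expo_addD u jA) (expo_coset uB).
(* the common size of the nonempty fibres of u |-> outer j u *)
pose c0 := #|[set h in young B | outer j h == outer j 1%g]|.
have cntE S : (0 < cnt S)%N -> cnt S = c0.
  move=> /card_gt0P [u]; rewrite inE => /andP [us /eqP uS].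
  rewrite /cnt /c0 -[RHS](card_rcoset _ u); apply: eq_card => v.
  rewrite mem_rcoset -{1}[v](mulgKV u); move: (v * u^-1)%g => h.
  rewrite !inE -(rcoset_eqP us) mem_rcoset mulgK outerM.
  congr (_ && _); first by rewrite /= [LHS]inE.
  rewrite -uS -{2}[u](mul1g u) outerM;
    exact: (inj_eq (imset_inj (@perm_inj _ u))).
have : \sum_(S : {set 'I_n} | #|S| == l) mon_class (chi b S + m) = 0.
  have : elem_sym b l * 'X_[m] \in sub_pred J by apply/J_mul/elem_sym_J.
  move=> /quot_pi_eq0; rewrite mulr_suml linear_sum /= => E; rewrite -[RHS]E.
  by apply: eq_bigr => S _; rewrite /mon_class mpolyXD.
rewrite (bigID (fun S => 0 < cnt S)%N) /= => /eqP; rewrite addr_eq0 => /eqP E.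
rewrite (bigID (fun S => 0 < cnt S)%N) /= [X in _ + X]big1 ?addr0; last first.
  by move=> S /andP [_]; rewrite -eqn0Ngt => /eqP ->.
rewrite (eq_bigr (fun S => mon_class (chi b S + m) *+ c0)); last first.
  by move=> S /andP [_ /cntE ->].
rewrite sumrMnl E rpredMn // rpredN rpred_sum // => S /andP [/eqP cS nS].
have [/exists_inP [a aS ga]|/exists_inPn gS] :=
  boolP [exists a in S, (0 < exp_at m (~~ b) a)%N].
  by apply: lower_eq0; apply: (mon_class_both hk aS ga).
have {}gS a : a \in S -> exp_at m (~~ b) a = 0%N.
  by move=> /gS; rewrite -leqNgt leqn0 => /eqP.
have mE : (chi b (initial (sperm b s) l) + m)%MM = expo A s.
  by rewrite -outer_initial -expo_addD.
have dm : decreasing (exp_at m b \o sperm b s) by apply: dec_expo.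
have d1 : dom (chi b S + m) (expo A s) by rewrite -mE; apply: dom_exchange.
move: (straighten hk (chi b S + m)); apply: spanQ_sub => h [t td ->].
apply: mem_spanQ; exists t => //; split.
  exact: dom_trans td (dom_trans d1 (dom_expo _ _ _)).
apply: contraNneq nS => tA.
have d2 : dom (expo A s) (chi b S + m).
  by apply: dom_trans td; rewrite tA; apply: dom_expo.
rewrite -mE in d2; have := dom_exchange_rev ln dm cS d2.
rewrite -outer_initial => Smax; have [u us uS] := outer_of_max cS gS Smax.
by apply/card_gt0P; exists u; rewrite !inE us uS eqxx.
Qed.

End Relations.

(** * Linear independence of the descent monomials *)

Section Independence.
Variables n k : nat.
Hypothesis hk : (1 <= k <= n)%N.
Implicit Types (A B : {set 'I_n}) (p q s t u : 'S_n) (m : 'X_{1..n + n})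
  (b : bool).
Implicit Types (a c i o : 'I_n).

Local Notation pol := {mpoly rat[n + n]}.
Local Notation J := (J n k).
Local Notation H' := (H' n k).
Local Notation hgt := (hgt k).
Local Notation expo := (@expo n k).
Local Notation mon_class := (@mon_class n k).
Local Notation pair_Delta := (@pair_Delta n k).
Local Notation PsiN := (Psi (@nat_of_ord n)).

Definition positive A := forall i, i \in A -> (0 < i)%N.

Lemma Des_positive s : positive (Des s).
Proof. by move=> i; rewrite inE => /existsP [j /andP [/eqP <-]]. Qed.

Lemma drop_neighbours (j : 'I_n) : (0 < j)%N ->
    exists b o c, neighbours k b o c /\ drop b o c = j.
Proof.
move=> j0; have h : (j.-1 < n)%N by apply: leq_ltn_trans (ltn_ord j);
  apply: leq_pred.
exists (k <= j)%N; case: (leqP k j) => kj.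
  by exists j, (Ordinal h); rewrite /= kj prednK ?eqxx.
by exists (Ordinal h), j; rewrite /= kj prednK ?eqxx.
Qed.

Lemma hgt_inj A B : positive A -> positive B ->
  (forall b i, hgt b A i = hgt b B i) -> A = B.
Proof.
move=> Apos Bpos E; apply/setP => j; case: (posnP j) => j0.
  by apply/idP/idP => [/Apos|/Bpos]; rewrite j0.
have [b [o [c [nb <-]]]] := drop_neighbours j0.
have := E b o; rewrite !(hgt_neighbours _ nb) E => /addnI.
by case: (_ \in A) (_ \in B) => [] [].
Qed.

Definition base A := expo A 1%g.

Lemma exp_at_base A b i : exp_at (base A) b (sperm b 1 i) =
    hgt b A (if b then rev_ord i else i).
Proof. by rewrite exp_at_expo invg1 spermE !perm1. Qed.

Lemma top_base A b j :
  top_sum (exp_at (base A) b) j =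
    (\sum_(i < n | (i < j)%N) hgt b A (if b then rev_ord i else i))%N.
Proof. by rewrite (top_sorted _ (dec_expo k A 1 b)); apply: eq_bigr => i _;
  rewrite exp_at_base. Qed.

Lemma dom_anti A B : positive A -> positive B ->
  (forall b j, top_sum (exp_at (base A) b) j = top_sum (exp_at (base B) b) j) ->
    A = B.
Proof.
move=> Apos Bpos E; apply: hgt_inj => // b i.
have := @partial_sums_inj n (fun i => hgt b A (if b then rev_ord i else i))
  (fun i => hgt b B (if b then rev_ord i else i)).
move=> /(_ _ (if b then rev_ord i else i)) /=; case: b E => E;
  rewrite ?rev_ordK; apply=> j;
  exact: etrans (esym (top_base _ _ _)) (etrans (E _ _) (top_base _ _ _)).
Qed.

(** A linear extension of the dominance order on shapes. *)
Definition height A : nat :=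
    (\sum_(b : bool) \sum_(j < n.+1) top_sum (exp_at (base A) b) j)%N.

Lemma top_large (f : 'I_n -> nat) j : (n <= j)%N ->
    top_sum f j = (\sum_a f a)%N.
Proof.
move=> nj; apply/eqP; rewrite eqn_leq; apply/andP; split.
  by apply/top_leP => X _; rewrite [leqRHS](bigID (mem X)) leq_addr.
rewrite -(eq_bigl _ _ (@in_setT _)); apply: top_ub.
by rewrite cardsT card_ord.
Qed.

Lemma height_mono A B : dom (base A) (base B) -> (height A <= height B)%N.
Proof. by move=> d; apply: leq_sum => b _; apply: leq_sum => j _;
  have [_] := d b. Qed.

Lemma height_strict A B : positive A -> positive B -> dom (base A) (base B) ->
  A != B -> (height A < height B)%N.
Proof.
move=> Apos Bpos d; apply: contraNltn => hBA; apply/eqP/dom_anti => // b j.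
have [sum_eq le] := d b.
case: (leqP n j) => [nj|/leqW jn]; first by rewrite !top_large.
apply/eqP; rewrite eqn_leq le /= leqNgt; apply: contraTN hBA => lt.
rewrite -ltnNge /height (bigD1 b) // [ltnRHS](bigD1 b) //= -addSn leq_add //;
  last first.
  by apply: leq_sum => b' _; apply: leq_sum => i _; have [_] := d b'.
rewrite (bigD1 (Ordinal jn)) // [ltnRHS](bigD1 (Ordinal jn)) //= -addSn
  leq_add //.
by apply: leq_sum => i _.
Qed.

Lemma dom_base_anti A B : positive A -> positive B -> dom (base A) (base B) ->
  dom (base B) (base A) -> A = B.
Proof.
move=> Apos Bpos d d'; apply/eqP;
  apply: contraT => /(height_strict Apos Bpos d).
by rewrite ltnNge height_mono.
Qed.

(** Sorting is subadditive for dominance, and the shapes with drop sets B and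
    its complement add up to the full shape, so the product is a monomial of
    Delta only if A dominates B.  When A = B all partial sums are attained, so
    the arrangement t of the product sorts both factors. *)
Lemma pair_Delta_split A B p q :
    pair_Delta ('X_[expo A p] * 'X_[expo (~: B) q]) != 0 ->
  dom (base B) (base A) /\ (A = B -> exists t,
    t \in (young A :* p)%g /\ t \in (young (~: A) :* q)%g).
Proof.
rewrite -mpolyXD => /(pair_Delta_neq0 hk) [t E].
have exE b a : (exp_at (expo A p) b a + exp_at (expo (~: B) q) b a)%N =
  exp_at (expo setT t) b a.
  by rewrite -E /exp_at mnmDE.
have dE C s b := dom_expo k C s 1%g b; have dE' C s b := dom_expo k C 1%g s b.
have topE C s b j : top_sum (exp_at (expo C s) b) j =
  top_sum (exp_at (base C) b) j.
  by apply/eqP; rewrite eqn_leq (proj2 (dE C s b)) (proj2 (dE' C s b)).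
have sum_expo C s b :
  (\sum_a exp_at (expo C s) b a = \sum_a exp_at (base C) b a)%N by have [] :=
  dE C s b.
have topT b j : top_sum (exp_at (base setT) b) j =
    (top_sum (exp_at (base B) b) j + top_sum (exp_at (base (~: B)) b) j)%N.
  rewrite !top_base -big_split; apply: eq_bigr => i _ /=.
  by case: b; rewrite hgt_setC.
split=> [b|AB].
  split=> [|j].
    have /eqP : (\sum_a exp_at (base A) b a + \sum_a exp_at (base (~: B)) b
      a)%N =
       (\sum_a exp_at (base B) b a + \sum_a exp_at (base (~: B)) b a)%N.
      rewrite -(sum_expo A p) -(sum_expo (~: B) q) -big_split /=.
      under eq_bigr do rewrite exE.
      have tl C : (\sum_a exp_at (base C) b a = top_sum (exp_at (base C) b) n)%N
        by rewrite top_large.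
      by rewrite (sum_expo setT t) (sum_expo (~: B) q) !tl topT.
    by rewrite eqn_add2r => /eqP.
  rewrite -(leq_add2r (top_sum (exp_at (base (~: B)) b) j)) -topT
    -(topE setT t).
  rewrite -(topE A p) -(topE (~: B) q); apply: top_add => a.
  by rewrite exE.
exists t; rewrite !mem_rcoset.
have sums b j :
    (\sum_(i < n | i < j) exp_at (expo A p) b (sperm b t i) =
      top_sum (exp_at (base A) b) j)%N /\
    (\sum_(i < n | i < j) exp_at (expo (~: B) q) b (sperm b t i) =
      top_sum (exp_at (base (~: B)) b) j)%N.
  have := topE setT t b j; rewrite topT (top_sorted _ (dec_expo k setT t b)).
  under eq_bigr do rewrite -exE.
  rewrite big_split /= -AB.
  have h1 : (\sum_(i < n | i < j) exp_at (expo A p) b (sperm b t i) <=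
    top_sum (exp_at (base A) b) j)%N.
    by rewrite -(topE A p) -sum_initial top_ub ?card_initial_le.
  have h2 : (\sum_(i < n | i < j) exp_at (expo (~: A) q) b (sperm b t i) <=
    top_sum (exp_at (base (~: A)) b) j)%N.
    by rewrite -(topE (~: A) q) -sum_initial top_ub ?card_initial_le.
  have split_eq (x y x' y' : nat) :
    (x <= x' -> y <= y' -> x + y = x' + y' -> x = x' /\ y = y')%N.
    by clear; lia.
  exact: split_eq.
have young_of C s :
  (forall b j, (\sum_(i < n | i < j) exp_at (expo C s) b (sperm b t i) =
    top_sum (exp_at (base C) b) j)%N) -> (t * s^-1)%g \in young C.
  move=> S; apply/youngP => i; rewrite permM; apply/hgt_block => b.
  have := @partial_sums_inj n (fun i => exp_at (expo C s) b (sperm b t i))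
    (fun i => hgt b C (if b then rev_ord i else i)).
  move=> /(_ _ (if b then rev_ord i else i)) /=; rewrite sperm_rev exp_at_expo.
  by case: b (S b) => Sb; rewrite ?rev_ordK; apply=> j; rewrite Sb top_base.
split; apply: young_of => b j; have [s1 s2] := sums b j => //.
by rewrite AB.
Qed.

Definition rev_value a : nat := (n.-1 - a)%N.

Lemma rev_value_inj : injective rev_value.
Proof.
move=> a c; rewrite /rev_value => E; apply: ord_inj; move: E.
by case: a c => a an [c cn] /=; clear -an cn; lia.
Qed.

Lemma Psi_rev s : (PsiN s + Psi rev_value s = \sum_(i < n) i * n.-1)%N.
Proof.
rewrite /Psi -big_split /=; apply: eq_bigr => i _; rewrite -mulnDr /rev_value.
by congr (_ * _)%N; case: (s i) => x xn /=; clear -xn; lia.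
Qed.

Lemma Des_compl_increasing s : block_increasing (~: Des s) rev_value s.
Proof.
apply: block_increasing_adj => i i' ii'; rewrite inE negbK inE => /existsP [j].
move=> /andP [/eqP ji lt]; have ij : j = i by apply: ord_inj; move: ji;
  rewrite ii' => -[].
by move: lt; rewrite ij /rev_value; case: (s i) (s i') => x xn [y yn] /=;
  clear -xn yn; lia.
Qed.

(** When the shapes agree, t lies in the coset of young (Des p) through p, which
    p increases along, and in the coset of the complementary group through q,
    which q decreases along.  Hence Psi q <= Psi t <= Psi p. *)
Lemma pair_Delta_triangular p q :
    pair_Delta ('X_[expo (Des p) p] * 'X_[expo (~: Des q) q]) != 0 ->
  [\/ p = q, (height (Des q) < height (Des p))%N |
      Des p = Des q /\ (PsiN q < PsiN p)%N].
Proof.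
move=> /pair_Delta_split [d young_t].
have [E|ne] := eqVneq (Des p) (Des q); last first.
  apply: Or32; apply: height_strict d _; try exact: Des_positive.
  by rewrite eq_sym.
have [t [tp tq]] := young_t E.
have pinc : block_increasing (Des p) (@nat_of_ord n) p by apply/Des_subP.
have qinc : block_increasing (~: Des p) rev_value q.
  by rewrite E; apply: Des_compl_increasing.
have := Psi_rev t; have := Psi_rev q.
have [tp'|lt1] := Psi_max (@ord_inj n) pinc tp;
  have [tq'|lt2] := Psi_max rev_value_inj qinc tq => e1 e2.
- by apply: Or31; rewrite -tp'.
- by apply: Or33; split=> //; rewrite -tp'; move: e1 e2 lt2; clear; lia.
- by apply: Or33; split=> //; rewrite -tq'.
- by apply: Or33; split=> //; move: e1 e2 lt1 lt2; clear; lia.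
Qed.

Lemma pair_Delta_diag q :
    pair_Delta ('X_[expo (Des q) q] * 'X_[expo (~: Des q) q]) != 0.
Proof.
rewrite -mpolyXD (_ : (_ + _)%MM = expo setT q) ?pair_Delta_full //.
by apply: mnm_sideP => b a; rewrite mnmDE !expoE hgt_setC.
Qed.

Definition a_class s : H' := quot_pi J (a_mon k s).

(** Among the p with nonzero coefficient take q with the largest height, then
    the largest Psi, and pair the relation with the complementary monomial of
    q. *)
Lemma a_class_free (c : 'S_n -> rat) : \sum_s c s *: a_class s = 0 ->
    forall s, c s = 0.
Proof.
move=> E s0; apply/eqP; apply: contraT => cs0.
(* K exceeds all values of Psi, so the order by weight is lexicographic *)
pose K := (\max_s PsiN s).+1.
have PK s : (PsiN s < K)%N by rewrite ltnS; apply: leq_bigmax.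
pose weight s := (height (Des s) * K + PsiN s)%N.
case: (@arg_maxnP _ s0 (fun s => c s != 0) weight cs0) => q cq qmax.
have /eqP : quot_pi J (\sum_s c s *: a_mon k s) = quot_pi J 0.
  by rewrite linear0 linear_sum -[RHS]E; apply: eq_bigr => s _; apply: linearZ.
rewrite quot_pi_eq subr0.
move=> /mem_J /(_ (expo (~: Des q) q));
  rewrite mulr_suml linear_sum (bigD1 q) //= big1.
  rewrite addr0 -scalerAl linearZ a_monE => /eqP;
    rewrite mulf_eq0 (negbTE cq) /=.
  by rewrite (negbTE (pair_Delta_diag q)).
have {}qmax p : c p != 0 -> (weight p <= weight q)%N by apply: qmax.
move=> p pq; rewrite -scalerAl linearZ a_monE /=.
have [->|cp] := eqVneq (c p) 0; first by rewrite scale0r.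
apply/eqP; rewrite mulf_eq0 (negbTE cp) /=;
  apply: contraT => /pair_Delta_triangular [E'|lt|[E' lt]].
- by rewrite E' eqxx in pq.
- have := qmax p cp; rewrite /weight leqNgt => /negP; case.
  have := leq_mul lt (leqnn K); rewrite mulSn; have := PK q; clear; lia.
- by have := qmax p cp; rewrite /weight E' leqNgt ltn_add2l lt.
Qed.

Lemma a_class_span (h : H') : exists c : 'S_n -> rat, h =
    \sum_s c s *: a_class s.
Proof.
suff : h \in spanQ (fun h : H' => exists2 s, xpredT s & h = a_class s).
  by move=> /spanQ_coef [c _ E]; exists c.
rewrite -[h]quot_pi_repr [repr h]mpolyE linear_sum rpred_sum // => m _.
rewrite linearZ rpredZ //; move: (straighten hk m); apply: spanQ_sub.
by move=> _ [s _ ->]; apply: mem_spanQ; exists s.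
Qed.

Definition coord (h : H') : 'S_n -> rat := projT1 (cid (a_class_span h)).

Lemma coordK h : h = \sum_s coord h s *: a_class s.
Proof. by rewrite /coord; case: cid. Qed.

Lemma coord_uniq (c : 'S_n -> rat) : coord (\sum_s c s *: a_class s) =1 c.
Proof.
move=> s; apply/eqP; rewrite -subr_eq0; apply/eqP.
apply: (@a_class_free (fun s => coord (\sum_s c s *: a_class s) s - c s)).
under eq_bigr do rewrite scalerBl.
by rewrite sumrB -coordK subrr.
Qed.

Definition coordl s (h : H') : rat^o := coord h s.

Lemma coordl_linear s : linear (coordl s).
Proof.
move=> x h h'; rewrite {1}[h]coordK {1}[h']coordK scaler_sumr -big_split /=.
under eq_bigr do rewrite scalerA -scalerDl.
by rewrite /coordl coord_uniq.
Qed.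
HB.instance Definition _ s := GRing.isLinear.Build rat H' rat^o *:%R
  (coordl s) (coordl_linear s).

Lemma coord_supp (P : pred 'S_n) (h : H') s :
  h \in spanQ (fun h => exists2 s, P s & h = a_class s) -> ~~ P s ->
    coord h s = 0.
Proof. by move=> /spanQ_coef [c c0 ->] /c0 <-; apply: coord_uniq. Qed.

End Independence.

(** * Bipartitions as drop sets *)

Section Bipartitions.
Arguments hgt : simpl never.
Variables n k : nat.
Hypothesis hk : (1 <= k <= n)%N.
Implicit Types (A B : {set 'I_n}) (s t u : 'S_n) (b : bool)
  (l : bipartition n k).

Local Notation hgt := (hgt k).
Local Notation base := (@base n k).

Definition lam_size b : nat := if b then (n - k).+1 else k.
(** The second partition of a bipartition is listed from the last position
    backwards. *)
Definition lam_pos b (y : nat) : nat := if b then (n.-1 - y)%N else y.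
Definition lam b A : seq nat :=
    mkseq (fun y => hgt b A (lam_pos b y)) (lam_size b).
Definition bip b (p : seq nat * seq nat) := if b then p.2 else p.1.

Lemma lam_size_le b : (lam_size b <= n)%N.
Proof. by rewrite /lam_size; case: b; move: hk; clear; lia. Qed.

Lemma lam_pos_center b y : (lam_size b <= y.+1)%N ->
  (if b then (lam_pos b y < k) else (k <= (lam_pos b y).+1))%N.
Proof. by rewrite /lam_size /lam_pos; case: b; move: hk; clear; lia. Qed.

Lemma lambda_aE s : lambda_a k s = (lam false (Des s), lam true (Des s)).
Proof.
have k1 : (k.-1.+1 = k)%N by move: hk; clear; lia.
congr (_, _); apply: (@eq_from_nth _ 0%N);
  rewrite size_rcons size_map ?size_rev size_iota.
- by rewrite size_mkseq k1.
- move=> y; rewrite k1 => yk; rewrite nth_mkseq // nth_rcons size_map size_iota.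
  case: ltngtP => [lt|gt|->]; last by rewrite hgt_center //= k1.
    rewrite (nth_map 0%N) ?size_iota // nth_iota // /dexp /hgt add1n.
    by rewrite (_ : (y.+1 < k)%N) //; move: lt; clear; lia.
  by move: yk gt; clear; lia.
- by rewrite size_mkseq.
move=> y yk; rewrite nth_mkseq //= nth_rcons size_map size_rev size_iota.
case: ltngtP => [lt|gt|->].
- rewrite (nth_map 0%N) ?size_rev ?size_iota // nth_rev ?size_iota //.
  rewrite nth_iota; last by move: lt; clear; lia.
  rewrite (_ : (k.+1 + _ = (n.-1 - y).+1)%N); last by move: lt; clear; lia.
  rewrite /dexp /hgt (_ : ((n.-1 - y).+1 < k)%N = false) //; move: lt; clear;
    lia.
- by move: yk gt; clear; lia.
by rewrite hgt_center //=; move: hk; clear; lia.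
Qed.

Lemma sumn_take_lam b A j : sumn (take j (lam b A)) =
    top_sum (exp_at (base A) b) j.
Proof.
rewrite top_base /lam /mkseq -map_take take_iota sumnE big_map.
rewrite -[X in iota 0 X]subn0 -/(index_iota 0 _) big_mkord.
have le : (minn j (lam_size b) <= n)%N by apply: leq_trans (geq_minr _ _)
  (lam_size_le b).
rewrite (big_ord_widen n (fun y => hgt b A (lam_pos b y)) le).
rewrite big_mkcond [RHS]big_mkcond; apply: eq_bigr => i _.
have -> : nat_of_ord (if b then rev_ord i else i) = lam_pos b i.
  by rewrite /lam_pos; case: b {le}; rewrite //= subnS; move: (ltn_ord i);
    clear; lia.
rewrite leq_min; case: (ltnP i j) => //= _; case: ltnP => // h.
by rewrite hgt_center //; apply/lam_pos_center/leqW.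
Qed.

Lemma sumn_lam b A : sumn (lam b A) = (\sum_a exp_at (base A) b a)%N.
Proof.
rewrite -(top_large _ (leqnn n)) -sumn_take_lam take_oversize //.
by rewrite size_mkseq lam_size_le.
Qed.

Lemma bidominated_lam A B :
  bidominated (lam false A, lam true A) (lam false B, lam true B) <->
    dom (base A) (base B).
Proof.
have E b : dominated (lam b A) (lam b B) <->
    ((\sum_a exp_at (base A) b a = \sum_a exp_at (base B) b a)%N /\
     forall j, (top_sum (exp_at (base A) b) j <=
       top_sum (exp_at (base B) b) j)%N).
  rewrite /dominated !sumn_lam; split=> [[h1 h2]|[h1 h2]]; split=> // j;
  by have := h2 j; rewrite !sumn_take_lam.
split=> [[/E h0 /E h1]|d]; first by case.
by split; apply/E; apply: d.
Qed.

Lemma lam_neighbours b y : (y.+1 < lam_size b)%N -> exists o c : 'I_n,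
  [/\ neighbours k b o c, lam_pos b y = o & lam_pos b y.+1 = c].
Proof.
rewrite /lam_size /lam_pos => yb.
have on : ((if b then n.-1 - y else y) < n)%N by move: yb hk; case: b; clear;
  lia.
have cn : ((if b then n.-1 - y.+1 else y.+1) < n)%N by clear on; move: yb hk;
  case: b; clear; lia.
exists (Ordinal on), (Ordinal cn); split=> //; rewrite /neighbours /=.
by clear on cn; move: yb hk; case: b; clear; lia.
Qed.

Lemma bipP l b : [/\ size (bip b l) = lam_size b, last 0%N (bip b l) = 0%N &
  forall y, (y.+1 < lam_size b)%N ->
    (nth 0 (bip b l) y.+1 <= nth 0 (bip b l) y <= (nth 0 (bip b l) y.+1).+1)%N].
Proof.
case: l => -[l1 l2] /= h; have /and4P [/= /eqP s1 st1 /eqP s2 st2] := h.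
have H c (s : seq nat) : size s = c -> stair s ->
  [/\ size s = c, last 0%N s = 0%N &
    forall y, (y.+1 < c)%N ->
      (nth 0 s y.+1 <= nth 0 s y <= (nth 0 s y.+1).+1)%N].
  by move=> <- /andP [/eqP l0 /(sortedP 0%N) srt]; split.
by case: b; apply: H.
Qed.

(** Membership in A_set compares consecutive entries of one of the two
    partitions. *)
Lemma A_set_drop l b y (o c : 'I_n) : (y.+1 < lam_size b)%N ->
  neighbours k b o c -> lam_pos b y = o -> lam_pos b y.+1 = c ->
  (drop b o c \in A_set l) =
    (nth 0%N (bip b l) y == (nth 0%N (bip b l) y.+1).+1).
Proof.
rewrite /lam_size /lam_pos inE /part; case: b => /= yb /andP [/eqP oc ko] eo ec.
  rewrite ko (ltnNge o) ko andbF /= (_ : (n - o).-1 = y);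
    last by move: yb eo (ltn_ord o); clear; lia.
  by rewrite (_ : (n - o)%N = y.+1) //; move: yb eo (ltn_ord o); clear; lia.
by rewrite -ec yb (leqNgt k) yb orbF.
Qed.

(** Both sides vanish at the last entry and increase by one exactly at the
    elements of A_set. *)
Lemma bip_nth l b y : (y < lam_size b)%N ->
  nth 0%N (bip b l) y = hgt b (A_set l) (lam_pos b y).
Proof.
have [sz l0 st] := bipP l b.
have [d] := ubnP (lam_size b - y); elim: d y => // d IH y yd yb.
case: (ltnP y.+1 (lam_size b)) => [ylt|yge]; last first.
  rewrite hgt_center ?lam_pos_center // -[RHS]l0 -nth_last sz; congr nth.
  by move: yb yge; clear; lia.
have [o [c [nb eo ec]]] := lam_neighbours ylt.
rewrite eo (hgt_neighbours _ nb) (A_set_drop l ylt nb eo ec) -ec -IH //;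
  last by move: yd ylt; clear; lia.
have := st y ylt; case: eqP => [->|ne] /andP [h1 h2]; first by rewrite addn1.
rewrite addn0; apply/eqP; rewrite eqn_leq h1 andbT -ltnS ltn_neqAle h2 andbT.
by apply/eqP.
Qed.

(** A bipartition is determined by its drop set. *)
Lemma bip_lam l : bip_val l = (lam false (A_set l), lam true (A_set l)).
Proof.
have E b : bip b l = lam b (A_set l).
  have [sz _ _] := bipP l b.
  apply: (@eq_from_nth _ 0%N) => [|y yb]; first by rewrite sz size_mkseq.
  by rewrite nth_mkseq -?sz // bip_nth // -sz.
by rewrite -(E false) -(E true) /bip; case: (bip_val l).
Qed.

Lemma A_set_inj l l' : A_set l = A_set l' -> l = l'.
Proof. by move=> E; apply: val_inj; rewrite /= !bip_lam E. Qed.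

Lemma A_set_positive l : positive (A_set l).
Proof.
move=> i; rewrite inE => /orP [/and3P [] //|/andP [ki _]].
by apply: leq_trans ki; case/andP: hk.
Qed.

Lemma lam_bipartition A : is_bipartition n k (lam false A, lam true A).
Proof.
have st b : stair (lam b A).
  apply/andP; split.
    rewrite -nth_last size_mkseq;
      have sb : (0 < lam_size b)%N by rewrite /lam_size; case: b; case/andP: hk.
    by rewrite nth_mkseq ?prednK // hgt_center // lam_pos_center // prednK.
  apply/(sortedP 0%N) => y; rewrite size_mkseq => yb.
  have [o [c [nb eo ec]]] := lam_neighbours yb.
  rewrite !nth_mkseq //; last exact: ltnW.
  by rewrite /= eo ec (hgt_neighbours _ nb) leq_addr -addn1 leq_add2l leq_b1.
by rewrite /is_bipartition !st !size_mkseq !eqxx.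
Qed.

Definition bip_of A : bipartition n k := Bipartition (lam_bipartition A).

Lemma bip_ofK A : positive A -> A_set (bip_of A) = A.
Proof.
move=> Apos; apply: (@hgt_inj n k _ _ (@A_set_positive _) Apos) => b i.
have lamE : bip b (bip_of A) = lam b A by case: b.
pose y := if b then (n.-1 - i)%N else nat_of_ord i.
have yi : lam_pos b y = i by rewrite /y /lam_pos; case: b {y lamE} => //;
  move: (ltn_ord i); clear; lia.
case: (ltnP y (lam_size b)) => yb.
  by have := bip_nth (bip_of A) yb; rewrite lamE nth_mkseq // yi => /esym.
have h := lam_pos_center (leqW yb); rewrite yi in h.
by rewrite !hgt_center.
Qed.

Definition total_hgt b A : nat := (\sum_(i < n) hgt b A i)%N.

Lemma total_hgt_exp_at A b s : total_hgt b A =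
    (\sum_a exp_at (expo k A s) b a)%N.
Proof.
rewrite [RHS](reindex_inj (@perm_inj _ s)); apply: eq_bigr => i _.
by rewrite exp_at_expo permK.
Qed.

(** The drop j raises the exponent of j indices on the x side, or of n-j
    indices on the y side. *)
Lemma total_hgtE b A : total_hgt b A =
  (\sum_(j in A) if b then (if k <= j then n - j else 0) else if j < k then val
    j else 0)%N.
Proof.
have cnt (P : nat -> nat -> bool) (i : nat) : #|[set j in A | P i j]| =
  (\sum_(j in A) P i j)%N.
  rewrite -sum1_card big_mkcond [RHS]big_mkcond; apply: eq_bigr => j _.
  by rewrite inE; case: (j \in A); case: (P i j).
rewrite /total_hgt /hgt; case: b.
  transitivity (\sum_(i < n) \sum_(j in A) nat_of_bool (k <= j <= i)%N)%N.
    by apply: eq_bigr => i _; apply: (cnt (fun i j => k <= j <= i)%N).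
  rewrite exchange_big; apply: eq_bigr => j jA /=; case: ifP => kj;
    last by rewrite big1.
  rewrite -(card_ord_itv j (leqnn n)) -sum1_card [RHS]big_mkcond /=.
  by apply: eq_bigr => i _; rewrite inE ltn_ord andbT; case: ifP.
transitivity (\sum_(i < n) \sum_(j in A) nat_of_bool (i < j < k)%N)%N.
  by apply: eq_bigr => i _; apply: (cnt (fun i j => i < j < k)%N).
rewrite exchange_big; apply: eq_bigr => j jA /=; case: ifP => jk; last first.
  by rewrite big1 // => i _; rewrite andbF.
rewrite -[RHS]subn0 -(card_ord_itv 0 (ltnW (ltn_ord j))) -sum1_card
  [RHS]big_mkcond /=.
by apply: eq_bigr => i _; rewrite inE andbT; case: ifP.
Qed.

Lemma part_gt l (i : 'I_n) : (0 < i)%N ->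
  (i \in A_set l) = if (k <= i)%N then
    (part l.2 (n - i).+1 < part l.2 (n - i))%N
                    else (part l.1 i.+1 < part l.1 i)%N.
Proof.
move=> i0; rewrite inE i0 /=; case: (leqP k i) => ki.
  rewrite /= /part /=.
  have [_ _ /(_ (n - i).-1)] := bipP l true;
    rewrite /= (ltn_predK (m := 0)) ?subn_gt0 //.
  have -> : (n - i < lam_size true)%N by rewrite /lam_size;
    move: ki (ltn_ord i); clear; lia.
  by move=> /(_ isT); move: (nth _ _ _) (nth _ _ _) => x y; clear; lia.
rewrite orbF /= /part /=.
have [_ _ /(_ i.-1)] := bipP l false; rewrite /= prednK // => /(_ ki).
by move: (nth _ _ _) (nth _ _ _) => x y; clear; lia.
Qed.

Lemma has_bidegreeE (t1 t2 : nat) l :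
  has_bidegree t1 t2 l =
    (total_hgt true (A_set l) == t1) && (total_hgt false (A_set l) == t2).
Proof.
rewrite /has_bidegree !total_hgtE; congr (_ && _); congr (_ == _).
  rewrite big_geq_mkord big_mkcond [RHS]big_mkcond; apply: eq_bigr => i _.
  case: (leqP k i) => ki; rewrite ?andbF ?andbT; last by case: ifP.
  rewrite part_gt ?ki //; by apply: leq_trans ki; case/andP: hk.
rewrite big_geq_mkord
  (big_ord_widen_cond n (fun i => (part l.1 i.+1 < part l.1 i) && (1 <= i))%N
  id);
  last by case/andP: hk.
rewrite big_mkcond [RHS]big_mkcond; apply: eq_bigr => i _.
case: (posnP i) => [i0|i0]; first by rewrite /= !i0 ltnn andbF; do !case: ifP.
by rewrite part_gt // leqNgt andbT; case: (ltnP i k) => ik /=;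
  rewrite ?andbT ?andbF ?if_same.
Qed.

End Bipartitions.

(** * Modules with a basis, subquotients and averaging *)

Lemma linear_inverse (V W : lmodType rat) (g : {linear V -> W}) :
  injective g -> (forall w, exists v, g v = w) ->
  exists f : {linear W -> V}, cancel f g /\ cancel g f.
Proof.
move=> g_inj /boolp.choice [f fK].
have f_lin : linear f by move=> a u v; apply: g_inj; rewrite linearP !fK.
pose F : {linear W -> V} :=
  HB.pack f (GRing.isLinear.Build rat W V *:%R f f_lin).
by exists F; split=> // v; apply: g_inj; rewrite fK.
Qed.

Lemma sn_isomorphic_sym n (M N : snModule n) (g : {linear N -> M}) :
    injective g -> (forall w, exists v, g v = w) ->
    (forall s v, g (sn_act s v) = sn_act s (g v)) ->
  sn_isomorphic M N.
Proof.
move=> g_inj g_surj g_act; have [f [fK gK]] := linear_inverse g_inj g_surj.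
exists f; split=> [|s v]; first by exists g.
by apply: g_inj; rewrite fK g_act fK.
Qed.

Lemma sn_isomorphic_of n (M N : snModule n) (f : {linear M -> N}) :
    injective f -> (forall w, exists v, f v = w) ->
    (forall s v, f (sn_act s v) = sn_act s (f v)) ->
  sn_isomorphic M N.
Proof.
move=> f_inj f_surj f_act; have [g [gK fK]] := linear_inverse f_inj f_surj.
by exists f; split=> //; exists g.
Qed.

Section BasisRepresentation.
Variables (n : nat) (M : snModule n) (I : finType) (P : {set I}) (b : I -> M).
Variable N : 'S_n -> I -> I -> rat.
Hypothesis b_span : forall v, exists c : I -> rat, v = \sum_(i in P) c i *: b i.
Hypothesis b_free : forall c : I -> rat,
  \sum_(i in P) c i *: b i = 0 -> forall i, i \in P -> c i = 0.
Hypothesis b_act : forall s i, i \in P ->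
  sn_act s (b i) = \sum_(j in P) N s i j *: b j.

Let comb (r : 'rV[rat]_#|P|) : M := \sum_(x < #|P|) r 0 x *: b (enum_val x).

Let comb_linear : linear comb.
Proof.
move=> a u v; rewrite /comb scaler_sumr -big_split; apply: eq_bigr => x _.
by rewrite !mxE scalerDl scalerA.
Qed.

HB.instance Definition _ :=
    GRing.isLinear.Build rat 'rV[rat]_#|P| M *:%R comb comb_linear.

Let comb_inj : injective comb.
Proof.
move=> u v /eqP; rewrite -subr_eq0 -linearB => /eqP E; apply/eqP;
  rewrite -subr_eq0.
move: (u - v) E => {u v} w E; apply/eqP/rowP => x; rewrite mxE.
have [Px|/negP//] := boolP (enum_val x \in P); last by have := enum_valP x.
pose c i := w 0 (enum_rank_in Px i).
have cE (y : 'I_#|P|) : c (enum_val y) = w 0 y by rewrite /c enum_valK_in.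
rewrite -cE; apply: (b_free (c := c)) => //; rewrite big_enum_val -[RHS]E.
by apply: eq_bigr => y _; rewrite cE.
Qed.

Let comb_surj v : exists r, comb r = v.
Proof.
have [c ->] := b_span v; exists (\row_x c (enum_val x)).
by rewrite big_enum_val; apply: eq_bigr => x _; rewrite mxE.
Qed.

Let mx s : 'M[rat]_#|P| := \matrix_(x, y) N s (enum_val x) (enum_val y).

Let comb_mx s r : comb (r *m mx s) = sn_act s (comb r).
Proof.
rewrite /comb linear_sum /=; under [RHS]eq_bigr => x _.
  rewrite linearZ /= b_act ?enum_valP // big_enum_val scaler_sumr.
  over.
rewrite exchange_big; apply: eq_bigr => y _; rewrite mxE scaler_suml.
by apply: eq_bigr => x _; rewrite mxE scalerA.
Qed.

Let mx_mx_repr : mx_repr [set: 'S_n]%G mx.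
Proof.
have ext A B : (forall r : 'rV_#|P|, comb (r *m A) = comb (r *m B)) -> A = B.
  by move=> AB; apply/row_matrixP => x; rewrite !rowE; apply/comb_inj/AB.
split=> [|s t _ _]; apply: ext => r.
  by rewrite comb_mx sn_act1 mulmx1.
by rewrite mulmxA !comb_mx sn_actM.
Qed.

(** The coordinate rows in the basis b identify M with the module of the
    matrices of the action. *)
Lemma basis_representation :
  exists d (rG : mx_representation rat [set: 'S_n]%G d),
    (forall s, \tr (rG s) = \sum_(i in P) N s i i) /\
      sn_isomorphic M (mx_module rG).
Proof.
exists #|P|, (MxRepresentation mx_mx_repr); split=> [s|].
  by rewrite big_enum_val; apply: eq_bigr => x _; rewrite mxE.
by apply: (@sn_isomorphic_sym _ _ (mx_module (MxRepresentation mx_mx_repr))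
  comb).
Qed.
End BasisRepresentation.

Section SubquotientClass.
Variables (n : nat) (M : snModule n) (U W : snSubmodule M).

(** Outside U the value is that of 0; only elements of U are meant. *)
Definition subquot_class (h : M) : subquot_module U W :=
  quot_pi (SnSubmodule (@preim_submod_closed n M U W) (@preim_stable n M U W))
    (insubd (0 : sub_module U) h).

Lemma subquot_class_repr r : exists2 h, h \in sub_pred U & r = subquot_class h.
Proof.
rewrite -[r]quot_pi_repr; case: (repr r) => h hU; exists h => //.
by congr quot_pi; apply: val_inj; rewrite val_insubd hU.
Qed.

Lemma subquot_classP a u v : u \in sub_pred U -> v \in sub_pred U ->
    subquot_class (a *: u + v) = a *: subquot_class u + subquot_class v.
Proof.
move=> uU vU; rewrite /subquot_class -linearP; congr quot_pi; apply: val_inj.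
rewrite val_insubd rpredD ?rpredZ //=.
by rewrite [RHS](_ : _ =
  a *: val (insubd (0 : sub_module U) u) + val (insubd (0 : sub_module U) v)) //
  !val_insubd uU vU.
Qed.

Lemma subquot_class0 : subquot_class 0 = 0.
Proof.
have := @subquot_classP (-1) 0 0 (rpred0 _) (rpred0 _).
by rewrite scaler0 addr0 scaleN1r addNr.
Qed.

Lemma subquot_class_act s u : u \in sub_pred U ->
    subquot_class (sn_act s u) = sn_act s (subquot_class u).
Proof.
move=> uU; rewrite /subquot_class [RHS]quot_actE; congr quot_pi;
  apply: val_inj => /=.
by rewrite [LHS]val_insubd
  sub_stable // -[RHS]/(sn_act s (val (insubd (0 : sub_module U) u))) val_insubd
  uU.
Qed.

Lemma subquot_class_eq0 u : u \in sub_pred U -> subquot_class u = 0 <->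
    u \in sub_pred W.
Proof.
move=> uU; rewrite -subquot_class0 /subquot_class; split=> [/eqP|uW];
  last apply/eqP; rewrite quot_pi_eq inE /=.
  rewrite [X in X \in _](_ : _ =
    val (insubd (0 : sub_module U) u) - val (insubd (0 : sub_module U) 0)) //.
  by rewrite !val_insubd uU rpred0 subr0.
rewrite [X in X \in _](_ : _ =
  val (insubd (0 : sub_module U) u) - val (insubd (0 : sub_module U) 0)) //.
by rewrite !val_insubd uU rpred0 subr0.
Qed.
End SubquotientClass.

Section Averaging.
Variables (n : nat) (M N : snModule n) (g : M -> N).
Hypothesis g_linear : linear g.

(** The equivariant map obtained from a linear map g. *)
Definition average (h : M) : N :=
  #|'S_n|%:R^-1 *: \sum_(s : 'S_n) sn_act s^-1%g (g (sn_act s h)).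

Lemma average_linear : linear average.
Proof.
move=> a u v; rewrite /average scalerA mulrC -scalerA -scalerDr; congr (_ *: _).
rewrite scaler_sumr -big_split; apply: eq_bigr => s _.
by rewrite linearP g_linear linearP.
Qed.

Lemma average_act t h : average (sn_act t h) = sn_act t (average h).
Proof.
rewrite /average [RHS]linearZ [X in _ = _ *: X]linear_sum; congr (_ *: _).
rewrite (reindex_inj (mulgI t^-1%g)); apply: eq_bigr => s _.
by rewrite -[sn_act _ (sn_act t h)]sn_actM mulKVg invMg invgK sn_actM.
Qed.

Lemma average_const h r : (forall s, g (sn_act s h) = sn_act s r) ->
    average h = r.
Proof.
move=> gr; rewrite /average (eq_bigr (fun=> r)).
  rewrite sumr_const -scaler_nat scalerA mulVf ?scale1r //.
  by rewrite Num.Theory.pnatr_eq0 -lt0n; apply/card_gt0P; exists 1%g.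
by move=> s _; rewrite gr -sn_actM mulgV sn_act1.
Qed.
End Averaging.

(** * The bigraded components *)

Section Decomposition.
Variables n k : nat.
Hypothesis hk : (1 <= k <= n)%N.
Implicit Types (A B : {set 'I_n}) (p q s t u : 'S_n) (m : 'X_{1..n + n}).
Implicit Types (l : bipartition n k).

Local Notation J := (J n k).
Local Notation H' := (H' n k).
Local Notation expo := (@expo n k).
Local Notation base := (@base n k).
Local Notation mon_class := (@mon_class n k).
Local Notation a_class := (@a_class n k).
Local Notation height := (@height n k).
Local Notation coord := (coord hk).
Local Notation lower_span := (@lower_span n k).
Local Notation dominated_span := (@dominated_span n k).

Lemma a_classE s : a_class s = mon_class (expo (Des s) s).
Proof. by rewrite /a_class a_monE. Qed.

Lemma act_mon_class A s t : sn_act s (mon_class (expo A t)) =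
    mon_class (expo A (t * s)%g).
Proof.
by rewrite /mon_class -[LHS]/(quot_act s (quot_pi J _)) quot_actE
  -[sn_act _ _]/(pol_act _ _) pol_act_mon.
Qed.

Lemma spanQ_act (S : H' -> Prop) (U : submodClosed H') s :
  (forall v, S v -> sn_act s v \in U) -> forall v, v \in spanQ S ->
    sn_act s v \in U.
Proof.
move=> SU; apply: spanQ_ind => [|a u v Su vU]; first by rewrite linear0 rpred0.
by rewrite linearP rpredD // rpredZ // SU.
Qed.

Lemma mon_class_dominated A B s : dom (base A) (base B) ->
    mon_class (expo A s) \in dominated_span (base B).
Proof.
move=> d; apply: dominated_span_trans (straighten hk (expo A s)).
exact: dom_trans (dom_expo k A s 1%g) d.
Qed.

Lemma dom_expo_base A s m : dom (expo A s) m <-> dom (base A) m.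
Proof. by split; apply: dom_trans; apply: dom_expo. Qed.

Lemma act_dominated B s h :
  h \in dominated_span (base B) -> sn_act s h \in dominated_span (base B).
Proof.
apply: spanQ_act => _ [t /dom_expo_base td ->].
by rewrite -/(a_class t) a_classE act_mon_class mon_class_dominated.
Qed.

(** The image of a descent monomial under s is a monomial of the same shape;
    straightening it cannot go up, and reaching A again would make its shape
    equal to A by antisymmetry. *)
Lemma act_lower A s h : positive A -> h \in lower_span A ->
    sn_act s h \in lower_span A.
Proof.
move=> Apos; apply: spanQ_act => _ [t [/dom_expo_base td tA] ->].
rewrite -/(a_class t) a_classE act_mon_class.
move: (mon_class_dominated (t * s) (dom_refl (base (Des t)))); apply: spanQ_sub.
move=> _ [u /dom_expo_base ud ->]; apply: mem_spanQ; exists u => //; split.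
  exact/dom_expo_base/(dom_trans ud).
apply: contraNneq tA => uA; rewrite uA in ud.
by apply/eqP; apply: (@dom_base_anti n k) => //; apply: Des_positive.
Qed.

Lemma eq_spanQ (V : lmodType rat) (S S' : V -> Prop) :
  (forall v, S v <-> S' v) -> spanQ S =i spanQ S'.
Proof.
move=> E v; apply/idP/idP; apply: spanQ_sub => u Su; apply: mem_spanQ.
  exact/E.
exact/E.
Qed.

Lemma bidominatedE l s : bidominated (lambda_a k s) l <->
    dom (expo (Des s) s) (base (A_set l)).
Proof. by rewrite lambda_aE // bip_lam // bidominated_lam // dom_expo_base. Qed.

Lemma lambda_a_eq l s : lambda_a k s = l <-> Des s = A_set l.
Proof.
rewrite lambda_aE //; split=> [E|->]; last by rewrite -bip_lam.
rewrite -[LHS](bip_ofK hk (@Des_positive _ _)); congr A_set; exact: val_inj.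
Qed.

Lemma I_leE l : I_le l =i dominated_span (base (A_set l)).
Proof.
apply: eq_spanQ => h; split=> -[s d ->]; exists s => //; exact/bidominatedE.
Qed.

Lemma I_ltE l : I_lt l =i lower_span (A_set l).
Proof.
apply: eq_spanQ => h; split=> -[s [d ne] ->]; exists s => //; split;
  try exact/bidominatedE.
  by apply/eqP => /lambda_a_eq.
by move=> /lambda_a_eq/eqP; apply/negP.
Qed.

Lemma I_le_stable l : sn_stable (I_le l).
Proof. by move=> s h; rewrite !I_leE; apply: act_dominated. Qed.

Lemma I_lt_stable l : sn_stable (I_lt l).
Proof.
by move=> s h; rewrite !I_ltE; apply: act_lower; apply: (A_set_positive hk).
Qed.

Lemma a_class_I_le l p : Des p = A_set l -> a_class p \in I_le l.
Proof.
move=> E; rewrite I_leE; apply: mem_spanQ; exists p => //.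
by apply/dom_expo_base; rewrite E; apply: dom_refl.
Qed.

Lemma coord_lower A h p : h \in lower_span A -> Des p = A -> coord h p = 0.
Proof.
move=> hA pA; apply: (@coord_supp n k hk (fun s => Des s != A));
  last by rewrite pA eqxx.
by move: hA; apply: spanQ_sub => _ [s [_ ne] ->]; apply: mem_spanQ; exists s.
Qed.

Lemma coord_dominated B h p : h \in dominated_span (base B) -> coord h p != 0 ->
  dom (base (Des p)) (base B).
Proof.
move=> hB cp; suff /asboolP : `[< dom (base (Des p)) (base B) >] by [].
apply: contraNT cp => nd; apply/eqP.
apply: (@coord_supp n k hk (fun s => `[< dom (base (Des s)) (base B) >])) => //.
move: hB; apply: spanQ_sub => _ [s /dom_expo_base d ->]; apply: mem_spanQ;
  exists s => //.
exact/asboolP.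
Qed.

(** The projection onto the descent monomials of shape l along the others. *)
Definition proj l (h : H') : H' :=
    \sum_(p | Des p == A_set l) coord h p *: a_class p.

Lemma proj_I_le l h : proj l h \in I_le l.
Proof.
apply: rpred_sum => p /eqP pA; apply: rpredZ; exact: a_class_I_le.
Qed.

Lemma proj_linear l : linear (proj l).
Proof.
move=> a u v; rewrite /proj scaler_sumr -big_split; apply: eq_bigr => p _.
by rewrite -!/(coordl hk p _) linearP scalerDl scalerA.
Qed.

Lemma sub_proj_lower l h : h \in I_le l ->
    h - proj l h \in lower_span (A_set l).
Proof.
rewrite I_leE => hl;
  rewrite {1}[h](coordK hk) (bigID (fun p => Des p == A_set l)) /=.
rewrite /proj addrAC subrr add0r rpred_sum // => p ne.
have [->|cp] := eqVneq (coord h p) 0; first by rewrite scale0r rpred0.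
rewrite rpredZ //; apply: mem_spanQ; exists p => //; split=> //.
exact/dom_expo_base/(coord_dominated hl).
Qed.

(** From here on R l stands for the quotient of [I_le l] by [I_lt l], known only
    through the properties of its class map. *)
Variables (R : bipartition n k -> snModule n) (toR : forall l, H' -> R l).
Hypothesis toR_linear : forall l a (u v : H'), u \in I_le l -> v \in I_le l ->
  toR l (a *: u + v) = a *: toR l u + toR l v.
Hypothesis toR_equivariant : forall l s (u : H'), u \in I_le l ->
  toR l (sn_act s u) = sn_act s (toR l u).
Hypothesis toR_kernel : forall l (u : H'), u \in I_le l -> toR l u = 0 <->
  u \in I_lt l.
Hypothesis toR_onto : forall l (r : R l), exists2 u, u \in I_le l & r = toR l u.

Lemma toR0 l : toR l 0 = 0.
Proof. by have := toR_linear (-1) (rpred0 (I_le l)) (rpred0 (I_le l));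
  rewrite scaler0 addr0 scaleN1r addNr. Qed.

Lemma toRZ l a (u : H') : u \in I_le l -> toR l (a *: u) = a *: toR l u.
Proof. by move=> ul; have := toR_linear a ul (rpred0 (I_le l));
  rewrite !addr0 toR0 addr0. Qed.

Lemma toR_sum l (I : Type) (r : seq I) (P : pred I) (F : I -> H') :
  (forall i, P i -> F i \in I_le l) ->
  toR l (\sum_(i <- r | P i) F i) = \sum_(i <- r | P i) toR l (F i).
Proof.
move=> FU; suff [] : toR l (\sum_(i <- r | P i) F i) =
  \sum_(i <- r | P i) toR l (F i) /\
  \sum_(i <- r | P i) F i \in I_le l by [].
elim/big_rec2: _ => [|i x y Pi [E yU]]; first by rewrite toR0 rpred0.
have := toR_linear 1 (FU i Pi) yU; rewrite !scale1r E => ->; split=> //.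
by rewrite rpredD ?FU.
Qed.

Lemma toR_eq0 l h : h \in I_le l -> toR l h = 0 <-> h \in lower_span (A_set l).
Proof. by move=> hl; rewrite -I_ltE; apply: toR_kernel. Qed.

Lemma toR_proj l h : h \in I_le l -> toR l (proj l h) = toR l h.
Proof.
move=> hl; have pl := proj_I_le l h.
have /(toR_eq0 _) h0 := sub_proj_lower hl.
have hpl : h - proj l h \in I_le l by apply: rpredB.
by have := toR_linear 1 hpl pl; rewrite scale1r subrK scale1r h0 // add0r.
Qed.

Lemma toR_a_class_free l (c : 'S_n -> rat) :
  \sum_(p | Des p == A_set l) c p *: toR l (a_class p) = 0 ->
  forall p, Des p = A_set l -> c p = 0.
Proof.
move=> E p pA; pose h := \sum_(p | Des p == A_set l) c p *: a_class p.
have hl : h \in I_le l.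
  by apply: rpred_sum => q /eqP qA; apply: rpredZ; apply: a_class_I_le.
have : toR l h = 0.
  rewrite -E /h toR_sum => [|q /eqP qA]; last by apply: rpredZ;
    apply: a_class_I_le.
  by apply: eq_bigr => q /eqP qA; rewrite toRZ //; apply: a_class_I_le.
move=> /(toR_eq0 hl) /coord_lower /(_ pA).
have -> : h = \sum_q (if Des q == A_set l then c q else 0) *: a_class q.
  by rewrite /h big_mkcond; apply: eq_bigr => q _; case: ifP; rewrite ?scale0r.
by rewrite coord_uniq pA eqxx.
Qed.

Lemma toR_a_class_span l (r : R l) : exists c : 'S_n -> rat,
  r = \sum_(p | Des p == A_set l) c p *: toR l (a_class p).
Proof.
have [h hl ->] := toR_onto r; exists (coord h).
rewrite -(toR_proj hl) /proj toR_sum => [|q /eqP qA].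
  by apply: eq_bigr => q /eqP qA; rewrite toRZ //; apply: a_class_I_le.
by apply: rpredZ; apply: a_class_I_le.
Qed.

Lemma mon_class_I_le l s : mon_class (expo (A_set l) s) \in I_le l.
Proof. by rewrite I_leE; apply: mon_class_dominated; apply: dom_refl. Qed.

(** The classes of the monomials of shape l satisfy the hypotheses of
    [des_expand] by [sum_coset_lower]. *)
Lemma toR_a_class_act l s p : Des p = A_set l ->
  sn_act s (toR l (a_class p)) =
  \sum_(q | Des q == A_set l) des_coef (A_set l) (p * s)%g q *: toR l
    (a_class q).
Proof.
move=> pA; rewrite -toR_equivariant; last exact: a_class_I_le.
rewrite a_classE pA act_mon_class.
rewrite (@des_expand n (R l) (A_set l)
  (fun u => toR l (mon_class (expo (A_set l) u)))).
- by apply: eq_bigr => q /eqP qA; rewrite a_classE qA.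
- by move=> h t hA; rewrite (@expo_coset n k _ t) // mem_rcoset mulgK.
move=> j t jA; rewrite -toR_sum => [|u _]; last exact: mon_class_I_le.
apply/toR_eq0; first by apply: rpred_sum => u _; apply: mon_class_I_le.
by apply: sum_coset_lower => //; apply: (A_set_positive hk jA).
Qed.

Lemma R_solomon l : is_solomon_rep (A_set l) (R l).
Proof.
pose P := [set p | Des p == A_set l].
have sumP (V : nmodType) (F : 'S_n -> V) : \sum_(p in P) F p =
  \sum_(p | Des p == A_set l) F p.
  by apply: eq_bigl => p; rewrite inE.
have [|||d [rG [tr iso]]] :=
  @basis_representation n (R l) _ P (fun p => toR l (a_class p))
  (fun s p q => des_coef (A_set l) (p * s)%g q).
- by move=> r; have [c ->] := toR_a_class_span r; exists c; rewrite sumP.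
- by move=> c; rewrite sumP => E p; rewrite inE => /eqP;
  apply: toR_a_class_free.
- by move=> s p; rewrite inE => /eqP pA; rewrite sumP; apply: toR_a_class_act.
by exists d, rG; split=> // s; rewrite tr sumP solomon_charE.
Qed.

Definition toR_of_proj l (h : H') : R l := toR l (proj l h).

Lemma toR_of_proj_linear l : linear (toR_of_proj l).
Proof. by move=> a u v;
  rewrite /toR_of_proj proj_linear toR_linear ?proj_I_le. Qed.

Definition avg l : H' -> R l := average (toR_of_proj l).

Lemma avg_linear l : linear (avg l).
Proof. exact/average_linear/toR_of_proj_linear. Qed.
HB.instance Definition _ l :=
    GRing.isLinear.Build rat H' (R l) *:%R (avg l) (avg_linear l).

(** On [I_le l] the class map is already equivariant and ignores the
    difference between h and its projection. *)
Lemma avg_I_le l h : h \in I_le l -> avg l h = toR l h.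
Proof.
move=> hl; apply: average_const => s; rewrite /toR_of_proj toR_proj;
  last exact: I_le_stable.
exact: toR_equivariant.
Qed.

Lemma avg_dominated l B h : h \in dominated_span (base B) -> avg l h != 0 ->
  dom (base (A_set l)) (base B).
Proof.
move=> hB; apply: contraPP => nd; apply/negP; rewrite negbK; apply/eqP.
apply: average_const => s;
  rewrite linear0 /toR_of_proj /proj big1 => [|p /eqP pA]; first exact: toR0.
have [->|cp] := eqVneq (coord (sn_act s h) p) 0; first by rewrite scale0r.
by case: nd; rewrite -pA; apply: coord_dominated cp; apply: act_dominated.
Qed.

Variables t1 t2 : nat.
Local Notation total_hgt := (@total_hgt n k).
Local Notation bideg A :=
  ((total_hgt true A == t1) && (total_hgt false A == t2)).

(** Straightening keeps the bidegree. *)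
Lemma coord_Hcomp (h : H') p : h \in Hcomp_pred t1 t2 -> coord h p != 0 ->
    bideg (Des p).
Proof.
move=> /asboolP [f ft ->] cp; apply: contraNT cp => nb; apply/eqP.
apply: (@coord_supp n k hk (fun s => bideg (Des s))) => //.
rewrite [f]mpolyE linear_sum big_seq rpred_sum // => m /ft [m1 m2].
rewrite linearZ rpredZ //; move: (straighten hk m);
  apply: spanQ_sub => _ [s d ->].
apply: mem_spanQ; exists s => //; rewrite !(total_hgt_exp_at k _ _ s).
by rewrite (proj1 (d true)) (proj1 (d false)) /exp_at -m1 -m2 !eqxx.
Qed.

Lemma I_le_Hcomp l h : has_bidegree t1 t2 l -> h \in I_le l ->
    h \in Hcomp_pred t1 t2.
Proof.
rewrite (has_bidegreeE hk) => /andP [/eqP l1 /eqP l2]; rewrite I_leE.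
have [H0 HP] := Hcomp_submod_closed n k t1 t2.
move: h; apply: spanQ_ind => // a u v [s d ->] vH; apply: HP => //.
apply/asboolP; exists (a_mon k s) => // m; rewrite a_monE msuppX inE => /eqP ->.
split; first by rewrite -l1 (total_hgt_exp_at k _ _ 1%g) -(proj1 (d true)).
by rewrite -l2 (total_hgt_exp_at k _ _ 1%g) -(proj1 (d false)).
Qed.

Local Notation index := {l : bipartition n k | has_bidegree t1 t2 l}.
Local Notation sumR := (dsum_module (fun l : index => R (sval l))).

Definition avg_all (h : Hcomp n k t1 t2) : sumR :=
  [ffun l : index => avg (sval l) (sub_val h) : R (sval l)].

Lemma avg_all_linear : linear avg_all.
Proof.
move=> a u v; apply/ffunP => l; rewrite !ffunE.
by rewrite -linearP.
Qed.
HB.instance Definition _ := GRing.isLinear.Build rat (Hcomp n k t1 t2) sumR *:%R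
  avg_all avg_all_linear.

Lemma avg_all_act s h : avg_all (sn_act s h) = sn_act s (avg_all h).
Proof.
apply/ffunP => l; rewrite !ffunE.
exact: (average_act (toR_of_proj (sval l)) s (sub_val h)).
Qed.

(** Let q have a nonzero coordinate in h and a shape l of largest height.
    Only descent monomials of shape l contribute to the l-component, which is
    therefore the class of the projection of h. *)
Lemma avg_all_inj : injective avg_all.
Proof.
move=> u v /eqP; rewrite -subr_eq0 -linearB => /eqP E; apply/eqP;
  rewrite -subr_eq0.
move: (u - v) E => {u v} h E.
have h0 (l : index) : avg (sval l) (sub_val h) = 0.
  by have /ffunP/(_ l) := E; rewrite !ffunE.
apply/eqP/val_inj => /=; rewrite [LHS](coordK hk).
have [/existsP [q0 cq0]|/existsPn none] :=
  boolP [exists q, coord (sub_val h) q != 0]; last first.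
  by rewrite big1 // => q _; have := none q; rewrite negbK => /eqP ->;
    rewrite scale0r.
case: (@arg_maxnP _ q0 (fun q => coord (sub_val h) q != 0)
  (fun q => height (Des q)) cq0) => q cq qmax.
have Apos := @Des_positive n q.
pose l := bip_of hk (Des q); have lA : A_set l = Des q by apply: bip_ofK.
have lb : has_bidegree t1 t2 l.
  by rewrite (has_bidegreeE hk) lA; apply: coord_Hcomp cq; case: (h).
have := h0 (exist _ l lb); rewrite /= [sub_val h](coordK hk) linear_sum.
rewrite (bigID (fun p => Des p == A_set l)) /= [X in _ + X]big1 ?addr0;
  last first.
  move=> p ne; rewrite linearZ /=.
  have [->|cp] := eqVneq (coord (sub_val h) p) 0; first by rewrite scale0r.
  have [->|ap] := eqVneq (avg l (a_class p)) 0; first by rewrite scaler0.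
  have /(avg_dominated (B := Des p)) d := ap.
  have {}d : dom (base (A_set l)) (base (Des p)).
    by apply: d; apply: mem_spanQ; exists p => //; apply/dom_expo_base/dom_refl.
  have := height_strict (@A_set_positive n k hk l) (@Des_positive n p) d.
  rewrite eq_sym ne lA => /(_ isT); have := qmax p cp; rewrite /= leqNgt.
  by move=> /negP.
rewrite (eq_bigr (fun p => coord (sub_val h) p *: toR l (a_class p)));
  last first.
  by move=> p /eqP pA; rewrite linearZ /= avg_I_le //; apply: a_class_I_le.
by move=> /toR_a_class_free/(_ q)/(_ (esym lA)) c0; rewrite c0 eqxx in cq.
Qed.

Lemma sub_sumR (u v : sumR) (l : index) : (u - v : sumR) l = u l - v l.
Proof. by rewrite [LHS]ffunE [X in _ + X]ffunE. Qed.

(** Induction on a strict bound d for the heights at which r is nonzero.  The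
    components of height d are lifted to elements of [I_le l]; their images
    agree with r there and add nothing higher, so r minus the image has bound
    d. *)
Lemma avg_all_surj (r : sumR) : exists h, avg_all h = r.
Proof.
have [d] : exists d, forall l : index, r l != 0 ->
  (height (A_set (sval l)) < d)%N.
  exists (\max_(l : index) height (A_set (sval l))).+1 => l _.
  by rewrite ltnS (leq_bigmax l).
elim: d r => [|d IH] r rd.
  exists 0; rewrite linear0; apply/ffunP => l; rewrite ffunE.
  by apply/esym/eqP; apply: contraT => /rd.
have ex_h (l : index) : exists h : H', h \in I_le (sval l) /\
    if height (A_set (sval l)) == d then toR (sval l) h = r l else h = 0.
  case: eqP => _; last by exists 0; rewrite rpred0.
  by have [h hl E] := toR_onto (r l); exists h.
have {ex_h} /fin_all_exists [g gP] := ex_h.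
have gH (l : index) : g l \in Hcomp_pred t1 t2.
  by have [gl _] := gP l; apply: I_le_Hcomp gl; apply: (svalP l).
have gsum : \sum_l g l \in Hcomp_pred t1 t2.
  have [H0 HP] := Hcomp_submod_closed n k t1 t2.
  elim/big_rec: _ => // l x _ xH; rewrite -[g l]scale1r; exact: HP.
pose h : Hcomp n k t1 t2 :=
  @SubSpace n _ (SnSubmodule (Hcomp_submod_closed n k t1 t2)
  (@Hcomp_stable n k t1 t2)) (\sum_l g l) gsum.
have off (l l' : index) : l != l' -> (d <= height (A_set (sval l')))%N ->
  avg (sval l') (g l) = 0.
  move=> ll' dl'; have [gl gE] := gP l; case: eqP gE => [ld _|_ ->];
    last exact: linear0.
  apply/eqP; apply: contraT => ne.
  have dd : dom (base (A_set (sval l'))) (base (A_set (sval l))).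
    by apply: avg_dominated ne; rewrite -I_leE.
  have := height_strict (@A_set_positive n k hk _) (@A_set_positive n k hk _)
    dd.
  rewrite ld ltnNge dl'; apply; apply: contraNneq ll' => E.
  by apply/eqP/val_inj/(A_set_inj hk); rewrite /= E.
have agree (l : index) : (d <= height (A_set (sval l)))%N -> avg_all h l = r l.
  move=> dl; rewrite ffunE /= linear_sum (bigD1 l) //= big1 ?addr0 => [|l' ne];
    last exact: off.
  have [gl gE] := gP l; rewrite avg_I_le //; case: eqP gE => [//|/eqP ld ->].
  rewrite toR0; apply/esym/eqP; apply: contraNT ld => /rd.
  by rewrite ltnS eqn_leq dl andbT.
have [|h' h'E] := IH (r - avg_all h).
  move=> l; apply: contraNltn => dl; apply/eqP.
  by rewrite sub_sumR agree // subrr.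
exists (h' + h); rewrite (linearD avg_all) -[RHS](subrK (avg_all h)) -h'E //.
Qed.

Lemma Hcomp_iso : sn_isomorphic (Hcomp n k t1 t2) sumR.
Proof. exact: sn_isomorphic_of avg_all_inj avg_all_surj avg_all_act. Qed.

End Decomposition.

Theorem corollary1p14 (n k t1 t2 : nat) (hk : (1 <= k <= n)%N) :
  exists (le_stable : forall l : bipartition n k, sn_stable (I_le l))
         (lt_stable : forall l : bipartition n k, sn_stable (I_lt l)),
    (forall l : bipartition n k, has_bidegree t1 t2 l ->
       is_solomon_rep (A_set l) (R_module (le_stable l) (lt_stable l)))
    /\ sn_isomorphic (Hcomp n k t1 t2)
         (dsum_module
            (fun l : {l : bipartition n k | has_bidegree t1 t2 l} =>
               R_module (le_stable (sval l)) (lt_stable (sval l)))).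
Proof.
exists (@I_le_stable n k hk), (@I_lt_stable n k hk).
pose U l := SnSubmodule (spanQ_submod_closed _) (@I_le_stable n k hk l).
pose W l := SnSubmodule (spanQ_submod_closed _) (@I_lt_stable n k hk l).
pose c l := @subquot_class n (H' n k) (U l) (W l).
have cP l a (u v : H' n k) : u \in I_le l -> v \in I_le l ->
  c l (a *: u + v) = a *: c l u + c l v.
  exact: (@subquot_classP n (H' n k) (U l) (W l)).
have c_act l s (u : H' n k) : u \in I_le l ->
  c l (sn_act s u) = sn_act s (c l u).
  exact: (@subquot_class_act n (H' n k) (U l) (W l)).
have c_ker l (u : H' n k) : u \in I_le l -> c l u = 0 <-> u \in I_lt l.
  exact: (@subquot_class_eq0 n (H' n k) (U l) (W l)).
have c_onto l r : exists2 u, u \in I_le l & r = c l u.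
  exact: (@subquot_class_repr n (H' n k) (U l) (W l)).
split=> [l _|]; first exact: (R_solomon hk cP c_act c_ker c_onto l).
exact: (Hcomp_iso hk cP c_act c_ker c_onto t1 t2).
Qed.
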